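(* Let $T>0$, $A,C\in\mathbb{R}^{n\times n}$, $B,D\in\mathbb{R}^{n\times m}$, $Q\in\mathbb{S}^n$ with $Q\geq 0$, and $R\in\mathbb{S}^m$ with $R>0$. Suppose that the delayed Riccati equation $$ \begin{cases} \dot\Sigma(s)+\Sigma(s)[A+B\Psi]+[A+B\Psi]^{\mathrm T}\Sigma(s)+[C+D\Psi]^{\mathrm T}\Sigma(s)[C+D\Psi]+Q+\Psi^{\mathrm T}R\Psi=0,\quad 0\leq s\leq T,\\ \Sigma(T)=0, \end{cases} $$ with $$ \Psi=-[R+D^{\mathrm T}\Sigma(0)D]^{-1}[B^{\mathrm T}\Sigma(0)+D^{\mathrm T}\Sigma(0)C], $$ admits a solution $\Sigma(\cdot)\in C([0,T];\mathbb{S}^n_+)$. Then the linear feedback strategy $\bar\Theta_{ES}:=\Psi$ is an equilibrium strategy (in the sense defined in the context).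
   Context: $\mathbb{S}^n$ is the space of real symmetric $n\times n$ matrices, $\mathbb{S}^n_+$ the subset of positive semidefinite ones; $M\geq N$ (resp. $M>N$) means $M-N$ is positive semidefinite (resp. positive definite). $(\Omega,\mathcal F,\mathbb P)$ is a complete probability space carrying a one-dimensional standard Brownian motion $W$, and $\mathbb F=\{\mathcal F_s\}_{s\geq 0}$ is its natural filtration augmented by all $\mathbb P$-null sets. $L^2_{\mathbb F}(a,b;\mathbb{R}^m)$ denotes the $\mathbb F$-progressively measurable processes $\varphi:[a,b]\times\Omega\to\mathbb{R}^m$ ($b$ may be $\infty$) with $\mathbb E\int_a^b|\varphi(s)|^2ds<\infty$. A solution of the delayed Riccati equation is a function $\Sigma(\cdot)$ on $[0,T]$ satisfying the equation with the constant matrix $\Psi$ determined by the value $\Sigma(0)$ of the unknown itself. Cost functional: for $t\geq 0$, a square-integrable $\mathcal F_t$-measurable initial state $\xi$ and a control $u(\cdot)\in L^2_{\mathbb F}(t,t+T;\mathbb{R}^m)$, let $X$ solve $dX(s)=[AX(s)+Bu(s)]ds+[CX(s)+Du(s)]dW(s)$ on $[t,t+T]$, $X(t)=\xi$, and set $$\mathcal J(t,\xi;u(\cdot))=\mathbb E\int_t^{t+T}\big[\langle QX(s),X(s)\rangle+\langle Ru(s),u(s)\rangle\big]ds.$$ Equilibrium strategy: a constant matrix $\bar\Theta_{ES}\in\mathbb{R}^{m\times n}$ is an equilibrium strategy if, for every $x\in\mathbb{R}^n$, every $t\in[0,\infty)$ and every $u(\cdot)\in L^2_{\mathbb F}(t,\infty;\mathbb{R}^m)$,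 $$\liminf_{\varepsilon\to0^+}\frac{\mathcal J(t,\bar X(t);u^\varepsilon(\cdot))-\mathcal J(t,\bar X(t);\bar\Theta_{ES}\bar X(\cdot))}{\varepsilon}\geq 0,$$ where $\bar X$ solves $d\bar X(s)=[A+B\bar\Theta_{ES}]\bar X(s)ds+[C+D\bar\Theta_{ES}]\bar X(s)dW(s)$ on $[0,\infty)$, $\bar X(0)=x$, and, for $0<\varepsilon<T$, $u^\varepsilon(s)=u(s)$ for $s\in[t,t+\varepsilon)$ and $u^\varepsilon(s)=\bar\Theta_{ES}X^\varepsilon(s)$ for $s\in[t+\varepsilon,t+T]$, with $X^\varepsilon$ the solution of $dX^\varepsilon(s)=[AX^\varepsilon(s)+Bu^\varepsilon(s)]ds+[CX^\varepsilon(s)+Du^\varepsilon(s)]dW(s)$ on $[t,t+T]$, $X^\varepsilon(t)=\bar X(t)$. *)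

(* Defs.v *)
From HB Require Import structures.
From mathcomp Require Import all_boot all_order all_algebra.
From mathcomp Require Import all_classical all_reals all_analysis.

Set Implicit Arguments.
Unset Strict Implicit.
Unset Printing Implicit Defensive.

Import Order.TTheory GRing.Theory Num.Theory.
Import numFieldNormedType.Exports.

Local Open Scope classical_set_scope.
Local Open Scope ring_scope.

Definition psdmx (R : realType) (n : nat) (M : 'M[R]_n) : Prop :=
  M^T = M /\ forall x : 'cV[R]_n, 0 <= (x^T *m M *m x) 0 0.

Definition pdmx (R : realType) (n : nat) (M : 'M[R]_n) : Prop :=
  M^T = M /\ forall x : 'cV[R]_n, x != 0 -> 0 < (x^T *m M *m x) 0 0.

Definition sqnorm (R : realType) (n : nat) (v : 'cV[R]_n) : R :=
  \sum_(i < n) v i 0 ^+ 2.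

(* A process is a function of time and of the outcome; only its values on the
   relevant time set matter. *)
Definition process (R : realType) (Omega : Type) (n : nat) : Type :=
  R -> Omega -> 'cV[R]_n.

Section brownian_motion.
Context {R : realType} {d : measure_display} {Omega : measurableType d}.

Definition past_events (W : R -> Omega -> R) (s : R) : set (set Omega) :=
  [set E | exists r : R, 0 <= r <= s /\
     exists2 V : set R, measurable V & E = W r @^-1` V].

(* W is real-valued and indexed by R, but only its values at times s >= 0 are
   used. *)
Definition brownian_motion (P : probability Omega R) (W : R -> Omega -> R)
    : Prop :=
  [/\ forall s : R, 0 <= s -> measurable_fun [set: Omega] (W s),
      {ae P, forall w, W 0 w = 0},
      {ae P, forall w, {within `[0, +oo[, continuous (fun s : R => W s w)}},
      forall s t : R, 0 <= s -> s < t -> forall V : set R, measurable V ->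
        P ((W t \- W s) @^-1` V) = normal_prob 0 (Num.sqrt (t - s)) V &
      forall s t : R, 0 <= s -> s < t -> forall (E : set Omega) (V : set R),
        <<s past_events W s >> E -> measurable V ->
        let U := (W t \- W s) @^-1` V in P (E `&` U) = (P E * P U)%E].

(* generators of the sigma-algebra F_s of the augmented natural filtration *)
Definition filtration_gen (P : probability Omega R) (W : R -> Omega -> R)
    (s : R) : set (set Omega) :=
  past_events W s `|` P.-negligible.

Notation F_ P W s := (g_sigma_algebraType (filtration_gen P W s)).

(* Progressive measurability on a time interval D = `[a, b] or `[a, +oo[ :
   for s in D, the set D `&` `]-oo, s] is the interval `[a, s]. *)
Definition progressive (P : probability Omega R) (W : R -> Omega -> R)
    (D : set R) (n : nat) (phi : process R Omega n) : Prop :=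
  forall s : R, D s -> forall i,
    measurable_fun ((D `&` `]-oo, s]) `*` [set: F_ P W s])
      (fun z : R * F_ P W s => phi z.1 z.2 i 0).

Definition L2F (P : probability Omega R) (W : R -> Omega -> R)
    (D : set R) (n : nat) (phi : process R Omega n) : Prop :=
  progressive P W D phi /\
  (\int[P]_w \int[lebesgue_measure]_(s in D) (sqnorm (phi s w))%:E < +oo)%E.

(* The simple process \sum_(k < N) xi_k 1_]t_k, t_k+1] on [a, b]. *)
Record simple_process (P : probability Omega R) (W : R -> Omega -> R)
    (a b : R) (n : nat) := SimpleProcess {
  sp_size : nat ;
  sp_time : nat -> R ;
  sp_coef : nat -> Omega -> 'cV[R]_n ;
  sp_time_bounds : forall k, (k <= sp_size)%N -> a <= sp_time k <= b ;
  sp_time_mono : forall k, (k < sp_size)%N -> sp_time k <= sp_time k.+1 ;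
  sp_coef_meas : forall k, (k < sp_size)%N -> forall i,
    measurable_fun [set: F_ P W (sp_time k)] (fun w => sp_coef k w i 0) ;
  sp_coef_bounded : exists M : R,
    forall k, (k < sp_size)%N -> forall w, sqnorm (sp_coef k w) <= M }.

Definition sp_val P W a b n (S : simple_process P W a b n)
    : process R Omega n :=
  fun s w => \sum_(k < sp_size S)
    (if sp_time S k < s <= sp_time S k.+1 then sp_coef S k w else 0).

Definition sp_int P W a b n (S : simple_process P W a b n)
    : Omega -> 'cV[R]_n :=
  fun w => \sum_(k < sp_size S)
    (W (sp_time S k.+1) w - W (sp_time S k) w) *: sp_coef S k w.

(* I is (a version of) the Ito integral of phi over [a, b] with respect to W:
   the L^2(P)-limit of the integrals of simple processes converging to phi. *)
Definition is_ito_integral (P : probability Omega R) (W : R -> Omega -> R)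
    (a b : R) (n : nat) (phi : process R Omega n) (I : Omega -> 'cV[R]_n)
    : Prop :=
  [/\ L2F P W `[a, b] phi,
      forall i, measurable_fun [set: Omega] (fun w => I w i 0) &
      exists S : nat -> simple_process P W a b n,
        (fun k => \int[P]_w \int[lebesgue_measure]_(s in `[a, b])
           (sqnorm (sp_val (S k) s w - phi s w)%R)%:E)%E @ \oo --> 0%E /\
        (fun k => \int[P]_w (sqnorm (sp_int (S k) w - I w)%R)%:E)%E
           @ \oo --> 0%E].

(* dX(s) = beta(s) ds + sigma(s) dW(s) on [a, b], X(a) = xi *)
Definition ito_process (P : probability Omega R) (W : R -> Omega -> R)
    (a b : R) (n : nat) (xi : Omega -> 'cV[R]_n)
    (beta sigma X : process R Omega n) : Prop :=
  [/\ L2F P W `[a, b] X,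
      {ae P, forall w, forall i,
         {within `[a, b], continuous (fun s : R => X s w i 0)}} &
      forall s : R, a <= s <= b ->
        exists2 I : Omega -> 'cV[R]_n,
          is_ito_integral P W a s sigma I &
          {ae P, forall w, X s w = xi w +
            \col_i (\int[lebesgue_measure]_(r in `[a, s]) beta r w i 0)
            + I w}].

End brownian_motion.

Section control_problem.
Context {R : realType} {d : measure_display} {Omega : measurableType d}.
Variables (P : probability Omega R) (W : R -> Omega -> R).
Variables (n m : nat) (T : R).
Variables (A : 'M[R]_n) (B : 'M[R]_(n, m)) (C : 'M[R]_n) (D : 'M[R]_(n, m)).
Variables (Q : 'M[R]_n) (Rw : 'M[R]_m).

Definition state_process (t : R) (xi : Omega -> 'cV[R]_n)
    (u : process R Omega m) (X : process R Omega n) : Prop :=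
  ito_process P W t (t + T) xi
    (fun s w => A *m X s w + B *m u s w)
    (fun s w => C *m X s w + D *m u s w) X.

(* The state equation is well posed: its solution is unique up to
   indistinguishability, so that the cost does not depend on the choice made
   by xget. *)
Definition cost (t : R) (xi : Omega -> 'cV[R]_n) (u : process R Omega m)
    : \bar R :=
  let X := xget (fun _ _ => 0) [set X | state_process t xi u X] in
  (\int[P]_w \int[lebesgue_measure]_(s in `[t, (t + T)%R])
     (((X s w)^T *m Q *m X s w) 0 0 + ((u s w)^T *m Rw *m u s w) 0 0)%R%:E)%E.

Definition feedback (Theta : 'M[R]_(m, n)) (X : process R Omega n)
    : process R Omega m :=
  fun s w => Theta *m X s w.

Definition closed_loop (Theta : 'M[R]_(m, n)) (x : 'cV[R]_n)
    (X : process R Omega n) : Prop :=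
  forall b : R, 0 <= b ->
    ito_process P W 0 b (cst x)
      (fun s w => (A + B *m Theta) *m X s w)
      (fun s w => (C + D *m Theta) *m X s w) X.

(* u on [t, t + eps), then the feedback Theta along X *)
Definition spike (t eps : R) (Theta : 'M[R]_(m, n)) (u : process R Omega m)
    (X : process R Omega n) : process R Omega m :=
  fun s w => if s < t + eps then u s w else feedback Theta X s w.

Definition equilibrium_strategy (Theta : 'M[R]_(m, n)) : Prop :=
  forall (x : 'cV[R]_n) (Xbar : process R Omega n),
    closed_loop Theta x Xbar ->
  forall t : R, 0 <= t ->
  forall u : process R Omega m, L2F P W `[t, +oo[ u ->
  forall Xeps : R -> process R Omega n,
    (forall eps : R, 0 < eps < T ->
       state_process t (Xbar t) (spike t eps Theta u (Xeps eps)) (Xeps eps)) ->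
  (0 <= limf_einf
     (fun eps : R =>
        (cost t (Xbar t) (spike t eps Theta u (Xeps eps))
         - cost t (Xbar t) (feedback Theta Xbar)) * (eps^-1)%:E)
     (0 : R)^'+)%E.

Definition riccati_gain (S0 : 'M[R]_n) : 'M[R]_(m, n) :=
  - (invmx (Rw + D^T *m S0 *m D) *m (B^T *m S0 + D^T *m S0 *m C)).

(* Sigma has derivative dSigma at s relative to E; for E = `[0, T] this is the
   one-sided derivative at the endpoints. *)
Definition mx_derivative_within (E : set R) (Sigma : R -> 'M[R]_n) (s : R)
    (dSigma : 'M[R]_n) : Prop :=
  forall i j,
    (fun r => (r - s)^-1 * (Sigma r i j - Sigma s i j))
      @ within (E `\ s) (nbhs s) --> dSigma i j.

Definition delayed_riccati_solution (Sigma : R -> 'M[R]_n) : Prop :=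
  let Psi := riccati_gain (Sigma 0) in
  [/\ forall i j, {within `[0, T], continuous (fun s : R => Sigma s i j)},
      forall s : R, 0 <= s <= T -> psdmx (Sigma s),
      forall s : R, 0 <= s <= T ->
        exists2 dSigma : 'M[R]_n,
          mx_derivative_within `[0, T] Sigma s dSigma &
          dSigma + Sigma s *m (A + B *m Psi) + (A + B *m Psi)^T *m Sigma s
          + (C + D *m Psi)^T *m Sigma s *m (C + D *m Psi)
          + Q + Psi^T *m Rw *m Psi = 0 &
      Sigma T = 0].

End control_problem.

(* Main.v *)
Require Import Defs.
From HB Require Import structures.
From mathcomp Require Import all_boot all_order all_algebra.
From mathcomp Require Import all_classical all_reals all_analysis.
From mathcomp Require Import measurable_realfun ring lra.
Import Order.TTheory GRing.Theory Num.Theory.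
Import numFieldNormedType.Exports.

Set Implicit Arguments.
Unset Strict Implicit.
Unset Printing Implicit Defensive.

Local Open Scope classical_set_scope.
Local Open Scope ring_scope.

(** Let $\Psi$ be the gain of the Riccati equation and set
    $v = u - \Psi X$, the deviation of a control from the feedback. Differentiating
    $E\langle \Sigma(s - t) X(s), X(s)\rangle$ and using the Riccati equation
    removes every term that does not contain $v$ ([riccati_square]), so that the
    cost of [u] from the state $\xi$ at time [t] is
    $$E\langle \Sigma(0)\xi, \xi\rangle + E\int_t^{t+T} \big[
      2 \langle G(s) X, v\rangle + \langle (R + D^T \Sigma(s - t) D) v, v\rangle
      \big] ds,$$
    where $G(s)$ is the matrix called [gap] ([cost_identity]). The feedback has
    $v = 0$ and costs exactly the first term. The spike control has $v = 0$ after
    time $t + \varepsilon$, and before it, completing the square bounds the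
    integrand from below by $-c |G(s)|^2 |X(s)|^2$ ([square_lower_bound]). The
    choice of $\Psi$ means precisely that $G(t) = 0$ ([gap_gain]), and $G$ is
    continuous, so $|G| \le e$ on the spike when $\varepsilon$ is small. Since the
    energy of the state over the spike is $O(\varepsilon)$ ([linear_bound]), the cost
    decreases by at most $c' e^2 \varepsilon$ with [e] arbitrarily small, and the
    lower limit of the difference quotient is nonnegative.

    The stochastic analysis needed is a theory of second moments. If
    $dX = \beta ds + \sigma dW$ and likewise for $X'$, then $E[X X']$ has
    derivative $E[X \beta' + \beta X' + \sigma \sigma']$ ([second_moment]). This
    follows, without Ito's formula, from three facts: the isometry of the
    stochastic integral ([ito_isometry]), the martingale property
    ([ito_future_orth]) and pathwise integration by parts for the drifts
    ([ip_drift_int]). The first two reduce to step processes, hence to the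
    independence of a Brownian increment from the augmented past
    ([indep_increment]) and to its first two moments. Vector processes are treated
    coordinate by coordinate.

    Second moments also give the mean-square uniqueness of the state
    ([linear_unique]), so that the cost does not depend on the solution along which
    it is evaluated. Existence is not required: the spike states are given, and for
    the feedback an upper bound of the cost suffices ([cost_le]). *)

(** * Square-integrable functions *)

Section square_integrable.
Context d (T : measurableType d) (R : realType).
Variable mu : {measure set T -> \bar R}.
Implicit Types (f g h : T -> R) (c : R).

Definition L1 f := mu.-integrable [set: T] (EFin \o f).
Definition L2 f := measurable_fun [set: T] f /\ L1 (f * f).
Definition ip f g : R := \int[mu]_x (f x * g x).

Lemma L1_measurable f : L1 f -> measurable_fun [set: T] f.
Proof. by move=> /measurable_int/measurable_EFinP. Qed.

Lemma L1P f : L1 f <->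
  measurable_fun [set: T] f /\ (\int[mu]_x (`|f x|)%:E < +oo)%E.
Proof.
split=> [/integrableP[/measurable_EFinP]//|[mf oo]].
by apply/integrableP; split=> //; exact/measurable_EFinP.
Qed.

Lemma le_L1 f g : measurable_fun [set: T] f ->
  (forall x, `|f x| <= `|g x|) -> L1 g -> L1 f.
Proof.
move=> mf fg; apply: le_integrable => //; first exact/measurable_EFinP.
by move=> x _ /=; rewrite lee_fin.
Qed.

Lemma L1D f g : L1 f -> L1 g -> L1 (f + g).
Proof. exact: integrableD. Qed.

Lemma L1N f : L1 f -> L1 (- f).
Proof. exact: integrableN. Qed.

Lemma L1B f g : L1 f -> L1 g -> L1 (f - g).
Proof. by move=> /L1D + /L1N; apply. Qed.

Lemma L1Z c f : L1 f -> L1 (cst c * f).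
Proof. exact: integrableZl. Qed.

Lemma L1_0 : L1 0.
Proof. exact: integrable0. Qed.

Lemma L1_sum (I : Type) (s : seq I) (p : pred I) (F : I -> T -> R) :
  (forall i, L1 (F i)) -> L1 (\sum_(i <- s | p i) F i).
Proof.
move=> L1F; elim/big_rec: _ => [|i f _ L1f]; first exact: L1_0.
exact: L1D.
Qed.

Lemma L1_bounded (b f : T -> R) (M : R) : measurable_fun [set: T] b ->
  (forall x, `|b x| <= M) -> L1 f -> L1 (b * f).
Proof.
move=> mb bM L1f; apply: (@le_L1 _ (cst M * f)); last exact: L1Z.
  by apply: measurable_funM => //; exact: L1_measurable.
by move=> x; rewrite !fctE !normrM ler_wpM2r// (le_trans (bM x))// ler_norm.
Qed.

Lemma intD f g : L1 f -> L1 g ->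
  \int[mu]_x (f + g) x = \int[mu]_x f x + \int[mu]_x g x.
Proof. by move=> L1f L1g; rewrite RintegralD. Qed.

Lemma intB f g : L1 f -> L1 g ->
  \int[mu]_x (f - g) x = \int[mu]_x f x - \int[mu]_x g x.
Proof. by move=> L1f L1g; rewrite RintegralB. Qed.

Lemma intZ c f : L1 f -> \int[mu]_x (cst c * f) x = c * \int[mu]_x f x.
Proof. by move=> L1f; rewrite RintegralZl. Qed.

Lemma int_sum (I : Type) (s : seq I) (F : I -> T -> R) :
  (forall i, L1 (F i)) ->
  \int[mu]_x (\sum_(i <- s) F i) x = \sum_(i <- s) \int[mu]_x F i x.
Proof.
move=> L1F; elim: s => [|i s IH].
  by rewrite !big_nil Rintegral_cst// mul0r.
by rewrite !big_cons intD// ?IH//; exact: L1_sum.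
Qed.

Lemma le_int f g : L1 f -> L1 g -> (forall x, f x <= g x) ->
  \int[mu]_x f x <= \int[mu]_x g x.
Proof. by move=> L1f L1g fg; apply: le_Rintegral. Qed.

Lemma int_EFin f : L1 f -> (\int[mu]_x (f x)%:E)%E = (\int[mu]_x f x)%:E.
Proof. by move=> L1f; rewrite fineK// integrable_fin_num. Qed.

Lemma L2_measurable f : L2 f -> measurable_fun [set: T] f.
Proof. by case. Qed.

Lemma L2_sqr f : L2 f -> L1 (f * f).
Proof. by case. Qed.

Lemma L2P f : L2 f <->
  measurable_fun [set: T] f /\ (\int[mu]_x (f x ^+ 2)%:E < +oo)%E.
Proof.
split=> -[mf]; first case/L1P => _.
  by under eq_integral do rewrite fctE -expr2 ger0_norm ?sqr_ge0//.
move=> oo; split=> //; apply/L1P; split; first exact: measurable_funM.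
by under eq_integral do rewrite fctE -expr2 ger0_norm ?sqr_ge0//.
Qed.

(** From $2|fg| \le f^2 + g^2$. *)
Lemma L1_mul f g : L2 f -> L2 g -> L1 (f * g).
Proof.
move=> [mf f2] [mg g2]; apply: (@le_L1 _ (f * f + g * g)).
- exact: measurable_funM.
- move=> x; rewrite !fctE normrM [X in _ <= X]ger0_norm; last first.
    by rewrite addr_ge0// -expr2 sqr_ge0.
  rewrite -!expr2 -(real_normK (num_real (f x))) -(real_normK (num_real (g x))).
  have := sqr_ge0 (`|f x| - `|g x|); have := normr_ge0 (f x).
  have := normr_ge0 (g x); nra.
- exact: L1D.
Qed.

Lemma L2D f g : L2 f -> L2 g -> L2 (f + g).
Proof.
move=> L2f L2g; split.
  by apply: measurable_funD; exact: L2_measurable.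
rewrite (_ : _ * _ = f * f + cst 2 * (f * g) + g * g); last first.
  by apply/funext => x; rewrite !fctE; ring.
apply: L1D; [apply: L1D|]; [exact: L2_sqr| |exact: L2_sqr].
by apply: L1Z; exact: L1_mul.
Qed.

Lemma L2_bounded (b f : T -> R) (M : R) : measurable_fun [set: T] b ->
  (forall x, `|b x| <= M) -> L2 f -> L2 (b * f).
Proof.
move=> mb bM [mf f2]; split; first exact: measurable_funM.
rewrite (_ : _ * _ = (b * b) * (f * f)); last by ring.
apply: (@L1_bounded _ _ (M ^+ 2)) => //; first exact: measurable_funM.
by move=> x; rewrite fctE normrM -expr2 lerXn2r// nnegrE// (le_trans _ (bM x)).
Qed.

Lemma L2Z c f : L2 f -> L2 (cst c * f).
Proof. by apply: (@L2_bounded _ _ `|c|). Qed.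

Lemma L2N f : L2 f -> L2 (- f).
Proof. by move=> /(L2Z (-1)); rewrite (_ : cst _ * _ = - f)//; apply/funext => x; rewrite !fctE mulN1r. Qed.

Lemma L2B f g : L2 f -> L2 g -> L2 (f - g).
Proof. by move=> /L2D + /L2N; apply. Qed.

Lemma L2_0 : L2 0.
Proof. by split; [exact: measurable_cst|rewrite mul0r; exact: L1_0]. Qed.

Lemma ipC f g : ip f g = ip g f.
Proof. by apply: eq_Rintegral => x _; rewrite mulrC. Qed.

Lemma ipDl f g h : L2 f -> L2 g -> L2 h -> ip (f + g) h = ip f h + ip g h.
Proof.
move=> L2f L2g L2h; rewrite /ip -intD ?L1_mul//.
by apply: eq_Rintegral => x _; rewrite !fctE mulrDl.
Qed.

Lemma ipZl c f h : L2 f -> L2 h -> ip (cst c * f) h = c * ip f h.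
Proof.
move=> L2f L2h; rewrite /ip -intZ ?L1_mul//.
by apply: eq_Rintegral => x _; rewrite !fctE mulrA.
Qed.

Lemma ipBl f g h : L2 f -> L2 g -> L2 h -> ip (f - g) h = ip f h - ip g h.
Proof.
move=> L2f L2g L2h; rewrite /ip -intB ?L1_mul//.
by apply: eq_Rintegral => x _; rewrite !fctE mulrBl.
Qed.

Lemma ipDr f g h : L2 f -> L2 g -> L2 h -> ip h (f + g) = ip h f + ip h g.
Proof. by move=> *; rewrite ipC ipDl// !(ipC h). Qed.

Lemma ipZr c f h : L2 f -> L2 h -> ip h (cst c * f) = c * ip h f.
Proof. by move=> *; rewrite ipC ipZl// !(ipC h). Qed.

Lemma ipBr f g h : L2 f -> L2 g -> L2 h -> ip h (f - g) = ip h f - ip h g.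
Proof. by move=> *; rewrite ipC ipBl// !(ipC h). Qed.

Lemma ip0l g : ip 0 g = 0.
Proof.
rewrite /ip (@eq_Rintegral _ _ _ mu _ (cst 0)) ?Rintegral_cst ?mul0r//.
by move=> x _; rewrite mul0r.
Qed.

Lemma ip_ge0 f : 0 <= ip f f.
Proof. by apply: Rintegral_ge0 => x _; rewrite -expr2 sqr_ge0. Qed.

Lemma cauchy_schwarz f g : L2 f -> L2 g -> ip f g ^+ 2 <= ip f f * ip g g.
Proof.
move=> L2f L2g.
have key c : 0 <= ip f f - 2 * c * ip f g + c ^+ 2 * ip g g.
  have L2cg : L2 (cst c * g) by exact: L2Z.
  have := ip_ge0 (f - cst c * g).
  rewrite ipBl ?ipBr ?ipZl ?ipZr//; try exact: L2B.
  by rewrite (ipC g f) => /le_trans; apply; lra.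
have := ip_ge0 g; rewrite le_eqVlt => /orP[/eqP g0|g0].
  (* in [key] the right-hand side is then affine and nonnegative, hence constant *)
  rewrite -g0 mulr0 le_eqVlt; apply/orP; left; rewrite sqrf_eq0.
  apply: contraT => fg0.
  have := key ((ip f f + 1) / (2 * ip f g)); rewrite -g0 mulr0 addr0.
  rewrite (_ : 2 * _ * _ = ip f f + 1); last by field.
  by rewrite opprD addNKr ler0N1.
have := key (ip f g / ip g g).
rewrite (_ : _ + _ = (ip f f * ip g g - ip f g ^+ 2) / ip g g); last first.
  by field; rewrite gt_eqF.
by rewrite pmulr_lge0 ?invr_gt0// subr_ge0.
Qed.

Definition L2cvg (f_ : nat -> T -> R) f :=
  (fun k => ip (f_ k - f) (f_ k - f)) @ \oo --> (0 : R).

(** A function of mean square 0 is orthogonal to everything, by the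
    Cauchy-Schwarz inequality: this replaces arguments up to null sets. *)
Lemma ip_eq0 f g : L2 f -> L2 g -> ip f f = 0 -> ip f g = 0.
Proof.
move=> L2f L2g f0; have := cauchy_schwarz L2f L2g.
by rewrite f0 mul0r => fg; apply/eqP; rewrite -sqrf_eq0 eq_le fg sqr_ge0.
Qed.

Lemma L2cvg_ipl (f_ : nat -> T -> R) f g :
  (forall k, L2 (f_ k)) -> L2 f -> L2 g -> L2cvg f_ f ->
  (fun k => ip (f_ k) g) @ \oo --> ip f g.
Proof.
move=> L2f_ L2f L2g f_f; apply/subr_cvg0.
have sq : (fun k => (ip (f_ k) g - ip f g) ^+ 2) @ \oo --> (0 : R).
  apply: (@squeeze_cvgr _ _ _ _ (fun=> 0)
      (fun k => ip (f_ k - f) (f_ k - f) * ip g g)).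
  - near=> k; rewrite sqr_ge0/= -ipBl//.
    by apply: cauchy_schwarz => //; exact: L2B.
  - exact: cvg_cst.
  - by rewrite -(mul0r (ip g g)); apply: cvgM => //; exact: cvg_cst.
apply/norm_cvg0P.
rewrite (_ : (fun _ => _) =
    (fun k => Num.sqrt ((ip (f_ k) g - ip f g) ^+ 2))); last first.
  by apply/funext => k /=; rewrite sqrtr_sqr.
rewrite -(@sqrtr0 R); apply: continuous_cvg => //; exact: sqrt_continuous.
Unshelve. all: by end_near. Qed.

Lemma L2cvg_ip (f_ g_ : nat -> T -> R) f g :
  (forall k, L2 (f_ k)) -> (forall k, L2 (g_ k)) -> L2 f -> L2 g ->
  L2cvg f_ f -> L2cvg g_ g -> (fun k => ip (f_ k) (g_ k)) @ \oo --> ip f g.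
Proof.
move=> L2f_ L2g_ L2f L2g f_f g_g.
have fg : (fun k => ip (f_ k - f) (g_ k - g)) @ \oo --> (0 : R).
  apply: (@squeeze_cvgr _ _ _ _
    (fun k => - (ip (f_ k - f) (f_ k - f) + ip (g_ k - g) (g_ k - g)))
    (fun k => ip (f_ k - f) (f_ k - f) + ip (g_ k - g) (g_ k - g))).
  - near=> k; rewrite -ler_norml.
    have L2fk : L2 (f_ k - f) by exact: L2B.
    have L2gk : L2 (g_ k - g) by exact: L2B.
    have := cauchy_schwarz L2fk L2gk; have := ip_ge0 (f_ k - f).
    have := ip_ge0 (g_ k - g).
    set a := ip _ _; set b := ip (f_ k - f) (f_ k - f); set c := ip _ _ => a0 b0.
    move=> cs; rewrite -(@ler_pXn2r _ 2)// ?nnegrE ?addr_ge0//.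
    rewrite real_normK ?num_real// (le_trans cs)//; nra.
  - by rewrite -oppr0; apply: cvgN; rewrite -(addr0 0); exact: cvgD.
  - by rewrite -(addr0 0); exact: cvgD.
rewrite (_ : (fun _ => _) = (fun k => ip (f_ k - f) (g_ k - g) +
  (ip (f_ k) g + ip f (g_ k) - ip f g))); last first.
  apply/funext => k; rewrite ipBl ?ipBr//; [ring|exact: L2B].
rewrite -[X in _ --> X]add0r; apply: cvgD => //.
rewrite -[X in _ --> X](addrK (ip f g)); apply: cvgB; last exact: cvg_cst.
apply: cvgD; first exact: L2cvg_ipl.
rewrite (_ : (fun _ => _) = (fun k => ip (g_ k) f)); last first.
  by apply/funext => k; rewrite ipC.
by rewrite ipC; exact: L2cvg_ipl.
Unshelve. all: by end_near. Qed.

Lemma L2cvgD (f_ g_ : nat -> T -> R) f g :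
  (forall k, L2 (f_ k)) -> (forall k, L2 (g_ k)) -> L2 f -> L2 g ->
  L2cvg f_ f -> L2cvg g_ g -> L2cvg (fun k => f_ k + g_ k) (f + g).
Proof.
move=> L2f_ L2g_ L2f L2g f_f g_g.
apply: (@squeeze_cvgr _ _ _ _ (fun=> 0) (fun k =>
    2 * ip (f_ k - f) (f_ k - f) + 2 * ip (g_ k - g) (g_ k - g))).
- near=> k; rewrite ip_ge0/=.
  have L2fk : L2 (f_ k - f) by exact: L2B.
  have L2gk : L2 (g_ k - g) by exact: L2B.
  rewrite (_ : f_ k + g_ k - (f + g) = (f_ k - f) + (g_ k - g)); last by ring.
  have := ip_ge0 ((f_ k - f) - (g_ k - g)).
  move: (f_ k - f) (g_ k - g) L2fk L2gk => u v L2u L2v.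
  rewrite ipBl ?ipBr ?ipDl ?ipDr//; try by [exact: L2D|exact: L2B].
  rewrite (ipC v u); lra.
- exact: cvg_cst.
- rewrite -(addr0 0) -[X in X + _](mulr0 2) -[X in _ + X](mulr0 2).
  by apply: cvgD; apply: cvgM => //; exact: cvg_cst.
Unshelve. all: by end_near. Qed.

Lemma L2cvgZ c (f_ : nat -> T -> R) f :
  (forall k, L2 (f_ k)) -> L2 f -> L2cvg f_ f ->
  L2cvg (fun k => cst c * f_ k) (cst c * f).
Proof.
move=> L2f_ L2f f_f; rewrite /L2cvg.
rewrite (_ : (fun _ => _) = (fun k => c ^+ 2 * ip (f_ k - f) (f_ k - f))).
  by rewrite -(mulr0 (c ^+ 2)); apply: cvgM => //; exact: cvg_cst.
apply/funext => k; rewrite -mulrBr ipZl ?ipZr ?expr2 ?mulrA//; try exact: L2B.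
by apply: L2Z; exact: L2B.
Qed.

End square_integrable.

#[global] Hint Resolve L2_0 L2D L2B L2Z L1_mul : core.

Section probability_L2.
Context d (T : measurableType d) (R : realType) (P : probability T R).

Lemma L1_cst (c : R) : L1 P (cst c).
Proof. exact: finite_measure_integrable_cst. Qed.

Lemma L2_cst (c : R) : L2 P (cst c).
Proof. by split=> //; exact: (L1_cst (c * c)). Qed.

Lemma L2_L1 (f : T -> R) : L2 P f -> L1 P f.
Proof. by move=> L2f; have := L1_mul (L2_cst 1) L2f; rewrite mul1r. Qed.

Lemma int_cst (c : R) : \int[P]_x (cst c) x = c.
Proof.
transitivity (c * fine (P setT)); first exact: Rintegral_cst.
by rewrite probability_setT mulr1.
Qed.

End probability_L2.

Lemma aeS d (T : measurableType d) (R : realType)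
    (mu : {measure set T -> \bar R}) (A B : T -> Prop) :
  (forall x, A x -> B x) -> {ae mu, forall x, A x} -> {ae mu, forall x, B x}.
Proof. by move=> AB; exact: filterS. Qed.

(** * Fubini's theorem for real-valued integrals *)

Lemma ae_int_eq d (T : measurableType d) (R : realType)
    (mu : {measure set T -> \bar R}) (f g : T -> R) :
  measurable_fun [set: T] f -> measurable_fun [set: T] g ->
  {ae mu, forall x, f x = g x} -> \int[mu]_x f x = \int[mu]_x g x.
Proof.
move=> mf mg fg; congr fine; apply: ae_eq_integral => //.
- exact/measurable_EFinP.
- exact/measurable_EFinP.
- by apply: filterS fg => x -> _.
Qed.

Lemma norm_int_le d (T : measurableType d) (R : realType)
    (mu : {measure set T -> \bar R}) (f : T -> R) : measurable_fun [set: T] f ->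
  (`|\int[mu]_x f x|%:E <= \int[mu]_x `|f x|%:E)%E.
Proof.
move=> mf; have := @le_abse_integral _ _ _ mu _ (EFin \o f) measurableT.
move=> /(_ ((measurable_EFinP _ _).2 mf)); apply: le_trans.
by rewrite /Rintegral; case: (integral _ _ _) => [r| |]//=; rewrite ?normr0 ?leey ?leNye//.
Qed.

Section fubini.
Context d1 d2 (T1 : measurableType d1) (T2 : measurableType d2) (R : realType).
Variable m1 : {sigma_finite_measure set T1 -> \bar R}.
Variable m2 : {sigma_finite_measure set T2 -> \bar R}.

Lemma int_tensor (g : T1 -> R) (h : T2 -> R) : L1 m1 g -> L1 m2 h ->
  L1 (m1 \x m2)%E (fun z => g z.1 * h z.2) /\
  \int[(m1 \x m2)%E]_z (g z.1 * h z.2) = (\int[m1]_s g s) * \int[m2]_w h w.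
Proof.
move=> L1g L1h.
have mgh : measurable_fun [set: T1 * T2] (fun z => g z.1 * h z.2).
  apply: measurable_funM.
    by apply: (measurableT_comp (L1_measurable L1g)).
  by apply: (measurableT_comp (L1_measurable L1h)).
have L1gh : L1 (m1 \x m2)%E (fun z => g z.1 * h z.2).
  apply/integrable12ltyP; first exact/measurable_EFinP.
  have mh : measurable_fun [set: T2] (fun w => `|h w|%:E).
    apply/measurable_EFinP/measurableT_comp; first exact: normr_measurable.
    exact: L1_measurable L1h.
  have mg : measurable_fun [set: T1] (fun s => `|g s|%:E).
    apply/measurable_EFinP/measurableT_comp; first exact: normr_measurable.
    exact: L1_measurable L1g.
  have e s : (\int[m2]_w `|(g s * h w)%:E| =
      `|g s|%:E * \int[m2]_w `|h w|%:E)%E.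
    rewrite -ge0_integralZl//.
    by apply: eq_integral => w _; rewrite -EFinM -normrM.
  under eq_integral do rewrite e.
  rewrite ge0_integralZr//; last exact: integral_ge0.
  have /L1P[_ goo] := L1g; have /L1P[_ hoo] := L1h.
  by rewrite lte_mul_pinfty ?integral_ge0// ge0_fin_numE// integral_ge0.
split=> //.
have e s : (\int[m2]_w (g s * h w)%:E = (g s * \int[m2]_w h w)%:E)%E.
  by rewrite -intZ// -int_EFin//; exact: L1Z.
rewrite -RintegralZr// /Rintegral -integral12_prod_meas1// /fubini_F /=.
by under eq_integral do rewrite e.
Qed.

(** The real-valued integral is the extended one with infinite values replaced
    by 0, so that measurability holds without integrability. *)
Lemma measurable_int_param (H : T1 * T2 -> R) :
  measurable_fun [set: T1 * T2] H ->
  measurable_fun [set: T1] (fun x => \int[m2]_y H (x, y)).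
Proof.
move=> mH; apply: (@measurableT_comp _ _ _ _ _ _ fine) => //.
have mE : measurable_fun [set: T1 * T2] (EFin \o H) by exact/measurable_EFinP.
rewrite (_ : (fun _ => _) = (fun x => (\int[m2]_y (EFin \o H)^\+ (x, y)) -
    \int[m2]_y (EFin \o H)^\- (x, y))%E); last first.
  apply/funext => x; rewrite [LHS]integralE.
  by congr (_ - _)%E; apply: eq_integral => y _; rewrite ?funeposE ?funenegE.
apply: emeasurable_funB.
- by apply: (measurable_fun_fubini_tonelli_F (m2 := m2) (EFin \o H)^\+%E) => //; exact: measurable_funepos.
- by apply: (measurable_fun_fubini_tonelli_F (m2 := m2) (EFin \o H)^\-%E) => //; exact: measurable_funeneg.
Qed.

Variable F : T1 * T2 -> R.
Hypothesis L1F : L1 (m1 \x m2)%E F.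

Lemma L1_slice1 : {ae m1, forall x, L1 m2 (fun y => F (x, y))}.
Proof. exact: ae_integrable1 L1F. Qed.

Lemma L1_slice2 : {ae m2, forall y, L1 m1 (fun x => F (x, y))}.
Proof. exact: ae_integrable2 L1F. Qed.

(** The inner integral may diverge on a null set, where the real-valued
    integral takes the value 0; this affects neither side. *)
Lemma int_fubini1 : L1 m1 (fun x => \int[m2]_y F (x, y)) /\
  \int[(m1 \x m2)%E]_z F z = \int[m1]_x \int[m2]_y F (x, y).
Proof.
have mF := L1_measurable L1F.
have mG : measurable_fun [set: T1] (fun x => \int[m2]_y F (x, y)).
  exact: measurable_int_param.
have ae : {ae m1, forall x, (\int[m2]_y F (x, y))%:E = fubini_F m2 (EFin \o F) x}.
  by apply: filterS L1_slice1 => x L1x; rewrite -int_EFin.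
split.
  apply/L1P; split => //.
  apply: le_lt_trans ((integrable12ltyP m1 m2 ((measurable_EFinP _ _).2 mF)).1 L1F).
  apply: ge0_le_integral => //.
  - by apply/measurable_EFinP/measurableT_comp.
  - apply: (measurable_fun_fubini_tonelli_F (m2 := m2) (abse \o (EFin \o F))); last by move=> z; exact: abse_ge0.
    by apply: measurableT_comp; last exact/measurable_EFinP.
  - move=> x _; apply: norm_int_le; apply: (measurableT_comp mF); exact: pair1_measurable.
rewrite /Rintegral -integral12_prod_meas1//; congr fine.
apply: ae_eq_integral => //; first exact: (measurable_fubini_F L1F).
  exact/measurable_EFinP.
by apply: filterS ae => x /= -> _.
Qed.

End fubini.

Lemma int_fubini2 d1 d2 (T1 : measurableType d1) (T2 : measurableType d2)
    (R : realType) (m1 : {sigma_finite_measure set T1 -> \bar R})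
    (m2 : {sigma_finite_measure set T2 -> \bar R}) (F : T1 * T2 -> R) :
  L1 (m1 \x m2)%E F -> L1 m2 (fun y => \int[m1]_x F (x, y)) /\
  \int[(m1 \x m2)%E]_z F z = \int[m2]_y \int[m1]_x F (x, y).
Proof.
move=> L1F; have mF := L1_measurable L1F.
have mG : measurable_fun [set: T2] (fun y => \int[m1]_x F (x, y)).
  apply: (@measurable_int_param _ _ T2 T1 R m1 (fun z => F (z.2, z.1))).
  apply: (measurableT_comp (L1_measurable L1F)).
  by apply: measurable_fun_pair.
have ae : {ae m2, forall y, (\int[m1]_x F (x, y))%:E = fubini_G m1 (EFin \o F) y}.
  by apply: filterS (L1_slice2 L1F) => y L1y; rewrite -int_EFin.
split.
  apply/L1P; split => //.
  apply: le_lt_trans ((integrable21ltyP m1 m2 ((measurable_EFinP _ _).2 mF)).1 L1F).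
  apply: ge0_le_integral => //.
  - by apply/measurable_EFinP/measurableT_comp.
  - apply: (measurable_fun_fubini_tonelli_G (m1 := m1) (abse \o (EFin \o F))); last by move=> z; exact: abse_ge0.
    by apply: measurableT_comp; last exact/measurable_EFinP.
  - move=> y _; apply: norm_int_le; apply: (measurableT_comp mF); exact: pair2_measurable.
rewrite /Rintegral -integral21_prod_meas1//; congr fine.
apply: ae_eq_integral => //; first exact: (measurable_fubini_G L1F).
  exact/measurable_EFinP.
by apply: filterS ae => y /= -> _.
Qed.

(** * Moments of the centred normal law *)

Section normal_moments.
Context {R : realType}.
Variable s : R.
Hypothesis s_gt0 : 0 < s.
Local Notation mu := (@lebesgue_measure R).
Local Notation nu := (normal_prob 0 s).
Let q : R -> R := normal_pdf 0 s.

Let q_ge0 x : 0 <= q x. Proof. exact: normal_pdf_ge0. Qed.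

Let mq : measurable_fun [set: R] q. Proof. exact: measurable_normal_pdf. Qed.

Let cq : continuous q.
Proof. by apply: continuous_normal_pdf; rewrite gt_eqF. Qed.

Let qE x : q x = normal_peak s * expR (- x ^+ 2 / (s ^+ 2 *+ 2)).
Proof. by rewrite /q normal_pdfE ?gt_eqF// /normal_fun subr0. Qed.

(** The density is the Radon-Nikodym derivative of the law, which agrees with it
    almost everywhere. *)
Lemma ge0_integral_normal_prob (f : R -> \bar R) :
  (forall x, 0 <= f x)%E -> measurable_fun [set: R] f ->
  (\int[nu]_x f x = \int[mu]_x (f x * (q x)%:E))%E.
Proof.
move=> f0 mf; have dom := normal_prob_dominates 0 s.
rewrite -(Radon_Nikodym_SigmaFinite.change_of_variables dom f0)//.
have ig := Radon_Nikodym_SigmaFinite.f_integrable dom.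
apply: ae_eq_integral => //.
- by apply: emeasurable_funM => //; exact: measurable_int ig.
- by apply: emeasurable_funM => //; exact/measurable_EFinP.
apply: ae_eqe_mul2l; apply: integral_ae_eq => //.
- exact/measurable_EFinP.
- by move=> E _ mE; rewrite -Radon_Nikodym_SigmaFinite.f_integral.
Qed.

Let dq x : is_derive x (1 : R) q (- (x / s ^+ 2) * q x).
Proof.
rewrite (_ : q = fun x => normal_peak s * expR (- x ^+ 2 / (s ^+ 2 *+ 2))); last first.
  by apply/funext => y; rewrite qE.
apply: is_derive_eq.
rewrite /GRing.scale /=.
by field; rewrite gt_eqF.
Qed.

Let dxq x : is_derive x (1 : R) (fun y => y * q y) ((1 - x ^+ 2 / s ^+ 2) * q x).
Proof.
apply: (is_derive_eq (is_deriveM (is_derive_id x (1 : R)) (dq x))).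
rewrite /GRing.scale /=.
by field; rewrite gt_eqF.
Qed.

Let xq_derivable (x : R) : derivable (fun y : R => y * q y) x (1 : R).
Proof. by case: (dxq x). Qed.

Let xq_derive (x : R) :
  'D_1 (fun y : R => y * q y) x = (1 - x ^+ 2 / s ^+ 2) * q x.
Proof. by case: (dxq x). Qed.

Let cxq : continuous (fun x : R => x * q x).
Proof. by move=> x; apply: cvgM; [exact: cvg_id|exact: cq]. Qed.

Let cvg_xq : (x * q x) @[x --> +oo%R] --> (0 : R).
Proof.
have s20 : 0 < s ^+ 2 *+ 2 by rewrite pmulrn_rgt0// exprn_gt0.
apply: (@squeeze_cvgr _ _ _ _ (fun=> 0)
  (fun x => (normal_peak s * (s ^+ 2 *+ 2)) * x^-1)).
- near=> x; have x0 : 0 < x by near: x; exact: nbhs_pinfty_gt.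
  rewrite mulr_ge0 ?q_ge0 ?(ltW x0)//= qE mulrCA.
  rewrite -[leRHS]mulrA ler_wpM2l ?normal_peak_ge0//.
  have := expR_ge1Dx (x ^+ 2 / (s ^+ 2 *+ 2)).
  rewrite mulNr expRN => h.
  rewrite ler_pdivrMr ?expR_gt0// mulrAC ler_pdivlMr// -expr2.
  rewrite -[leLHS](divfK (lt0r_neq0 s20)) mulrC ler_pM2l//.
  by apply: le_trans h; rewrite lerDr.
- exact: cvg_cst.
- rewrite -(mulr0 (normal_peak s * (s ^+ 2 *+ 2))); apply: cvgM; first exact: cvg_cst.
  apply/gtr0_cvgV0; last exact: cvg_id.
  by near=> x; near: x; exact: nbhs_pinfty_gt.
Unshelve. all: by end_near. Qed.

Let sqr_div_ge0 x : 0 <= x ^+ 2 / s ^+ 2.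
Proof. by rewrite divr_ge0// sqr_ge0. Qed.

Let mg : measurable_fun [set: R] (fun x => x ^+ 2 / s ^+ 2 * q x).
Proof.
by do 2 (apply: measurable_funM => //); exact: exprn_measurable.
Qed.

Let cg : continuous (fun x : R => x ^+ 2 / s ^+ 2 * q x).
Proof.
move=> x; apply: cvgM; last exact: cq.
by apply: cvgM; [exact: exprn_continuous|exact: cvg_cst].
Qed.

(** The density $q$ satisfies $(x q)' = (1 - x^2/s^2) q$ and $x q$ vanishes at 0
    and at infinity. Splitting the half-line at $s$, where $1 - x^2/s^2$ changes
    sign, keeps every integrand nonnegative. *)
Let half_moment :
  (\int[mu]_(x in `[0%R, +oo[) (x ^+ 2 / s ^+ 2 * q x)%:E =
   \int[mu]_(x in `[0%R, +oo[) (q x)%:E)%E.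
Proof.
have c1 : continuous (fun x : R => (1 - x ^+ 2 / s ^+ 2) * q x).
  move=> x; apply: cvgM; last exact: cq.
  apply: cvgB; first exact: cvg_cst.
  by apply: cvgM; [exact: exprn_continuous|exact: cvg_cst].
have low : (\int[mu]_(x in `[0%R, s]) ((1 - x ^+ 2 / s ^+ 2) * q x)%:E = (s * q s)%:E)%E.
  rewrite (@continuous_FTC2 _ _ (fun x => x * q x))//.
  - by rewrite mul0r sube0.
  - exact: continuous_subspaceT.
  - split.
    + by move=> x _; exact: xq_derivable x.
    + by apply: cvg_at_right_filter; exact: cxq.
    + by apply: cvg_at_left_filter; exact: cxq.
  - by move=> x _; rewrite derive1E; exact: xq_derive.
have high : (\int[mu]_(x in `[s, +oo[) ((x ^+ 2 / s ^+ 2 - 1) * q x)%:E = (s * q s)%:E)%E.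
  rewrite (@ge0_continuous_FTC2y _ _ (fun x => - (x * q x)) _ 0)//.
  - by rewrite sub0e EFinN oppeK.
  - move=> x sx; rewrite mulr_ge0// subr_ge0 ler_pdivlMr ?exprn_gt0// mul1r.
    by rewrite lerXn2r// nnegrE (le_trans (ltW s_gt0)).
  - rewrite (_ : (fun _ => _) = (fun x => - ((1 - x ^+ 2 / s ^+ 2) * q x))); last first.
      by apply/funext => x; rewrite -mulNr opprB.
    by apply: continuous_subspaceT => x; apply: cvgN; exact: c1.
  - by rewrite -oppr0; exact: cvgN.
  - by move=> x _; apply: derivableN; exact: xq_derivable x.
  - apply: cvgN; apply: cvg_at_right_filter; exact: cxq.
  - move=> x _; rewrite derive1E deriveN; last exact: xq_derivable x.
    by rewrite xq_derive -mulNr opprB.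
have U : `[0%R, +oo[%classic = `[0%R, s]%classic `|` `]s, +oo[%classic :> set R.
  by apply: itv_bndbnd_setU => //; rewrite bnd_simp// ltW.
have dU : [disjoint `[0%R, s]%classic & `]s, +oo[%classic].
  apply/disj_set2P; rewrite -subset0 => x [/=]; rewrite !in_itv/= andbT.
  by move=> /andP[_ xs] sx; have := le_lt_trans xs sx; rewrite ltxx.
have split (f : R -> R) : measurable_fun [set: R] f -> (forall x, 0 <= f x) ->
  (\int[mu]_(x in `[0%R, +oo[) (f x)%:E = \int[mu]_(x in `[0%R, s]) (f x)%:E +
    \int[mu]_(x in `[s, +oo[) (f x)%:E)%E.
  move=> mf f0; rewrite U ge0_integral_setU//; last 2 first.
  - exact/measurable_EFinP/measurable_funTS.
  - by move=> x _; rewrite lee_fin.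
  by congr adde; rewrite integral_itv_obnd_cbnd//; exact/measurable_EFinP/measurable_funTS.
rewrite split// ?split//; last by move=> x; rewrite mulr_ge0.
have L : (\int[mu]_(x in `[0%R, s]) (q x)%:E =
    \int[mu]_(x in `[0%R, s]) (x ^+ 2 / s ^+ 2 * q x)%:E + (s * q s)%:E)%E.
  rewrite -low -ge0_integralD//=; last 4 first.
  - by move=> x _; rewrite lee_fin mulr_ge0.
  - exact/measurable_EFinP/measurable_funTS.
  - move=> x; rewrite in_itv/= => /andP[x0 xs]; rewrite lee_fin mulr_ge0//.
    by rewrite subr_ge0 ler_pdivrMr ?exprn_gt0// mul1r lerXn2r// nnegrE ltW.
  - apply/measurable_EFinP/measurable_funTS; exact: continuous_measurable_fun.
  by apply: eq_integral => x _; rewrite -EFinD -mulrDl subrKC mul1r.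
have H : (\int[mu]_(x in `[s, +oo[) (x ^+ 2 / s ^+ 2 * q x)%:E =
    \int[mu]_(x in `[s, +oo[) (q x)%:E + (s * q s)%:E)%E.
  rewrite -high -ge0_integralD//=; last 4 first.
  - by move=> x _; rewrite lee_fin.
  - exact/measurable_EFinP/measurable_funTS.
  - move=> x; rewrite in_itv/= andbT => sx; rewrite lee_fin mulr_ge0//.
    rewrite subr_ge0 ler_pdivlMr ?exprn_gt0// mul1r.
    by rewrite lerXn2r// nnegrE (le_trans (ltW s_gt0)).
  - apply/measurable_EFinP/measurable_funTS; apply: measurable_funM => //.
    apply: measurable_funB => //; apply: measurable_funM => //; exact: exprn_measurable.
  by apply: eq_integral => x _; rewrite -EFinD; congr EFin; ring.
by rewrite L H [in RHS]addeAC addeA.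
Qed.

Lemma normal_second_moment : (\int[nu]_x (x ^+ 2)%:E = (s ^+ 2)%:E)%E.
Proof.
rewrite ge0_integral_normal_prob; last 2 first.
- by move=> x; rewrite lee_fin sqr_ge0.
- by apply/measurable_EFinP; exact: exprn_measurable.
transitivity ((s ^+ 2)%:E * \int[mu]_x (x ^+ 2 / s ^+ 2 * q x)%:E)%E.
  rewrite -ge0_integralZl//; last 3 first.
  - exact/measurable_EFinP.
  - by move=> x _; rewrite lee_fin mulr_ge0.
  - by rewrite lee_fin sqr_ge0.
  apply: eq_integral => x _; rewrite -!EFinM; congr EFin.
  by field; rewrite gt_eqF.
have even (f : R -> R) : continuous f -> (forall x, 0 <= f x) -> (forall x, f x = f (- x)) ->
    (\int[mu]_x (f x)%:E = 2%:E * \int[mu]_(x in `[0%R, +oo[) (f x)%:E)%E.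
  move=> cf f0 fN; rewrite ge0_symfun_integralT//; congr (_ * integral _ _ _)%E.
  by apply/seteqP; split => x /=; rewrite in_itv/= andbT.
rewrite even//; last 2 first.
- by move=> x; rewrite mulr_ge0.
- by move=> x; rewrite !qE !sqrrN.
rewrite half_moment -even//; last by move=> x; rewrite !qE sqrrN.
by rewrite integral_normal_pdf mule1.
Qed.

(** The first moment of an increment vanishes by this symmetry, without any
    computation. *)
Lemma normal_symmetric (V : set R) : measurable V ->
  nu (-%R @^-1` V) = nu V.
Proof.
move=> mV.
have mN : measurable_fun [set: R] (-%R : R -> measurableTypeR R) by exact: oppr_measurable.
rewrite /normal_prob integral_mkcond [RHS]integral_mkcond.
transitivity (\int[pushforward mu (-%R : R -> measurableTypeR R)]_x ((fun x => (q x)%:E) \_ V) x)%E.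
  rewrite ge0_integral_pushforward//=; last 2 first.
  - apply/(measurable_restrictT _ _).1 => //.
    exact/measurable_funTS/measurable_EFinP.
  - by move=> x _; apply: erestrict_ge0 => y _; rewrite lee_fin.
  apply: eq_integral => x _; rewrite !patchE /=.
  have -> : q (- x) = q x by rewrite !qE sqrrN.
  by congr (if _ then _ else _); apply/idP/idP; rewrite !inE.
by apply: eq_measure_integral => A mA _; exact: lebesgue_measureN.
Qed.

End normal_moments.

(** * Independence of a Brownian increment and the past *)

Section product_law.
Context {R : realType} {d : measure_display} {Omega : measurableType d}.
Variable P : probability Omega R.
Variables X Y : Omega -> R.
Hypotheses (mX : measurable_fun [set: Omega] X)
           (mY : measurable_fun [set: Omega] Y).
Hypothesis XY : forall U V : set R, measurable U -> measurable V ->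
  P (X @^-1` U `&` Y @^-1` V) = (P (X @^-1` U) * P (Y @^-1` V))%E.

Let X' : {mfun Omega >-> R} := mfun_Sub (mem_set mX).
Let Y' : {mfun Omega >-> R} := mfun_Sub (mem_set mY).
Let Z (w : Omega) := (X w, Y w).
Let mZ : measurable_fun [set: Omega] Z. Proof. exact: measurable_fun_pair. Qed.
Let Z' : {mfun Omega >-> (R * R)%type} := mfun_Sub (mem_set mZ).

Let joint : forall U, measurable U ->
  (distribution P X' \x distribution P Y')%E U = distribution P Z' U.
Proof.
apply: product_measure_unique => U V mU mV.
by rewrite /distribution /pushforward/= -XY.
Qed.

(** Independence says that the joint law is the product of the laws, since they
    agree on rectangles; then Tonelli's theorem applies. *)
Lemma ge0_integral_indep (f g : R -> \bar R) :
  measurable_fun [set: R] f -> measurable_fun [set: R] g ->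
  (forall x, 0 <= f x)%E -> (forall x, 0 <= g x)%E ->
  (\int[P]_w (f (X w) * g (Y w)) =
   (\int[P]_w f (X w)) * (\int[P]_w g (Y w)))%E.
Proof.
move=> mf mg f0 g0.
pose F (z : R * R) := (f z.1 * g z.2)%E.
have mF : measurable_fun [set: R * R] F.
  by apply: emeasurable_funM; exact: measurableT_comp.
have F0 z : (0 <= F z)%E by exact: mule_ge0.
transitivity (\int[distribution P Z']_z F z)%E.
  by rewrite ge0_integral_pushforward.
rewrite -(@eq_measure_integral _ _ _ _ _ (distribution P X' \x distribution P Y')%E); last first.
  by move=> U mU _; exact: joint.
rewrite fubini_tonelli1// /fubini_F /F/=.
under eq_integral do rewrite ge0_integralZl//=.
rewrite ge0_integralZr//=; last exact: integral_ge0.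
by rewrite !ge0_integral_pushforward.
Qed.

Lemma indep_L1M : L1 P X -> L1 P Y -> L1 P (X * Y).
Proof.
move=> /L1P[_ X1] /L1P[_ Y1]; apply/L1P; split; first exact: measurable_funM.
under eq_integral do rewrite fctE normrM EFinM.
rewrite (@ge0_integral_indep (fun x => `|x|%:E) (fun x => `|x|%:E))//; try by
  apply/measurable_EFinP; exact: normr_measurable.
by rewrite lte_mul_pinfty// ?integral_ge0// ge0_fin_numE// integral_ge0.
Qed.

(** Splitting both variables into positive and negative parts reduces the claim
    to nonnegative functions. *)
Lemma indep_int : L1 P X -> L1 P Y ->
  \int[P]_w (X w * Y w) = (\int[P]_w X w) * \int[P]_w Y w.
Proof.
move=> L1X L1Y.
pose p (x : R) := Num.max x 0; pose m (x : R) := Num.max (- x) 0.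
have mp : measurable_fun [set: R] p by apply: measurable_maxr => //; exact: measurable_id.
have mm : measurable_fun [set: R] m.
  by apply: measurable_maxr => //; exact: oppr_measurable.
have pm x : x = p x - m x.
  rewrite /p /m; have [x0|x0] := leP x 0.
    by rewrite max_l ?oppr_ge0// sub0r opprK.
  by rewrite max_r ?subr0// oppr_le0 ltW.
have p0 x : 0 <= p x by rewrite le_max lexx orbT.
have m0 x : 0 <= m x by rewrite le_max lexx orbT.
have L1p (f : Omega -> R) : L1 P f -> L1 P (p \o f).
  move=> L1f; apply: (le_L1 _ _ L1f) => [|x /=].
    by apply: measurableT_comp => //; exact: L1_measurable L1f.
  by rewrite ger0_norm// ge_max ler_norm normr_ge0.
have L1m (f : Omega -> R) : L1 P f -> L1 P (m \o f).
  move=> L1f; apply: (le_L1 _ _ L1f) => [|x /=].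
    by apply: measurableT_comp => //; exact: L1_measurable L1f.
  by rewrite ger0_norm// ge_max -normrN ler_norm normr_ge0.
have L1prod (f g : R -> R) : measurable_fun [set: R] f ->
    measurable_fun [set: R] g -> (forall x, 0 <= f x) -> (forall x, 0 <= g x) ->
    L1 P (f \o X) -> L1 P (g \o Y) -> L1 P ((f \o X) * (g \o Y)) /\
    \int[P]_w ((f \o X) * (g \o Y)) w =
      (\int[P]_w (f \o X) w) * \int[P]_w (g \o Y) w.
  move=> mf mg f0 g0 L1f L1g.
  have e : (\int[P]_w (((f \o X) * (g \o Y)) w)%:E =
      (\int[P]_w ((f \o X) w)%:E) * (\int[P]_w ((g \o Y) w)%:E))%E.
    rewrite -(@ge0_integral_indep (EFin \o f) (EFin \o g))//;
      exact/measurable_EFinP.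
  split; last by rewrite /Rintegral e fineM// integrable_fin_num.
  apply/L1P; split.
    by apply: measurable_funM; exact: measurableT_comp.
  rewrite (eq_integral (fun w => (((f \o X) * (g \o Y)) w)%:E)); last first.
    by move=> w _; rewrite ger0_norm//; apply: mulr_ge0; [exact: f0|exact: g0].
  rewrite e; apply: lte_mul_pinfty.
  - by apply: integral_ge0 => w _; rewrite lee_fin; exact: f0.
  - exact: integrable_fin_num.
  - by rewrite ltey_eq integrable_fin_num.
have [i1 e1] := L1prod _ _ mp mp p0 p0 (L1p _ L1X) (L1p _ L1Y).
have [i2 e2] := L1prod _ _ mp mm p0 m0 (L1p _ L1X) (L1m _ L1Y).
have [i3 e3] := L1prod _ _ mm mp m0 p0 (L1m _ L1X) (L1p _ L1Y).
have [i4 e4] := L1prod _ _ mm mm m0 m0 (L1m _ L1X) (L1m _ L1Y).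
have split (f : Omega -> R) : L1 P f -> \int[P]_w f w =
    \int[P]_w (p \o f) w - \int[P]_w (m \o f) w.
  move=> L1f; rewrite -intB; [|exact: L1p|exact: L1m].
  by apply: eq_Rintegral => w _; rewrite !fctE/= -pm.
rewrite (split _ L1X) (split _ L1Y).
rewrite mulrBl !mulrBr -e1 -e2 -e3 -e4 -intB// -intB// -intB//; try exact: L1B.
apply: eq_Rintegral => w _; rewrite !fctE /= {1}(pm (X w)) {1}(pm (Y w)); ring.
Qed.

End product_law.

Section filtration.
Context {R : realType} {d : measure_display} {Omega : measurableType d}.
Variable P : probability Omega R.
Hypothesis P_complete : measure_is_complete P.
Variable W : R -> Omega -> R.
Hypothesis W_brownian : brownian_motion P W.
Local Notation F_ s := (g_sigma_algebraType (filtration_gen P W s)).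

Definition adapted_at (s : R) (f : Omega -> R) :=
  measurable_fun [set: F_ s] (f : F_ s -> R).

Lemma measurable_past s : past_events W s `<=` @measurable _ Omega.
Proof.
have [mW _ _ _ _] := W_brownian.
move=> _ [r [/andP[r0 _] [V mV ->]]].
by rewrite -[X in measurable X]setTI; exact: mW.
Qed.

(** Completeness of the probability space makes the null sets that are added to
    the filtration measurable. *)
Lemma measurable_filtration s (E : set Omega) :
  <<s filtration_gen P W s >> E -> measurable E.
Proof.
apply: smallest_sub => [|A [/measurable_past//|/P_complete//]].
split => [|A mA|F mF]; first exact: measurable0.
- by apply: measurableD => //; exact: measurableT.
- exact: bigcupT_measurable.
Qed.

Lemma measurable_fun_filtration s :
  measurable_fun [set: Omega] (id : Omega -> F_ s).
Proof. by move=> _ B mB; rewrite setTI; apply: measurable_filtration mB. Qed.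

Lemma adapted_measurable s (f : Omega -> R) :
  adapted_at s f -> measurable_fun [set: Omega] f.
Proof.
by move=> mf; exact: (measurableT_comp mf (@measurable_fun_filtration s)).
Qed.

Lemma filtrationS s t (E : set Omega) : s <= t ->
  <<s filtration_gen P W s >> E -> <<s filtration_gen P W t >> E.
Proof.
move=> st; apply: sub_sigma_algebra2 => A [[r [/andP[r0 rs] h]]|n]; [left|by right].
by exists r; split => //; rewrite r0 (le_trans rs).
Qed.

Lemma adaptedS s t (f : Omega -> R) : s <= t -> adapted_at s f -> adapted_at t f.
Proof. by move=> st mf _ B mB; exact: filtrationS (mf measurableT B mB). Qed.

Lemma adapted_brownian r s : 0 <= r -> r <= s -> adapted_at s (W r).
Proof.
move=> r0 rs _ B mB; rewrite setTI; apply: sub_sigma_algebra; left.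
by exists r; rewrite r0 rs; split => //; exists B.
Qed.

(** The sets that differ by a null set from a past event form a sigma-algebra,
    which contains the generators of the augmented filtration. *)
Lemma filtration_past s (E : set Omega) : <<s filtration_gen P W s >> E ->
  exists2 E', <<s past_events W s >> E' &
    P.-negligible (E `\` E') /\ P.-negligible (E' `\` E).
Proof.
pose G := [set A | exists2 A', <<s past_events W s >> A' &
  P.-negligible (A `\` A') /\ P.-negligible (A' `\` A)].
suff h : <<s filtration_gen P W s >> `<=` G by exact: h.
apply: smallest_sub => [|A [pA|nA]]; last 2 first.
- exists A; first exact: sub_sigma_algebra.
  by rewrite setDv; split; exact: negligible_set0.
- exists set0; first exact: sigma_algebra0.
  by rewrite setD0 set0D; split => //; exact: negligible_set0.
split=> [|A [A' sA' [n1 n2]]|A hA].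
- exists set0; first exact: sigma_algebra0.
  by rewrite setD0; split; exact: negligible_set0.
- exists (setT `\` A'); first exact: sigma_algebraCD.
  rewrite !setTD; split; apply: negligibleS; [|exact: n2| |exact: n1].
  + by move=> x [? /contrapT].
  + by move=> x [? /contrapT].
- have [A' hA'] := choice (fun k => let: ex_intro2 B b1 b2 := hA k in
    ex_intro (fun B => _ /\ _) B (conj b1 b2)).
  exists (\bigcup_k A' k); first by apply: sigma_algebra_bigcup => k; exact: (hA' k).1.
  split.
  + apply: (@negligibleS _ _ _ _ (\bigcup_k (A k `\` A' k))).
      by move=> x [[k _ Ak] nA]; exists k => //; split => // A'k; apply: nA; exists k.
    by apply: negligible_bigcup => k; exact: (hA' k).2.1.
  + apply: (@negligibleS _ _ _ _ (\bigcup_k (A' k `\` A k))).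
      by move=> x [[k _ Ak] nA]; exists k => //; split => // A'k; apply: nA; exists k.
    by apply: negligible_bigcup => k; exact: (hA' k).2.2.
Qed.

Lemma measurable_increment s t : 0 <= s -> s <= t ->
  measurable_fun [set: Omega] (W t - W s).
Proof.
have [mW _ _ _ _] := W_brownian => s0 st.
by apply: measurable_funB; apply: mW => //; exact: le_trans st.
Qed.

Lemma past_sigma_measurable s (E : set Omega) :
  <<s past_events W s >> E -> measurable E.
Proof.
move=> h; apply: (@measurable_filtration s); move: h.
by apply: sub_sigma_algebra2 => A; left.
Qed.

Lemma measure_ae_eq (A B : set Omega) : measurable A -> measurable B ->
  P.-negligible (A `\` B) -> P.-negligible (B `\` A) -> P A = P B.
Proof.
move=> mA mB nAB nBA.
have key (C D : set Omega) : measurable C -> measurable D ->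
    P.-negligible (C `\` D) -> (P C <= P D)%E.
  move=> mC mD /(measure_negligible (measurableD mC mD)) CD0.
  have := measureU2 P (measurableD mC mD) mD.
  rewrite [X in (_ <= X)%E -> _](_ : _ = P D); last by rewrite CD0 add0e.
  apply: le_trans; apply: le_measure; rewrite ?inE//.
    by apply: measurableU => //; exact: measurableD.
  by move=> x Cx; have [Dx|nDx] := pselect (D x); [right|left].
by apply/eqP; rewrite eq_le !key.
Qed.

(** The increments are assumed independent of the raw past only; a member of the
    augmented filtration differs from one of the raw past by a null set. *)
Lemma indep_increment_event s t (E : set Omega) (V : set R) :
  0 <= s -> s < t -> <<s filtration_gen P W s >> E -> measurable V ->
  P (E `&` (W t - W s)%R @^-1` V) = (P E * P ((W t - W s)%R @^-1` V))%E.
Proof.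
move=> s0 st FE mV; have [_ _ _ _ ind] := W_brownian.
have [E' sE' [n1 n2]] := filtration_past FE.
have mE := measurable_filtration FE.
have mE' := past_sigma_measurable sE'.
have mU : measurable ((W t - W s)%R @^-1` V).
  by rewrite -[X in measurable X]setTI; exact: measurable_increment (ltW st) _ _ _.
rewrite (@measure_ae_eq E E')//.
have := ind _ _ s0 st _ _ sE' mV => /= <-.
apply: measure_ae_eq; [exact: measurableI|exact: measurableI| |].
- by apply: negligibleS n1 => x [[? ?] h]; split => // ?; exact: h.
- by apply: negligibleS n2 => x [[? ?] h]; split => // ?; exact: h.
Qed.

Lemma indep_increment s t (eta : Omega -> R) : 0 <= s -> s < t ->
  adapted_at s eta -> forall U V : set R, measurable U -> measurable V ->
  P (eta @^-1` U `&` (W t - W s)%R @^-1` V) =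
  (P (eta @^-1` U) * P ((W t - W s)%R @^-1` V))%E.
Proof.
move=> s0 st meta U V mU mV; apply: indep_increment_event => //.
by have := meta measurableT _ mU; rewrite setTI.
Qed.

(** ** Moments of the increments *)

Section increment.
Variables s t : R.
Hypotheses (s_ge0 : 0 <= s) (st : s < t).
Let D := W t - W s.
Let mD : measurable_fun [set: Omega] (D : Omega -> measurableTypeR R).
Proof. exact: measurable_increment (ltW st). Qed.
Let D' : {mfun Omega >-> measurableTypeR R} :=
  @mfun_Sub _ _ Omega (measurableTypeR R) D (mem_set mD).

Let sqrt_gt0 : 0 < Num.sqrt (t - s). Proof. by rewrite sqrtr_gt0 subr_gt0. Qed.

Lemma ge0_integral_increment (f : R -> \bar R) : (forall x, 0 <= f x)%E ->
  measurable_fun [set: R] f ->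
  (\int[P]_w f (D w) = \int[normal_prob 0 (Num.sqrt (t - s))]_x f x)%E.
Proof.
move=> f0 mf; transitivity (\int[distribution P D']_x f x)%E.
  by rewrite ge0_integral_pushforward.
apply: eq_measure_integral => V mV _; have [_ _ _ law _] := W_brownian.
exact: law.
Qed.

Lemma increment_sqr : (\int[P]_w (D w ^+ 2)%:E = (t - s)%:E)%E.
Proof.
rewrite (@ge0_integral_increment (fun x => (x ^+ 2)%:E)).
- by rewrite normal_second_moment// sqr_sqrtr// subr_ge0 ltW.
- by move=> x; rewrite lee_fin sqr_ge0.
- by apply/measurable_EFinP; exact: exprn_measurable.
Qed.

Lemma increment_L2 : L2 P D.
Proof. by apply/L2P; split=> //; rewrite increment_sqr ltry. Qed.

Lemma int_increment_sqr : \int[P]_w (D * D) w = t - s.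
Proof.
rewrite /Rintegral; under eq_integral do rewrite fctE -expr2.
by rewrite increment_sqr.
Qed.

(** The law of the increment is symmetric, so its mean equals its opposite. *)
Lemma int_increment : \int[P]_w D w = 0.
Proof.
have L1D : L1 P D by exact/L2_L1/increment_L2.
suff : \int[P]_w D w = - \int[P]_w D w by lra.
have mN : measurable_fun [set: Omega] ((- D) : Omega -> measurableTypeR R).
  exact: (measurableT_comp (@oppr_measurable R setT)).
pose N' : {mfun Omega >-> measurableTypeR R} :=
  @mfun_Sub _ _ Omega (measurableTypeR R) (- D) (mem_set mN).
have lawD V : measurable V -> distribution P D' V = normal_prob 0 (Num.sqrt (t - s)) V.
  by have [_ _ _ law _] := W_brownian => mV; exact: law.
have lawN : \int[distribution P N']_x x = \int[distribution P D']_x x.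
  congr fine; apply: eq_measure_integral => V mV _.
  have mNV : measurable (-%R @^-1` V).
    by rewrite -[X in measurable X]setTI; exact: oppr_measurable.
  transitivity (distribution P D' (-%R @^-1` V)); first by [].
  rewrite [LHS](lawD _ mNV) normal_symmetric//.
  exact/esym/lawD.
have e : \int[P]_w D w = \int[distribution P D']_x x.
  by rewrite /Rintegral integral_pushforward.
rewrite {1}e -lawN -[RHS]mulN1r -intZ// /Rintegral integral_pushforward//.
  by congr fine; apply: eq_integral => w _; rewrite !fctE mulN1r.
exact: L1N.
Qed.

End increment.
End filtration.

(** * The Ito integral in mean square *)

Section ito_integral.
Context {R : realType} {d : measure_display} {Omega : measurableType d}.
Variable P : probability Omega R.
Hypothesis P_complete : measure_is_complete P.
Variable W : R -> Omega -> R.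
Hypothesis W_brownian : brownian_motion P W.
Local Notation adapted_at := (adapted_at P W).
Local Notation M := ((@lebesgue_measure R) \x P)%E.

Lemma adaptedM s (f g : Omega -> R) :
  adapted_at s f -> adapted_at s g -> adapted_at s (f * g).
Proof. exact: measurable_funM. Qed.

Lemma adaptedB s (f g : Omega -> R) :
  adapted_at s f -> adapted_at s g -> adapted_at s (f - g).
Proof. exact: measurable_funB. Qed.

(** Half-open intervals make consecutive windows disjoint, and match the steps
    of simple processes. *)
Definition window (s t x : R) : R := (s < x <= t)%R%:R.

Lemma windowE s t : window s t = \1_(`]s, t]%classic).
Proof. by apply/funext => x; rewrite /window indicE mem_setE in_itv. Qed.

Lemma window_bound s t x : `|window s t x| <= 1.
Proof. by rewrite /window; case: (_ && _); rewrite ?normr1// normr0. Qed.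

Lemma measurable_window s t : measurable_fun [set: R] (window s t).
Proof. by rewrite windowE; exact: measurable_indic. Qed.

Lemma window_mul s1 t1 s2 t2 x :
  window s1 t1 x * window s2 t2 x = window (Num.max s1 s2) (Num.min t1 t2) x.
Proof.
rewrite /window gt_max le_min -natrM mulnb; congr (_%:R).
by case: (s1 < x); case: (s2 < x); case: (x <= t1); case: (x <= t2).
Qed.

Lemma window_disjoint a s t x : window a s x * window s t x = 0.
Proof. by rewrite /window; case: (leP x s) => _; rewrite ?andbF ?mul0r ?mulr0. Qed.

Lemma window_nil s x : window s s x = 0.
Proof. by rewrite /window; case: (leP x s) => _; rewrite ?andbF. Qed.

Lemma L1_window s t : L1 (@lebesgue_measure R) (window s t).
Proof.
apply/L1P; split; first exact: measurable_window.
under eq_integral do rewrite ger0_norm//.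
by rewrite windowE integral_indic//= setIT lebesgue_measure_itv/=; case: ifP => _; rewrite ltry.
Qed.

Lemma int_window s t : \int[@lebesgue_measure R]_x window s t x = Num.max 0 (t - s).
Proof.
rewrite windowE /Rintegral integral_indic//= setIT lebesgue_measure_itv/= lte_fin.
case: ltP => st /=; first by rewrite max_r// subr_ge0 ltW.
by rewrite max_l// subr_le0.
Qed.

(** [eta] and the increment are independent, and the increment has mean 0. *)
Lemma int_increment_past s t (eta : Omega -> R) : 0 <= s -> s <= t ->
  adapted_at s eta -> L1 P eta ->
  L1 P (eta * (W t - W s)) /\ \int[P]_w (eta * (W t - W s)) w = 0.
Proof.
move=> s0; rewrite le_eqVlt => /predU1P[<-|st] meta L1eta.
  by rewrite subrr mulr0; split; [exact: L1_0|exact: (int_cst P 0)].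
have mD : measurable_fun [set: Omega] (W t - W s).
  exact: (measurable_increment W_brownian s0 (ltW st)).
have L1D : L1 P (W t - W s) by apply: L2_L1; exact: (increment_L2 W_brownian s0 st).
have ind := indep_increment P_complete W_brownian s0 st meta.
split; first exact: (indep_L1M (L1_measurable L1eta) mD ind).
by rewrite [LHS](indep_int (L1_measurable L1eta) mD ind)// (int_increment W_brownian s0 st) mulr0.
Qed.

Lemma int_increment_sqr_past s t (eta : Omega -> R) : 0 <= s -> s <= t ->
  adapted_at s eta -> L1 P eta ->
  \int[P]_w (eta * ((W t - W s) * (W t - W s))) w =
  (\int[P]_w eta w) * (t - s).
Proof.
move=> s0; rewrite le_eqVlt => /predU1P[<-|st] meta L1eta.
  by rewrite !subrr !mulr0; exact: (int_cst P 0).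
have L2D : L2 P (W t - W s) := increment_L2 W_brownian s0 st.
have mDD : measurable_fun [set: Omega] ((W t - W s) * (W t - W s)).
  exact: L1_measurable (L2_sqr L2D).
have ind (U V : set R) : measurable U -> measurable V ->
    P (eta @^-1` U `&` ((W t - W s) * (W t - W s))%R @^-1` V) =
    (P (eta @^-1` U) * P (((W t - W s) * (W t - W s))%R @^-1` V))%E.
  move=> mU mV; pose V' := (fun x : R => x * x) @^-1` V.
  have mV' : measurable V'.
    have : measurable_fun [set: R] (fun x : R => x * x) by exact: measurable_funM.
    by move=> /(_ measurableT V mV); rewrite setTI.
  exact: (indep_increment P_complete W_brownian s0 st meta mU mV').
rewrite (indep_int (L1_measurable L1eta) mDD ind)//; last exact: L2_sqr.
by rewrite (int_increment_sqr W_brownian s0 st).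
Qed.

Lemma brownian_increment_L2 s t : 0 <= s -> s <= t -> L2 P (W t - W s).
Proof.
move=> s0; rewrite le_eqVlt => /predU1P[<-|st]; last exact: (increment_L2 W_brownian s0).
by rewrite subrr; exact: L2_0.
Qed.

Lemma adapted_increment r s t : 0 <= s -> s <= t -> t <= r ->
  adapted_at r (W t - W s).
Proof.
move=> s0 st tr; apply: adaptedB; apply: adapted_brownian => //.
- exact: le_trans st.
- exact: le_trans tr.
Qed.

(** The integral of a step process, seen as a relation: it is linear by
    construction, so identities are proved by induction on one step at a time. *)
Inductive simple_ito : (R * Omega -> R) -> (Omega -> R) -> Prop :=
| simple_ito_step (s t : R) (xi : Omega -> R) (K : R) of 0 <= s & s <= t & adapted_at s xi &
    (forall w, `|xi w| <= K) :
    simple_ito (fun z => window s t z.1 * xi z.2) (xi * (W t - W s))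
| simple_ito_lin c v I w J of simple_ito v I & simple_ito w J :
    simple_ito (v + cst c * w) (I + cst c * J).

Lemma simple_ito0 : simple_ito 0 0.
Proof.
have := @simple_ito_step 0 0 0 0 (lexx 0) (lexx 0).
rewrite mul0r (_ : (fun z => _) = 0); last first.
  by apply/funext => z; rewrite mulr0.
apply; first exact: measurable_cst.
by move=> w; rewrite normr0.
Qed.

Lemma L2_step s t (xi : Omega -> R) (K : R) : adapted_at s xi ->
  (forall w, `|xi w| <= K) -> L2 M (fun z => window s t z.1 * xi z.2).
Proof.
move=> mxi xiK; have mxi' := adapted_measurable P_complete W_brownian mxi.
have L1xi : L1 P (xi * cst 1).
  by apply: (L1_bounded (M := K)) => //; exact: L1_cst.
rewrite mulr1 in L1xi.
have [L1x _] := int_tensor (m1 := @lebesgue_measure R) (m2 := P) (L1_window s t) (L1_bounded mxi' xiK L1xi).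
split; first by apply: measurable_funM; [apply: (measurableT_comp (measurable_window s t))|apply: (measurableT_comp mxi')].
rewrite (_ : _ * _ = (fun z => window s t z.1 * (xi * xi) z.2))//.
apply/funext => z; rewrite !fctE mulrACA window_mul maxxx minxx//.
Qed.

Lemma L2_step_int s t (xi : Omega -> R) (K : R) : 0 <= s -> s <= t ->
  adapted_at s xi -> (forall w, `|xi w| <= K) -> L2 P (xi * (W t - W s)).
Proof.
move=> s0 st mxi xiK; apply: (L2_bounded (M := K)) => //.
  exact: (adapted_measurable P_complete W_brownian mxi).
exact: brownian_increment_L2.
Qed.

Lemma simple_ito_L2 v I : simple_ito v I -> L2 M v /\ L2 P I.
Proof.
elim=> [s t xi K s0 st mxi xiK|c {}v {}I w J _ [L2v L2I] _ [L2w L2J]].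
  by split; [exact: L2_step mxi xiK|exact: L2_step_int mxi xiK].
by split; apply: L2D => //; exact: L2Z.
Qed.

(** Split both increments at the ends of the common interval. A product of
    increments over disjoint intervals vanishes by [int_increment_past], and only
    the square of the increment over the common interval contributes. *)
Lemma ip_step (s1 t1 : R) (xi : Omega -> R) (K1 s2 t2 : R) (eta : Omega -> R) (K2 : R) :
  0 <= s1 -> s1 <= t1 -> adapted_at s1 xi -> (forall w, `|xi w| <= K1) ->
  0 <= s2 -> s2 <= t2 -> adapted_at s2 eta -> (forall w, `|eta w| <= K2) ->
  ip P (xi * (W t1 - W s1)) (eta * (W t2 - W s2)) =
  Num.max 0 (Num.min t1 t2 - Num.max s1 s2) * \int[P]_w (xi * eta) w.
Proof.
wlog s12 : s1 t1 xi K1 s2 t2 eta K2 / s1 <= s2.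
  move=> H; have /orP[s12|s21] := le_total s1 s2; first exact: H.
  move=> *; rewrite ipC (H s2 t2 eta K2 s1 t1 xi K1)// minC [Num.max s2 _]maxC.
  by rewrite [eta * _]mulrC.
move=> s10 st1 mxi xiK s20 st2 meta etaK.
have bdd (f g : Omega -> R) (K K' : R) : (forall w, `|f w| <= K) ->
    (forall w, `|g w| <= K') -> forall w, `|(f * g) w| <= K * K'.
  by move=> fK gK w; rewrite fctE normrM ler_pM.
have mxi2 := adaptedS s12 mxi.
have L2xe : L2 P (xi * eta).
  rewrite -[xi * eta]mulr1; apply: (L2_bounded (M := K1 * K2)); last exact: L2_cst.
    exact: (adapted_measurable P_complete W_brownian (adaptedM mxi2 meta)).
  exact: bdd.
rewrite (max_r s12) /ip.
have disj r : s1 <= r -> r <= s2 ->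
    L1 P (xi * (W r - W s1) * (eta * (W t2 - W s2))) /\
    \int[P]_w (xi * (W r - W s1) * (eta * (W t2 - W s2))) w = 0.
  move=> s1r rs2; rewrite mulrA; apply: int_increment_past => //.
    apply: adaptedM => //; apply: adaptedM => //.
    exact: adapted_increment.
  rewrite mulrAC -[_ * (W r - W s1)]mulrC; apply: L1_mul.
    exact: brownian_increment_L2.
  exact: L2xe.
have [ts|st] := leP t1 s2.
  rewrite max_l ?mul0r; last by rewrite subr_le0 ge_min ts.
  exact: (disj _ st1 ts).2.
have := ltW st => {}st.
have L1past r r' : s2 <= r -> r <= r' ->
    L1 P (xi * eta * (W r - W s2) * (W r' - W r)) /\
    \int[P]_w (xi * eta * (W r - W s2) * (W r' - W r)) w = 0.
  move=> s2r rr'; apply: int_increment_past => //; first exact: le_trans s2r.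
    apply: adaptedM; last exact: adapted_increment.
    by apply: adaptedM; apply: adaptedS s2r _.
  by apply: L1_mul => //; exact: brownian_increment_L2.
have L1sq r : s2 <= r -> L1 P (xi * eta * ((W r - W s2) * (W r - W s2))).
  move=> s2r; apply: (L1_bounded (M := K1 * K2)); first exact: (L2_measurable L2xe).
    exact: bdd.
  exact: L2_sqr (brownian_increment_L2 s20 s2r).
have main : \int[P]_w (xi * (W t1 - W s2) * (eta * (W t2 - W s2))) w =
    (Num.min t1 t2 - s2) * \int[P]_w (xi * eta) w.
  have [t12|/ltW t21] := leP t1 t2.
    have [L1p p0] := L1past _ _ st t12.
    rewrite (_ : _ * _ = xi * eta * ((W t1 - W s2) * (W t1 - W s2)) +
      xi * eta * (W t1 - W s2) * (W t2 - W t1)); last by ring.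
    rewrite intD ?p0 ?addr0//; last exact: L1sq.
    rewrite int_increment_sqr_past//; first by rewrite mulrC.
    + exact: adaptedM.
    + exact: L2_L1.
  have [L1p p0] := L1past _ _ st2 t21.
  rewrite (_ : _ * _ = xi * eta * ((W t2 - W s2) * (W t2 - W s2)) +
    xi * eta * (W t2 - W s2) * (W t1 - W t2)); last by ring.
  rewrite intD ?p0 ?addr0//; last exact: L1sq.
  rewrite int_increment_sqr_past//; first by rewrite mulrC.
  + exact: adaptedM.
  + exact: L2_L1.
rewrite max_r; last by rewrite subr_ge0 le_min st.
rewrite -main; have [L1d d0] := disj _ s12 (lexx _).
rewrite -[RHS]add0r -d0 -intD//; last first.
  by apply: L1_mul; [apply: (L2_step_int (K := K1))|apply: (L2_step_int (K := K2))].
by apply: eq_Rintegral => w _; rewrite !fctE; ring.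
Qed.

(** By bilinearity it suffices to compare single steps, for which both sides are
    the length of the common interval times the mean of the product of the
    coefficients. *)
Lemma simple_ito_isometry v I w J : simple_ito v I -> simple_ito w J ->
  ip P I J = ip M v w.
Proof.
elim=> [s t xi K s0 st mxi xiK|c {}v {}I v' I' sv IH sv' IH']; last first.
  move=> sw; have [L2w L2J] := simple_ito_L2 sw.
  have [L2v L2I] := simple_ito_L2 sv; have [L2v' L2I'] := simple_ito_L2 sv'.
  by rewrite !ipDl ?ipZl ?IH ?IH'//; exact: L2Z.
elim=> [s' t' eta K' s'0 st' meta etaK'|c {}w {}J w' J' sw IH sw' IH']; last first.
  have [L2w L2J] := simple_ito_L2 sw; have [L2w' L2J'] := simple_ito_L2 sw'.
  have L2v := L2_step t mxi xiK; have L2I := L2_step_int s0 st mxi xiK.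
  by rewrite !ipDr ?ipZr ?IH ?IH'//; exact: L2Z.
rewrite (ip_step s0 st mxi xiK s'0 st' meta etaK') -int_window.
have mxi' := adapted_measurable P_complete W_brownian mxi.
have meta' := adapted_measurable P_complete W_brownian meta.
have L1xe : L1 P (xi * eta).
  apply: (L1_bounded (M := K)) => //; rewrite -[eta]mulr1.
  by apply: (L1_bounded (M := K')) => //; exact: L1_cst.
have [_ <-] := int_tensor (m1 := @lebesgue_measure R) (m2 := P) (L1_window (Num.max s s') (Num.min t t')) L1xe.
by apply: eq_Rintegral => z _; rewrite -window_mul !fctE; ring.
Qed.

(** [I'] plays the role of the conditional expectation of [I] given the past of
    [t]: the part of each increment that lies after [t] is independent of it. *)
Lemma simple_ito_stop v I t : simple_ito v I -> exists I',
  simple_ito (fun z => (z.1 <= t)%R%:R * v z) I' /\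
  forall eta, adapted_at t eta -> L2 P eta -> ip P eta (I - I') = 0.
Proof.
elim=> [r s xi K r0 rs mxi xiK|c {}v {}I w J sv [I' [sI' hI']] sw [J' [sJ' hJ']]]; last first.
  exists (I' + cst c * J'); split.
    rewrite (_ : (fun _ => _) = (fun z => (z.1 <= t)%R%:R * v z) +
      cst c * (fun z => (z.1 <= t)%R%:R * w z)); first exact: simple_ito_lin.
    by apply/funext => z; rewrite !fctE; ring.
  move=> eta meta L2eta.
  have [[_ L2I] [_ L2J]] := (simple_ito_L2 sv, simple_ito_L2 sw).
  have [[_ L2I'] [_ L2J']] := (simple_ito_L2 sI', simple_ito_L2 sJ').
  rewrite (_ : _ - _ = (I - I') + cst c * (J - J')); last by ring.
  by rewrite ipDr ?ipZr ?hI' ?hJ' ?mulr0 ?addr0//; [exact: L2B|exact: L2B|exact/L2Z/L2B].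
have [tr|rt] := leP t r.
  exists 0; split.
    rewrite (_ : (fun _ => _) = 0); first exact: simple_ito0.
    apply/funext => z; rewrite /window; have [zt|] := leP z.1 t; last by rewrite mul0r.
    by rewrite ltNge (le_trans zt tr) mul0r mulr0.
  move=> eta meta L2eta; rewrite subr0 /ip.
  have := (@int_increment_past r s (eta * xi) r0 rs _ _).2; rewrite -mulrA; apply.
    by apply: adaptedM => //; exact: adaptedS meta.
  rewrite mulrC; apply: (L1_bounded (M := K)) => //; last exact: L2_L1.
  exact: (adapted_measurable P_complete W_brownian mxi).
have := ltW rt => {}rt.
exists (xi * (W (Num.min s t) - W r)); split.
  rewrite (_ : (fun _ => _) = (fun z => window r (Num.min s t) z.1 * xi z.2)).
    by apply: (@simple_ito_step _ _ _ K) => //; rewrite le_min rs.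
  apply/funext => z; rewrite /window le_min mulrA -natrM mulnb; congr (_%:R * _).
  by case: (z.1 <= t); rewrite /= ?andbT ?andbF// andbF.
move=> eta meta L2eta; rewrite -mulrBr opprB addrA subrK.
have [st|/ltW ts] := leP s t; first by rewrite subrr mulr0 ipC ip0l.
have := (@int_increment_past t s (eta * xi) (le_trans r0 rt) ts _ _).2.
rewrite -mulrA; apply.
  by apply: adaptedM => //; exact: adaptedS mxi.
rewrite mulrC; apply: (L1_bounded (M := K)) => //; last exact: L2_L1.
exact: (adapted_measurable P_complete W_brownian mxi).
Qed.

(** The closure in mean square of the step processes paired with their
    integrals: [ito v I] says that [I] is the integral of [v] over the whole
    half-line. No integral operator has to be constructed, because an Ito process
    comes with its integrals. *)
Definition ito v I := [/\ L2 M v, L2 P I & exists v_ I_,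
  [/\ forall k : nat, simple_ito (v_ k) (I_ k), L2cvg M v_ v & L2cvg P I_ I]].

Lemma ito_lin c v I w J : ito v I -> ito w J ->
  ito (v + cst c * w) (I + cst c * J).
Proof.
move=> [L2v L2I [v_ [I_ [sv cv cI]]]] [L2w L2J [w_ [J_ [sw cw cJ]]]].
split; [by apply: L2D => //; exact: L2Z|by apply: L2D => //; exact: L2Z|].
exists (fun k => v_ k + cst c * w_ k), (fun k => I_ k + cst c * J_ k).
have L2v_ k := (simple_ito_L2 (sv k)).1; have L2I_ k := (simple_ito_L2 (sv k)).2.
have L2w_ k := (simple_ito_L2 (sw k)).1; have L2J_ k := (simple_ito_L2 (sw k)).2.
split; first by move=> k; exact: simple_ito_lin.
- by apply: L2cvgD => // [k||]; [exact: L2Z|exact: L2Z|exact: L2cvgZ].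
- by apply: L2cvgD => // [k||]; [exact: L2Z|exact: L2Z|exact: L2cvgZ].
Qed.

Lemma itoB v I w J : ito v I -> ito w J -> ito (v - w) (I - J).
Proof.
move=> iv iw; have := ito_lin (-1) iv iw.
have N (T : Type) (f g : T -> R) : f + cst (-1) * g = f - g.
  by apply/funext => x; rewrite !fctE mulN1r.
by rewrite !N.
Qed.

(** Both sides are continuous in mean square, so that the isometry passes from
    step processes to their closure. *)
Lemma ito_isometry v I w J : ito v I -> ito w J -> ip P I J = ip M v w.
Proof.
move=> [L2v L2I [v_ [I_ [sv cv cI]]]] [L2w L2J [w_ [J_ [sw cw cJ]]]].
have L2v_ k := (simple_ito_L2 (sv k)).1; have L2I_ k := (simple_ito_L2 (sv k)).2.
have L2w_ k := (simple_ito_L2 (sw k)).1; have L2J_ k := (simple_ito_L2 (sw k)).2.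
have h1 := L2cvg_ip L2I_ L2J_ L2I L2J cI cJ.
have h2 := L2cvg_ip L2v_ L2w_ L2v L2w cv cw.
rewrite (_ : (fun _ => _) = (fun k => ip P (I_ k) (J_ k))) in h2; last first.
  by apply/funext => k; rewrite (simple_ito_isometry (sv k) (sw k)).
exact: (cvg_unique _ h1 h2).
Qed.

(** The martingale property. Stopping at [t] the step processes that approximate
    [v] gives integrals that tend to 0 by the isometry, since [v] vanishes before
    [t], and that have the same scalar product with [eta]. *)
Lemma ito_future_orth v I t eta : ito v I -> (forall z, z.1 <= t -> v z = 0) ->
  adapted_at t eta -> L2 P eta -> ip P eta I = 0.
Proof.
move=> [L2v L2I [v_ [I_ [sv cv cI]]]] v0 meta L2eta.
have L2v_ k := (simple_ito_L2 (sv k)).1; have L2I_ k := (simple_ito_L2 (sv k)).2.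
have [I' hI'] := choice (fun k => simple_ito_stop t (sv k)).
have L2I' k := (simple_ito_L2 (hI' k).1).2.
have L2s k := (simple_ito_L2 (hI' k).1).1.
have cI' : L2cvg P I' 0.
  apply: (@squeeze_cvgr _ _ _ _ (fun=> 0)
    (fun k => ip M (v_ k - v) (v_ k - v))) => //; last exact: cvg_cst.
  near=> k; rewrite ip_ge0/= !subr0 (simple_ito_isometry (hI' k).1 (hI' k).1).
  apply: le_int; [exact: L1_mul|exact/L2_sqr/L2B|].
  move=> z; rewrite !fctE; have [zt|_] := leP z.1 t.
    by rewrite v0// subr0 !mul1r.
  by rewrite !mul0r -expr2 sqr_ge0.
have h1 := L2cvg_ipl L2I_ L2I L2eta cI.
have h2 := L2cvg_ipl L2I' (@L2_0 _ _ _ P) L2eta cI'.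
rewrite (_ : (fun _ => _) = (fun k => ip P (I_ k) eta)) in h2; last first.
  apply/funext => k; apply/esym/subr0_eq; rewrite -ipBl// ipC.
  by rewrite (hI' k).2.
by rewrite ipC (cvg_unique _ h1 h2)// ip0l.
Unshelve. all: by end_near. Qed.

End ito_integral.

(** * Second moments of an Ito process *)

Section drift.
Context {R : realType} {d : measure_display} {Omega : measurableType d}.
Variable P : probability Omega R.
Local Notation leb := (@lebesgue_measure R).
Local Notation M := (leb \x P)%E.

Lemma negligible_point (x : R) : {ae leb, forall y, y <> x}.
Proof.
exists [set x]; split; [exact: measurable_set1|exact: lebesgue_measure_set1|].
by move=> y /=; exact: contrapT.
Qed.

Lemma measurable_leR (x : R) : measurable_fun [set: R] (fun y : R => (y <= x)%R%:R : R).
Proof.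
rewrite (_ : (fun _ => _) = \1_(`]-oo, x]%classic)); first exact: measurable_indic.
by apply/funext => y; rewrite indicE mem_setE in_itv.
Qed.

(** Integration by parts for absolutely continuous functions of one variable:
    the square over which the product of two primitives integrates splits into
    two triangles. *)
Lemma triangle_split (f g : R -> R) : L1 leb f -> L1 leb g ->
  let F (s : R) := \int[leb]_r ((r <= s)%R%:R * f r) in
  let G (s : R) := \int[leb]_r ((r <= s)%R%:R * g r) in
  [/\ L1 leb (f * G), L1 leb (F * g) &
  (\int[leb]_r f r) * (\int[leb]_r g r) =
  \int[leb]_s (f * G) s + \int[leb]_s (F * g) s].
Proof.
move=> L1f L1g F G.
have [L1fg fgE] := int_tensor L1f L1g.
have mle : measurable_fun [set: R * R] (fun z : R * R => (z.2 <= z.1)%R%:R : R).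
  rewrite (_ : (fun _ => _) = (fun x : R => (x <= 0)%R%:R : R) \o (fun z : R * R => z.2 - z.1)).
    by apply: (measurableT_comp (measurable_leR 0)); exact: measurable_funB.
  by apply/funext => z /=; rewrite subr_le0.
pose low (z : R * R) : R := (z.2 <= z.1)%R%:R * (f z.1 * g z.2).
pose high (z : R * R) : R := (1 - (z.2 <= z.1)%R%:R) * (f z.1 * g z.2).
have b01 (b : bool) : `|b%:R : R| <= 1 by case: b; rewrite ?normr1 ?normr0.
have L1low : L1 (leb \x leb)%E low.
  by apply: (L1_bounded (M := 1)) L1fg => // z; exact: b01.
have L1high : L1 (leb \x leb)%E high.
  apply: (L1_bounded (M := 1)) L1fg => [|z].
    exact: measurable_funB.
  by case: (z.2 <= z.1); rewrite ?subrr ?subr0 ?normr1 ?normr0.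
have [L1l lE] := int_fubini1 L1low.
have [L1h hE] := int_fubini2 L1high.
have slice (h : R -> R) (k : R -> R) c : L1 leb h -> measurable_fun [set: R] k ->
    (forall x, `|k x| <= 1) ->
    \int[leb]_r (k r * (c * h r)) = c * \int[leb]_r (k r * h r).
  move=> L1h' mk kb; rewrite -intZ; last by apply: (L1_bounded (M := 1)).
  by apply: eq_Rintegral => r _; rewrite !fctE mulrCA.
have eG : (fun s => \int[leb]_r low (s, r)) = f * G.
  by apply/funext => s; rewrite /low/= slice//; exact: measurable_leR.
have eF : (fun r => \int[leb]_s high (s, r)) = F * g.
  apply/funext => r; rewrite /high/=.
  under eq_Rintegral do rewrite [f _ * _]mulrC.
  have mhi : measurable_fun [set: R] (fun x : R => 1 - (r <= x)%R%:R : R).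
    apply: measurable_funB => //.
    rewrite (_ : (fun _ => _) = \1_(`[r, +oo[%classic)); first exact: measurable_indic.
    by apply/funext => y; rewrite indicE mem_setE in_itv/= andbT.
  have hib x : `|1 - (r <= x)%R%:R : R| <= 1.
    by case: (r <= x); rewrite ?subrr ?subr0 ?normr1 ?normr0.
  rewrite slice// [RHS]mulrC; congr (_ * _).
  apply: ae_int_eq.
  - by apply: measurable_funM => //; exact: L1_measurable L1f.
  - by apply: measurable_funM; [exact: measurable_leR|exact: L1_measurable L1f].
  apply: aeS (negligible_point r) => x xr; congr (_ * _).
  by case: (ltgtP x r) xr => [_ _|_ _|-> /(_ erefl)//]; rewrite ?subrr ?subr0.
rewrite eG in L1l lE; rewrite eF in L1h hE.
split=> //; rewrite -fgE -lE -hE -intD//.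
by apply: eq_Rintegral => z _; rewrite !fctE/= /low /high; ring.
Qed.

Definition cut (f : R -> Omega -> R) (s t : R) (z : R * Omega) : R :=
  window s t z.1 * f z.1 z.2.

Lemma window_split (a s b x : R) : a <= s -> s <= b ->
  window a b x = window a s x + window s b x.
Proof.
move=> as_ sb; rewrite /window; case: (leP x s) => xs.
  by rewrite (le_trans xs sb) andbT/= addr0.
by rewrite (le_lt_trans as_ xs)/= add0r.
Qed.

Lemma cutB f s t u : s <= t -> t <= u -> cut f s u - cut f s t = cut f t u.
Proof.
move=> st tu; apply/funext => z; rewrite !fctE /cut.
by rewrite (window_split _ st tu); ring.
Qed.

Lemma window_cut f s t z : window s t z.1 * cut f s t z = cut f s t z.
Proof. by rewrite /cut mulrA window_mul maxxx minxx. Qed.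

Lemma window_sub (s t s' t' x : R) : s <= s' -> t' <= t ->
  window s' t' x * window s t x = window s' t' x.
Proof. by move=> ss tt; rewrite window_mul max_l// min_l. Qed.

Lemma measurable_fst_window s t :
  measurable_fun [set: R * Omega] (fun z : R * Omega => window s t z.1).
Proof. by apply: (measurableT_comp (measurable_window s t)). Qed.

Lemma L2_cutS f s t s' t' : s <= s' -> t' <= t -> L2 M (cut f s t) ->
  L2 M (cut f s' t').
Proof.
move=> ss tt L2f; rewrite (_ : cut _ _ _ = (fun z => window s' t' z.1) * cut f s t).
  apply: (L2_bounded (M := 1)) => //; first exact: measurable_fst_window.
  by move=> z; exact: window_bound.
by apply/funext => z; rewrite !fctE /cut mulrA window_sub.
Qed.

Lemma L2_window_tensor s t (eta : Omega -> R) : L2 P eta ->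
  L2 M (fun z => window s t z.1 * eta z.2) /\
  ip M (fun z => window s t z.1 * eta z.2) (fun z => window s t z.1 * eta z.2) =
  Num.max 0 (t - s) * ip P eta eta.
Proof.
move=> [meta L1e].
have [L1t tE] := int_tensor (m1 := leb) (m2 := P) (L1_window s t) L1e.
have e : (fun z : R * Omega => window s t z.1 * eta z.2) *
    (fun z => window s t z.1 * eta z.2) =
    (fun z => window s t z.1 * (eta * eta) z.2).
  by apply/funext => z; rewrite !fctE mulrACA window_mul maxxx minxx.
split; last first.
  rewrite /ip -int_window -tE.
  by apply: eq_Rintegral => z _; have := congr1 (fun h => h z) e; rewrite fctE => ->.
split; last by rewrite e.
apply: measurable_funM; first exact: measurable_fst_window.
exact: (measurableT_comp meta).
Qed.

Lemma L1_cut f s t : L2 M (cut f s t) -> L1 M (cut f s t).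
Proof.
move=> L2f; rewrite (_ : cut f s t = (fun z => window s t z.1 * cst 1 z.2) * cut f s t).
  by apply: L1_mul => //; have [] := L2_window_tensor s t (L2_cst P 1).
by apply/funext => z; rewrite !fctE mulr1 window_cut.
Qed.

Lemma L2_slice1 (F : R * Omega -> R) : L2 M F ->
  {ae leb, forall s, L2 P (fun w => F (s, w))}.
Proof.
move=> [mF L1F]; apply: aeS (L1_slice1 L1F) => s L1s; split=> //.
exact: (measurableT_comp mF (pair1_measurable s)).
Qed.

Lemma L2_slice2 (F : R * Omega -> R) : L2 M F ->
  {ae P, forall w, L2 leb (fun s => F (s, w))}.
Proof.
move=> [mF L1F]; apply: aeS (L1_slice2 L1F) => w L1w; split=> //.
exact: (measurableT_comp mF (pair2_measurable w)).
Qed.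

(** By Tonelli's theorem, from a bound on the second moment at each time. *)
Lemma L2_cut_bound f s t C : s <= t ->
  measurable_fun [set: R * Omega] (cut f s t) ->
  (forall r, s < r <= t -> L2 P (f r) /\ ip P (f r) (f r) <= C) ->
  L2 M (cut f s t) /\ ip M (cut f s t) (cut f s t) <= (t - s) * C.
Proof.
move=> st mf fC.
have key : (\int[M]_z (cut f s t z ^+ 2)%:E <= ((t - s) * C)%:E)%E.
  have mf2 : measurable_fun [set: R * Omega] (fun z => (cut f s t z ^+ 2)%:E).
    exact/measurable_EFinP/measurable_funX.
  have f2_ge0 z : (0 <= (cut f s t z ^+ 2)%:E)%E by rewrite lee_fin sqr_ge0.
  rewrite [leLHS](_ : _ = (\int[leb]_r \int[P]_w (cut f s t (r, w) ^+ 2)%:E)%E); last first.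
    exact: fubini_tonelli1.
  apply: (@le_trans _ _ (\int[leb]_r (window s t r * C)%:E)%E); last first.
    rewrite (_ : (\int[leb]_r _)%E = (\int[leb]_r (window s t * cst C) r)%:E).
      rewrite [window s t * _]mulrC intZ; last exact: L1_window.
      by rewrite int_window max_r ?subr_ge0// mulrC.
    by rewrite -int_EFin// mulrC; exact/L1Z/L1_window.
  apply: ge0_le_integral => //.
  - by move=> r _; apply: integral_ge0 => w _; rewrite lee_fin sqr_ge0.
  - exact: (measurable_fun_fubini_tonelli_F (m2 := P) _ mf2 f2_ge0).
  - by apply/measurable_EFinP/measurable_funM => //; exact: measurable_window.
  move=> r _; rewrite /fubini_F /cut /window /=.
  have [rst|_] := boolP (s < r <= t); last first.
    by under eq_integral do rewrite mul0r expr0n; rewrite integral0 mul0r.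
  have [L2f fle] := fC _ rst; rewrite mul1r.
  under eq_integral do rewrite mul1r expr2.
  by rewrite (int_EFin (L2_sqr L2f)) lee_fin.
have L2f : L2 M (cut f s t) by apply/L2P; split=> //; exact: le_lt_trans key (ltry _).
split=> //; rewrite -lee_fin -int_EFin; last exact: L2_sqr.
by under eq_integral do rewrite -expr2.
Qed.

Definition path_int (F : R * Omega -> R) (w : Omega) : R :=
  \int[leb]_s F (s, w).

Lemma measurable_path_int (F : R * Omega -> R) :
  measurable_fun [set: R * Omega] F -> measurable_fun [set: Omega] (path_int F).
Proof.
move=> mF; apply: (@measurable_int_param _ _ Omega (measurableTypeR R) R leb (fun z => F (z.2, z.1))).
by apply: (measurableT_comp mF); exact: measurable_fun_pair.
Qed.

(** The Cauchy-Schwarz inequality in the time variable, on each path. *)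
Lemma path_int_L2 f s t : s <= t -> L2 M (cut f s t) ->
  L2 P (path_int (cut f s t)) /\
  ip P (path_int (cut f s t)) (path_int (cut f s t)) <=
    (t - s) * ip M (cut f s t) (cut f s t).
Proof.
move=> st L2f; have mf := L2_measurable L2f.
have [L1sq sqE] := int_fubini2 (L2_sqr L2f).
have mV := measurable_path_int mf.
have bound : {ae P, forall w, path_int (cut f s t) w ^+ 2 <=
    (t - s) * \int[leb]_r (cut f s t * cut f s t) (r, w)}.
  apply: aeS (L2_slice2 L2f) => w L2w.
  have L2win : L2 leb (window s t).
    split; first exact: measurable_window.
    rewrite (_ : _ * _ = window s t); first exact: L1_window.
    by apply/funext => x; rewrite fctE window_mul maxxx minxx.
  have := cauchy_schwarz L2win L2w.
  rewrite [X in X ^+ 2 <= _](_ : _ = path_int (cut f s t) w); last first.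
    by apply: eq_Rintegral => r _; exact: (window_cut f s t (r, w)).
  move/le_trans; apply; rewrite ler_wpM2r ?ip_ge0//.
  rewrite /ip (@eq_Rintegral _ _ _ leb _ (window s t)).
    by rewrite int_window max_r// subr_ge0.
  by move=> r _; rewrite window_mul maxxx minxx.
have key : (\int[P]_w (path_int (cut f s t) w ^+ 2)%:E <=
    ((t - s) * ip M (cut f s t) (cut f s t))%:E)%E.
  rewrite /ip sqE -intZ// -int_EFin; last exact: L1Z.
  apply: ae_ge0_le_integral => //.
  - by move=> w _; rewrite lee_fin sqr_ge0.
  - exact/measurable_EFinP/measurable_funX.
  - move=> w _; rewrite lee_fin mulr_ge0 ?subr_ge0//.
    by apply: Rintegral_ge0 => r _; rewrite -expr2 sqr_ge0.
  - by apply/measurable_EFinP; exact: L1_measurable (L1Z (t - s) L1sq).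
  - by apply: filterS bound => w h _; rewrite lee_fin.
have L2V : L2 P (path_int (cut f s t)).
  by apply/L2P; split=> //; exact: le_lt_trans key (ltry _).
split=> //; rewrite -lee_fin -int_EFin; last exact: L2_sqr.
by under eq_integral do rewrite -expr2.
Qed.

Lemma ip_path_int f s t (eta : Omega -> R) : s <= t -> L2 M (cut f s t) ->
  L2 P eta ->
  ip P (path_int (cut f s t)) eta =
  ip M (cut f s t) (fun z => window s t z.1 * eta z.2).
Proof.
move=> st L2f L2e; have [L2t _] := L2_window_tensor s t L2e.
have [L2V _] := path_int_L2 st L2f.
have [L1F FE] := int_fubini2 (L1_mul L2f L2t); rewrite /ip FE.
apply: ae_int_eq.
- exact: (L1_measurable (L1_mul L2V L2e)).
- exact: L1_measurable L1F.
apply: aeS (L1_slice2 (L1_cut L2f)) => w L1w.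
rewrite /path_int mulrC -intZ//.
apply: eq_Rintegral => r _; rewrite !fctE/=.
by rewrite -[in LHS](window_cut f s t (r, w))/=; ring.
Qed.

Lemma cut_path_int f a b s : s <= b -> path_int (cut f a s) =
  path_int (fun z => (z.1 <= s)%R%:R * cut f a b z).
Proof.
move=> sb; apply/funext => w; apply: eq_Rintegral => r _.
rewrite /cut /window/= mulrA -natrM mulnb; congr (_%:R * _).
by rewrite andbCA; case: (leP r s) => rs; rewrite ?andbF//= (le_trans rs sb).
Qed.

(** The primitive of a process, as a process; its value is meaningful at the
    outcomes for which the path is integrable, hence almost surely. *)
Definition drift_int (f : R -> Omega -> R) (a s : R) : Omega -> R :=
  path_int (cut f a s).

Lemma L2_drift_int f a b : a <= b -> L2 M (cut f a b) ->
  L2 M (cut (drift_int f a) a b).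
Proof.
move=> ab L2f; have mf := L2_measurable L2f.
have mcut : measurable_fun [set: R * Omega] (cut (drift_int f a) a b).
  pose H (z : (R * Omega) * R) := (window a b z.1.1 * (z.2 <= z.1.1)%R%:R) * cut f a b (z.2, z.1.2).
  have mH : measurable_fun [set: (R * Omega) * R] H.
    apply: measurable_funM; last first.
      apply: (measurableT_comp mf); apply: measurable_fun_pair => //.
      exact: (measurableT_comp measurable_snd measurable_fst).
    apply: measurable_funM.
      apply: (measurableT_comp (measurable_window a b)).
      exact: (measurableT_comp measurable_fst measurable_fst).
    rewrite (_ : (fun _ => _) = (fun x : R => (x <= 0)%R%:R : R) \o (fun z : (R * Omega) * R => z.2 - z.1.1)).
      apply: (measurableT_comp (measurable_leR 0)); apply: measurable_funB => //.
      exact: (measurableT_comp measurable_fst measurable_fst).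
    by apply/funext => z /=; rewrite subr_le0.
  rewrite (_ : cut _ _ _ = (fun z => \int[leb]_r H (z, r))).
    exact: measurable_int_param.
  apply/funext => -[s w]; rewrite /cut /H/= /window.
  have [/andP[as_ sb]|_] := boolP (a < s <= b); last first.
    rewrite mul0r (@eq_Rintegral _ _ _ leb _ (cst 0)) ?Rintegral_cst ?mul0r//.
    by move=> r _; rewrite !mul0r.
  rewrite mul1r /drift_int (cut_path_int _ _ sb); apply: eq_Rintegral => r _.
  by rewrite mul1r.
apply: (L2_cut_bound (C := (b - a) * ip M (cut f a b) (cut f a b)) ab mcut _).1.
move=> s /andP[/ltW as_ sb].
have L2s : L2 M (cut f a s) by exact: L2_cutS L2f.
have [L2V Vle] := path_int_L2 as_ L2s; split=> //; apply: (le_trans Vle).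
rewrite ler_pM ?subr_ge0 ?ip_ge0 ?lerB//.
apply: le_int; [exact: L2_sqr|exact: L2_sqr|].
move=> z; rewrite -[leLHS]/(cut f a s z * cut f a s z) -[leRHS]/(cut f a b z * cut f a b z).
rewrite /cut /window; case: (leP z.1 s) => zs.
  by rewrite (le_trans zs sb).
by rewrite andbF !mul0r -expr2 sqr_ge0.
Qed.

(** Pathwise integration by parts, averaged over the outcomes. *)
Lemma ip_drift_int f g a b : a <= b -> L2 M (cut f a b) -> L2 M (cut g a b) ->
  ip P (drift_int f a b) (drift_int g a b) =
  ip M (cut f a b) (cut (drift_int g a) a b) +
  ip M (cut (drift_int f a) a b) (cut g a b).
Proof.
move=> ab L2f L2g.
have L2F := L2_drift_int ab L2f; have L2G := L2_drift_int ab L2g.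
have [L2Vf _] := path_int_L2 ab L2f; have [L2Vg _] := path_int_L2 ab L2g.
rewrite /ip -intD ?L1_mul//.
have [L1T ->] := int_fubini2 (L1D (L1_mul L2f L2G) (L1_mul L2F L2g)).
apply: ae_int_eq.
- exact: L1_measurable (L1_mul L2Vf L2Vg).
- exact: L1_measurable L1T.
apply: filterS2 (L1_slice2 (L1_cut L2f)) (L1_slice2 (L1_cut L2g)) => w L1f L1g.
have [L1fG L1Fg e] := triangle_split L1f L1g.
rewrite [LHS]e -intD//; apply: eq_Rintegral => s _; rewrite !fctE.
have eV h k : cut h a b (s, w) * cut (drift_int k a) a b (s, w) =
    cut h a b (s, w) * \int[leb]_r ((r <= s)%R%:R * cut k a b (r, w)).
  rewrite {1 2 3}/cut/= /window.
  have [/andP[as_ sb]|_] := boolP (a < s <= b); last by rewrite !mul0r.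
  by rewrite !mul1r /drift_int (cut_path_int _ _ sb).
by rewrite -[X in X + _](eV f g) [X in _ + X]mulrC -(eV g f) [X in _ + X]mulrC.
Qed.

End drift.

Section second_moment.
Context {R : realType} {d : measure_display} {Omega : measurableType d}.
Variable P : probability Omega R.
Hypothesis P_complete : measure_is_complete P.
Variable W : R -> Omega -> R.
Hypothesis W_brownian : brownian_motion P W.
Local Notation adapted_at := (adapted_at P W).
Local Notation leb := (@lebesgue_measure R).
Local Notation M := (leb \x P)%E.
Local Notation drift_int := (@drift_int R _ Omega).

(** The equation $dX = \beta dt + \sigma dW$ on $[a, b]$ with $X(a) = \xi$, for
    real-valued processes and in the mean-square sense: path continuity is
    forgotten, since second moments only see each time separately. *)
Record ms_process (a b : R) (xi : Omega -> R) (beta sigma X : R -> Omega -> R) :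
    Prop := MsProcess {
  ms_init_adapted : adapted_at a xi ;
  ms_init_L2 : L2 P xi ;
  ms_drift_L2 : L2 M (cut beta a b) ;
  ms_drift_adapted : forall s, a < s <= b -> adapted_at s (beta s) ;
  ms_state_L2 : L2 M (cut X a b) ;
  ms_eq : forall s, a <= s <= b ->
    ito P W (cut sigma a s) (X s - xi - drift_int beta a s) }.

Section one_process.
Variables (a b : R) (xi : Omega -> R) (beta sigma X : R -> Omega -> R).
Hypotheses (ab : a <= b) (XP : ms_process a b xi beta sigma X).

Lemma ms_drift_int_L2 s : a <= s <= b -> L2 P (drift_int beta a s).
Proof.
move=> /andP[as_ sb]; apply: (path_int_L2 as_ _).1.
by apply: L2_cutS (ms_drift_L2 XP).
Qed.

Lemma ms_value_L2 s : a <= s <= b -> L2 P (X s).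
Proof.
move=> sab; have [_ L2N _] := ms_eq XP sab.
rewrite (_ : X s = X s - xi - drift_int beta a s + xi + drift_int beta a s); last by ring.
by apply: L2D; [apply: L2D => //; exact: ms_init_L2 XP|exact: ms_drift_int_L2].
Qed.

Lemma ms_diffusion_L2 s : a <= s <= b -> L2 M (cut sigma a s).
Proof. by move=> sab; have [] := ms_eq XP sab. Qed.

Lemma ms_martingale s r eta : a <= s -> s <= r -> r <= b ->
  adapted_at s eta -> L2 P eta ->
  ip P eta ((X r - drift_int beta a r) - (X s - drift_int beta a s)) = 0.
Proof.
move=> as_ sr rb meta L2eta.
have ir : a <= r <= b by rewrite (le_trans as_ sr).
have is_ : a <= s <= b by rewrite as_ (le_trans sr rb).
have := itoB P_complete W_brownian (ms_eq XP ir) (ms_eq XP is_); rewrite (cutB _ as_ sr) => h.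
rewrite -[RHS](ito_future_orth P_complete W_brownian h _ meta L2eta).
  by congr ip; ring.
by move=> z zs; rewrite /cut /window ltNge zs mul0r.
Qed.

Lemma ms_martingale0 r eta : a <= r -> r <= b ->
  adapted_at a eta -> L2 P eta ->
  ip P eta (X r - xi - drift_int beta a r) = 0.
Proof.
move=> ar rb meta L2eta; have ir : a <= r <= b by rewrite ar.
apply: (ito_future_orth P_complete W_brownian (ms_eq XP ir) _ meta L2eta).
by move=> z zs; rewrite /cut /window ltNge zs mul0r.
Qed.

End one_process.

Lemma int_M_eq0 (F : R * Omega -> R) : L1 M F ->
  {ae leb, forall s, \int[P]_w F (s, w) = 0} -> \int[M]_z F z = 0.
Proof.
move=> L1F F0; have [L1G ->] := int_fubini1 L1F.
rewrite (@ae_int_eq _ _ _ leb _ (cst 0)) ?Rintegral_cst ?mul0r//.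
exact: L1_measurable L1G.
Qed.

(** At each time [s] the increment of the martingale part after [s] is orthogonal
    to [f s], so that the martingale part may be stopped at the running time. *)
Lemma ip_drift_martingale a b xi beta sigma X f : a <= b ->
  ms_process a b xi beta sigma X -> L2 M (cut f a b) ->
  (forall s, a < s <= b -> adapted_at s (f s)) ->
  ip P (drift_int f a b) (X b - drift_int beta a b) =
  ip M (cut f a b) (cut X a b - cut (drift_int beta a) a b).
Proof.
move=> ab XP L2f mf.
have bb : a <= b <= b by rewrite ab lexx.
have L2Y : L2 P (X b - drift_int beta a b).
  by apply: L2B; [exact: ms_value_L2 XP _ bb|exact: ms_drift_int_L2 XP _ bb].
have [L2t _] := L2_window_tensor a b L2Y.
have L2cY : L2 M (cut X a b - cut (drift_int beta a) a b).
  by apply: L2B; [exact: ms_state_L2 XP|exact/L2_drift_int/(ms_drift_L2 XP)].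
rewrite (ip_path_int ab L2f L2Y); apply: subr0_eq; rewrite -ipBr//.
apply: int_M_eq0; first by apply: L1_mul => //; exact: L2B.
apply: aeS (L2_slice1 L2f) => s L2s.
have [sab|nsab] := boolP (a < s <= b); last first.
  rewrite (@eq_Rintegral _ _ _ P _ (cst 0)) ?Rintegral_cst ?mul0r//.
  by move=> w _; rewrite {1}/cut /window/= (negbTE nsab) !mul0r.
have /andP[/ltW as_ sb] := sab.
have L2fs : L2 P (f s).
  move: L2s; rewrite (_ : (fun w => _) = f s)//.
  by apply/funext => w; rewrite /cut /window/= sab mul1r.
rewrite -[RHS](ms_martingale XP as_ sb (lexx b) (mf _ sab) L2fs).
apply: eq_Rintegral => w _; rewrite !fctE /cut /window/= sab !mul1r.
by congr (_ * _); ring.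
Qed.

(** Write $X = Y + V$ with $V$ the primitive of the drift. The isometry gives
    $E[Y Y']$, integration by parts gives $E[V V']$, and in the mixed terms the
    martingale part is replaced by its value at the running time. Product
    formulas for stochastic integrals are thereby avoided. *)
Lemma second_moment_end a b xi beta sigma X xi' beta' sigma' X' : a <= b ->
  ms_process a b xi beta sigma X -> ms_process a b xi' beta' sigma' X' ->
  ip P (X b) (X' b) = ip P xi xi' +
    (ip M (cut X a b) (cut beta' a b) + ip M (cut beta a b) (cut X' a b) +
     ip M (cut sigma a b) (cut sigma' a b)).
Proof.
move=> ab XP XP'.
have bb : a <= b <= b by rewrite ab lexx.
have L2X := ms_value_L2 XP bb; have L2X' := ms_value_L2 XP' bb.
have L2V := ms_drift_int_L2 XP bb; have L2V' := ms_drift_int_L2 XP' bb.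
have L2xi := ms_init_L2 XP; have L2xi' := ms_init_L2 XP'.
have L2b := ms_drift_L2 XP; have L2b' := ms_drift_L2 XP'.
have L2cX := ms_state_L2 XP; have L2cX' := ms_state_L2 XP'.
have L2cV := L2_drift_int ab L2b; have L2cV' := L2_drift_int ab L2b'.
pose Y := X b - drift_int beta a b; pose Y' := X' b - drift_int beta' a b.
have L2Y : L2 P Y by exact: L2B.
have L2Y' : L2 P Y' by exact: L2B.
have -> : X b = Y + drift_int beta a b by rewrite /Y subrK.
have -> : X' b = Y' + drift_int beta' a b by rewrite /Y' subrK.
rewrite ipDl ?(ipDr L2Y' L2V' L2Y) ?(ipDr L2Y' L2V' L2V)//; last exact: L2D.
rewrite (ipC P Y (drift_int beta' a b)).
have := ip_drift_martingale ab XP' L2b (ms_drift_adapted XP).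
rewrite -/Y' => ->.
have := ip_drift_martingale ab XP L2b' (ms_drift_adapted XP').
rewrite -/Y => ->.
rewrite (ip_drift_int ab L2b L2b').
have L2N : L2 P (X b - xi - drift_int beta a b) by do 2 apply: L2B => //.
have L2N' : L2 P (X' b - xi' - drift_int beta' a b) by do 2 apply: L2B => //.
have YY : ip P Y Y' = ip P xi xi' + ip M (cut sigma a b) (cut sigma' a b).
  rewrite -(ito_isometry P_complete W_brownian (ms_eq XP bb) (ms_eq XP' bb)).
  have -> : Y = xi + (X b - xi - drift_int beta a b) by rewrite /Y; ring.
  have -> : Y' = xi' + (X' b - xi' - drift_int beta' a b) by rewrite /Y'; ring.
  have N0 := ms_martingale0 XP ab (lexx b) (ms_init_adapted XP') L2xi'.
  have N0' := ms_martingale0 XP' ab (lexx b) (ms_init_adapted XP) L2xi.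
  move: (X b - xi - _) (X' b - xi' - _) L2N L2N' N0 N0' => N N' L2N L2N' N0 N0'.
  rewrite ipDl ?(ipDr L2xi' L2N' L2xi) ?(ipDr L2xi' L2N' L2N)//; last exact: L2D.
  by rewrite N0' (ipC P N xi') N0 addr0 add0r.
rewrite YY !ipBr// (ipC M (cut beta' a b) (cut X a b)).
rewrite (ipC M (cut beta' a b) (cut (drift_int beta a) a b)); ring.
Qed.

Lemma ms_processS a b b' xi beta sigma X : b' <= b -> a <= b' ->
  ms_process a b xi beta sigma X -> ms_process a b' xi beta sigma X.
Proof.
move=> b'b ab' [mxi L2xi L2b mb L2X eqX]; split => //.
- by apply: L2_cutS L2b.
- by move=> s /andP[as_ sb]; apply: mb; rewrite as_ (le_trans sb).
- by apply: L2_cutS L2X.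
- by move=> s /andP[as_ sb]; apply: eqX; rewrite as_ (le_trans sb).
Qed.

(** The integrated form of
    $\frac{d}{ds} E[X X'] = E[X \beta' + \beta X' + \sigma \sigma']$, the only
    consequence of Ito's formula that the quadratic cost requires. *)
Lemma second_moment a b s xi beta sigma X xi' beta' sigma' X' :
  a <= s <= b ->
  ms_process a b xi beta sigma X -> ms_process a b xi' beta' sigma' X' ->
  ip P (X s) (X' s) = ip P xi xi' +
    (ip M (cut X a s) (cut beta' a s) + ip M (cut beta a s) (cut X' a s) +
     ip M (cut sigma a s) (cut sigma' a s)).
Proof.
move=> /andP[as_ sb] XP XP'.
by apply: second_moment_end; [|exact: ms_processS XP|exact: ms_processS XP'].
Qed.

End second_moment.

(** * From vector-valued stochastic equations to scalar ones *)

Section components.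
Context {R : realType} {d : measure_display} {Omega : measurableType d}.
Variable P : probability Omega R.
Hypothesis P_complete : measure_is_complete P.
Variable W : R -> Omega -> R.
Hypothesis W_brownian : brownian_motion P W.
Local Notation adapted_at := (adapted_at P W).
Local Notation F_ s := (g_sigma_algebraType (filtration_gen P W s)).
Local Notation leb := (@lebesgue_measure R).
Local Notation M := (leb \x P)%E.

Definition comp n (phi : process R Omega n) (i : 'I_n) : R -> Omega -> R :=
  fun s w => phi s w i 0.

(** The part of progressive measurability that survives in the mean-square
    theory: joint measurability, through [L2], and adaptedness at each time. *)
Definition admissible a b (f : R -> Omega -> R) :=
  L2 M (cut f a b) /\ forall s, a <= s <= b -> adapted_at s (f s).

Lemma measurable_prod_filtration s :
  measurable_fun [set: R * Omega] (fun z => z : R * F_ s).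
Proof.
have h : measurable_fun [set: R * Omega] (fun z => (z.1, z.2) : R * F_ s).
  apply: (@measurable_fun_pair _ _ _ (R * Omega)%type R (F_ s)) => //.
  apply: (@measurableT_comp _ _ _ (R * Omega)%type Omega (F_ s) id _ snd) => //.
  exact: measurable_fun_filtration.
by rewrite (_ : (fun z => z) = (fun z => (z.1, z.2)))//; apply/funext => -[].
Qed.

Lemma cut_patch (f : R -> Omega -> R) a b :
  cut f a b = (fun z => f z.1 z.2) \_ (`]a, b]%classic `*` setT).
Proof.
apply/funext => z; rewrite patchE /cut windowE indicE.
have -> : (z \in `]a, b]%classic `*` [set: Omega]) = (z.1 \in `]a, b]%classic).
  by apply/idP/idP; rewrite !inE/=; [case|split].
by case: (_ \in _); rewrite ?mul1r ?mul0r.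
Qed.

(** Progressive measurability at the final time [b], where the domain is the
    whole interval. *)
Lemma progressive_measurable n a b (phi : process R Omega n) i :
  progressive P W `[a, b] phi ->
  measurable_fun [set: R * Omega] (cut (comp phi i) a b).
Proof.
move=> pphi; have [ab|ba] := leP a b; last first.
  rewrite (_ : cut _ _ _ = cst 0)//; apply/funext => z.
  rewrite /cut /window; have [/andP[az zb]|_] := boolP (a < z.1 <= b); last exact: mul0r.
  by have := lt_trans (lt_le_trans az zb) ba; rewrite ltxx.
have bb : `[a, b]%classic b by rewrite /= in_itv/= ab lexx.
have := pphi b bb i.
rewrite (_ : `[a, b]%classic `&` `]-oo, b]%classic = `[a, b]%classic); last first.
  apply/seteqP; split => x /=; first by case.
  by rewrite !in_itv/= => /andP[-> ->].
move=> mphi; rewrite cut_patch.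
apply/(measurable_restrictT _ _).1; first exact: measurableX.
apply: (@measurable_comp _ _ _ (R * Omega)%type (R * F_ b)%type R
  (`[a, b]%classic `*` setT) (fun z => phi z.1 z.2 i 0) _ (fun z => z)).
- exact: measurableX.
- move=> _ [[x w] [/= + _]] <-; rewrite !in_itv/= => /andP[/ltW ax xb].
  by split => //=; apply/andP.
- exact: mphi.
- apply: measurable_funTS; exact: measurable_prod_filtration.
Qed.

Lemma progressive_adapted n a b (phi : process R Omega n) i s :
  progressive P W `[a, b] phi -> a <= s <= b -> adapted_at s (comp phi i s).
Proof.
move=> pphi sab; have ss : `[a, b]%classic s by rewrite /= in_itv/=.
apply: (@measurable_comp _ _ _ (F_ s) (R * F_ s)%type R
  ((`[a, b]%classic `&` `]-oo, s]%classic) `*` setT)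
  (fun z => phi z.1 z.2 i 0) _ (pair s)).
- by apply: measurableX => //; exact: measurableI.
- by move=> _ [w _] <-; split => //; split => //=; rewrite in_itv/= lexx.
- exact: pphi ss i.
- exact: pair1_measurable.
Qed.

(** Tonelli's theorem for the sum of the squares of the coordinates; the closed
    and the half-open interval differ by a point. *)
Lemma int_cut_sqnorm n a b (phi : process R Omega n) i :
  (forall i, measurable_fun [set: R * Omega] (cut (comp phi i) a b)) ->
  (\int[M]_z (cut (comp phi i) a b z ^+ 2)%:E <=
   \int[P]_w \int[leb]_(s in `[a, b]) (sqnorm (phi s w))%:E)%E.
Proof.
move=> mphi.
have mi : measurable_fun [set: R * Omega] (fun z => (cut (comp phi i) a b z ^+ 2)%:E).
  exact/measurable_EFinP/measurable_funX.
have i_ge0 z : (0 <= (cut (comp phi i) a b z ^+ 2)%:E)%E by rewrite lee_fin sqr_ge0.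
pose S (z : R * Omega) := \sum_(j < n) cut (comp phi j) a b z ^+ 2.
have mS : measurable_fun [set: R * Omega] (EFin \o S).
  by apply/measurable_EFinP/measurable_sum => j; exact: measurable_funX.
have S_ge0 z : (0 <= (EFin \o S) z)%E.
  by rewrite lee_fin sumr_ge0// => j _; exact: sqr_ge0.
have eS w : (\int[leb]_(s in `[a, b]) (sqnorm (phi s w))%:E =
    \int[leb]_s (S (s, w))%:E)%E.
  have mSw : measurable_fun [set: R] (fun s => S (s, w)).
    apply: (@measurable_sum _ R) => j; apply: measurable_funX.
    by apply: (measurableT_comp (mphi j)); exact: pair2_measurable.
  have e : {in `]a, b]%classic : set R, (fun s => sqnorm (phi s w)) =1 (fun s => S (s, w))}.
    move=> s; rewrite inE/= in_itv/= => sab; apply: eq_bigr => j _.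
    by rewrite /cut /window/= sab mul1r.
  rewrite -integral_itv_obnd_cbnd; last first.
    apply/measurable_EFinP.
    by apply: (eq_measurable_fun (fun s => S (s, w))) => [s /e ->//|]; exact: measurable_funTS.
  rewrite integral_mkcond; apply: eq_integral => s _; rewrite patchE.
  case: ifPn => [/e ->//|]; rewrite notin_setE/= in_itv/= => /negP/negbTE nsab.
  rewrite /S big1// => j _.
  by rewrite /cut /window/= nsab mul0r expr0n.
rewrite [leRHS](_ : _ = (\int[P]_w \int[leb]_s (S (s, w))%:E)%E); last first.
  by apply: eq_integral => w _; exact: eS.
rewrite [leLHS](_ : _ = (\int[P]_w \int[leb]_s (cut (comp phi i) a b (s, w) ^+ 2)%:E)%E); last first.
  exact: fubini_tonelli2.
apply: ge0_le_integral => //.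
- by move=> w _; apply: integral_ge0.
- exact: (measurable_fun_fubini_tonelli_G (m1 := leb) _ mi i_ge0).
- exact: (measurable_fun_fubini_tonelli_G (m1 := leb) _ mS S_ge0).
move=> w _; apply: ge0_le_integral => //.
- by apply: (measurableT_comp mi); exact: pair2_measurable.
- by apply: (measurableT_comp mS); exact: pair2_measurable.
move=> s _; rewrite lee_fin /S (bigD1 i)//= lerDl sumr_ge0// => j _.
exact: sqr_ge0.
Qed.

Lemma L2F_admissible n a b (phi : process R Omega n) i :
  L2F P W `[a, b] phi -> admissible a b (comp phi i).
Proof.
move=> [pphi oo]; split; last by move=> s; exact: progressive_adapted.
apply/L2P; split; first exact: progressive_measurable.
apply: le_lt_trans oo; apply: int_cut_sqnorm => j.
exact: progressive_measurable.
Qed.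

Lemma simple_ito_sum (N : nat) (v : nat -> R * Omega -> R) (I : nat -> Omega -> R) :
  (forall k, (k < N)%N -> simple_ito P W (v k) (I k)) ->
  simple_ito P W (fun z => \sum_(k < N) v k z) (fun w => \sum_(k < N) I k w).
Proof.
elim: N => [|N IH] h.
  rewrite (_ : (fun _ => _) = 0); last by apply/funext => z; rewrite big_ord0.
  rewrite [X in simple_ito _ _ _ X](_ : _ = 0); last by apply/funext => z; rewrite big_ord0.
  exact: simple_ito0.
rewrite (_ : (fun _ => _) = (fun z => \sum_(k < N) v k z) + cst 1 * v N); last first.
  by apply/funext => z; rewrite big_ord_recr/= !fctE mul1r.
rewrite [X in simple_ito _ _ _ X](_ : _ = (fun z => \sum_(k < N) I k z) + cst 1 * I N); last first.
  by apply/funext => z; rewrite big_ord_recr/= !fctE mul1r.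
apply: simple_ito_lin; last exact: h.
by apply: IH => k kN; apply: h; exact: ltnW.
Qed.

Lemma sqr_coord_le n (v : 'cV[R]_n) i : v i 0 ^+ 2 <= sqnorm v.
Proof. by rewrite /sqnorm (bigD1 i)//= lerDl sumr_ge0// => j _; exact: sqr_ge0. Qed.

Lemma simple_process_ito n a b (S : simple_process P W a b n) i : 0 <= a ->
  simple_ito P W (fun z => sp_val S z.1 z.2 i 0) (fun w => sp_int S w i 0).
Proof.
move=> a0; pose xi k w := sp_coef S k w i 0.
pose v k (z : R * Omega) := window (sp_time S k) (sp_time S k.+1) z.1 * xi k z.2.
pose I k := xi k * (W (sp_time S k.+1) - W (sp_time S k)).
have -> : (fun z => sp_val S z.1 z.2 i 0) = (fun z => \sum_(k < sp_size S) v k z).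
  apply/funext => z; rewrite /sp_val summxE; apply: eq_bigr => k _.
  by rewrite /v /window; case: ifP => _; rewrite ?mul1r// mul0r mxE.
have -> : (fun w => sp_int S w i 0) = (fun w => \sum_(k < sp_size S) I k w).
  apply/funext => w; rewrite /sp_int summxE; apply: eq_bigr => k _.
  by rewrite mxE mulrC.
apply: simple_ito_sum => k kN; have [K hK] := sp_coef_bounded S.
apply: (@simple_ito_step _ _ _ _ _ _ _ _ (Num.sqrt K)).
- have /andP[+ _] := sp_time_bounds (s := S) (ltnW kN); exact: le_trans.
- exact: sp_time_mono.
- exact: sp_coef_meas.
- move=> w; rewrite -sqrtr_sqr ler_wsqrtr// (le_trans _ (hK _ kN w))//.
  exact: sqr_coord_le.
Qed.

Lemma cvg0_le_EFin (u : nat -> R) (e : nat -> \bar R) : (forall k, 0 <= u k) ->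
  (forall k, ((u k)%:E <= e k)%E) -> e @ \oo --> 0%E -> u @ \oo --> (0 : R).
Proof.
move=> u0 ue e0.
have : (EFin \o u) @ \oo --> 0%:E.
  apply: (@squeeze_cvge _ _ _ _ (cst 0%E) _ e) => //; last exact: cvg_cst.
  by apply: nearW => k; rewrite lee_fin u0/= ue.
by move=> /fine_cvgP[].
Qed.

(** [ito] only involves integrals, hence does not see null sets. *)
Lemma ito_ae v I J : ito P W v I -> measurable_fun [set: Omega] J ->
  {ae P, forall w, J w = I w} -> ito P W v J.
Proof.
move=> [L2v L2I [v_ [I_ [sv cv cI]]]] mJ JI.
have [mI _] := L2I.
have L2J : L2 P J.
  apply/L2P; split=> //; have /L2P[_] := L2I.
  rewrite (@ae_eq_integral _ _ _ P _ (fun w => (J w ^+ 2)%:E))//.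
  - exact/measurable_EFinP/measurable_funX.
  - exact/measurable_EFinP/measurable_funX.
  - by apply: aeS JI => w -> _.
split=> //; exists v_, I_; split=> //.
rewrite /L2cvg (_ : (fun _ => _) = (fun k => ip P (I_ k - I) (I_ k - I)))//.
apply/funext => k.
have [_ [mIk _]] := simple_ito_L2 P_complete W_brownian (sv k).
apply: ae_int_eq.
- by apply: measurable_funM; exact: measurable_funB.
- by apply: measurable_funM; exact: measurable_funB.
- by apply: aeS JI => w e; rewrite !fctE e.
Qed.

(** The mean-square convergence of vectors controls each coordinate. That [I] is
    square integrable is a consequence: it is at finite mean-square distance from
    some simple integral. *)
Lemma is_ito_integral_comp n a b (phi : process R Omega n) I i : 0 <= a ->
  is_ito_integral P W a b phi I ->
  ito P W (cut (comp phi i) a b) (fun w => I w i 0).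
Proof.
move=> a0 [L2Fphi mI [S [cv cI]]].
have [L2phi _] := L2F_admissible i L2Fphi.
have sS k := simple_process_ito (S k) i a0.
have L2v k := (simple_ito_L2 P_complete W_brownian (sS k)).1.
have L2I k := (simple_ito_L2 P_complete W_brownian (sS k)).2.
have valcut k j : cut (comp (sp_val (S k)) j) a b = (fun z => sp_val (S k) z.1 z.2 j 0).
  apply/funext => z; rewrite /cut /comp /window.
  have [_|nab] := boolP (a < z.1 <= b); rewrite ?mul1r// mul0r.
  rewrite /sp_val summxE big1// => l _; case: ifPn => [/andP[lz zl]|]; last by rewrite mxE.
  case/negP: nab; have /andP[al _] := sp_time_bounds (s := S k) (ltnW (ltn_ord l)).
  have /andP[_ bl] := sp_time_bounds (s := S k) (ltn_ord l).
  by rewrite (le_lt_trans al lz) (le_trans zl bl).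
have subE k j : cut (comp (fun s w => sp_val (S k) s w - phi s w) j) a b =
    (fun z => sp_val (S k) z.1 z.2 j 0) - cut (comp phi j) a b.
  by rewrite -valcut; apply/funext => z; rewrite !fctE /cut /comp !mxE mulrBr.
have msub k j : measurable_fun [set: R * Omega]
    (cut (comp (fun s w => sp_val (S k) s w - phi s w) j) a b).
  rewrite subE; apply: measurable_funB; last exact: L2_measurable (L2F_admissible j L2Fphi).1.
  exact: L2_measurable (simple_ito_L2 P_complete W_brownian (simple_process_ito (S k) j a0)).1.
have cv' : L2cvg M (fun k z => sp_val (S k) z.1 z.2 i 0) (cut (comp phi i) a b).
  apply: cvg0_le_EFin cv => k; first exact: ip_ge0.
  apply: le_trans (int_cut_sqnorm i (msub k)).
  rewrite -int_EFin; last by apply: L2_sqr; exact: L2B.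
  rewrite le_eqVlt; apply/orP; left; apply/eqP.
  by apply: eq_integral => z _; rewrite subE expr2.
(* the integrability of [I] is a consequence of the convergence *)
have key k : ((\int[P]_w ((sp_int (S k) w i 0 - I w i 0) ^+ 2)%:E) <=
    \int[P]_w (sqnorm (sp_int (S k) w - I w))%:E)%E.
  apply: ge0_le_integral => //.
  - by move=> w _; rewrite lee_fin sqr_ge0.
  - apply/measurable_EFinP/measurable_funX/measurable_funB => //.
    exact: L2_measurable (L2I k).
  - apply/measurable_EFinP/measurable_sum => j; apply: measurable_funX.
    rewrite (_ : (fun _ => _) = (fun w => sp_int (S k) w j 0) - (fun w => I w j 0)).
      apply: measurable_funB => //.
      exact: L2_measurable (simple_ito_L2 P_complete W_brownian (simple_process_ito (S k) j a0)).2.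
    by apply/funext => w; rewrite !mxE.
  - move=> w _; rewrite lee_fin.
    have := sqr_coord_le (sp_int (S k) w - I w) i.
    by rewrite !mxE.
have [N hN] : exists k, L2 P ((fun w => sp_int (S k) w i 0) - (fun w => I w i 0)).
  have /fine_cvgP[[N _ fN] _] := cI.
  exists N; apply/L2P; split.
    by apply: measurable_funB => //; exact: L2_measurable (L2I N).
  apply: le_lt_trans (key N) _.
  have := fN N (leqnn _); rewrite ge0_fin_numE// integral_ge0// => w _.
  by rewrite lee_fin sumr_ge0// => j _; exact: sqr_ge0.
have L2Ii : L2 P (fun w => I w i 0).
  rewrite (_ : (fun _ => _) = (fun w => sp_int (S N) w i 0) -
    ((fun w => sp_int (S N) w i 0) - (fun w => I w i 0))); last first.
    by apply/funext => w; rewrite !fctE subKr.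
  exact: L2B.
split=> //; exists (fun k z => sp_val (S k) z.1 z.2 i 0), (fun k w => sp_int (S k) w i 0).
split=> //; apply: cvg0_le_EFin cI => k; first exact: ip_ge0.
rewrite -int_EFin; last by apply: L2_sqr; exact: L2B.
by apply: le_trans (key k); under eq_integral do rewrite -expr2.
Qed.

Lemma cst_int_window a s (f : R -> R) : measurable_fun [set: R] (fun r => window a s r * f r) ->
  \int[leb]_(r in `[a, s]) f r = \int[leb]_r (window a s r * f r).
Proof.
move=> mf.
have e : (fun r => window a s r * f r) = f \_ `]a, s]%classic.
  apply/funext => r; rewrite patchE windowE indicE.
  by case: (_ \in _); rewrite ?mul1r ?mul0r.
rewrite e -Rintegral_mkcond /Rintegral -integral_itv_obnd_cbnd//.
apply/measurable_EFinP; move: mf; rewrite e.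
by apply: (measurable_restrictT _ _).2.
Qed.

Lemma admissible_slice a b f w : admissible a b f -> forall s, s <= b ->
  measurable_fun [set: R] (fun r => window a s r * f r w).
Proof.
move=> [L2f _] s sb; have L2s : L2 M (cut f a s) by exact: L2_cutS L2f.
exact: (measurableT_comp (L2_measurable L2s) (pair2_measurable w)).
Qed.

(** The exceptional null set of the vector equation is absorbed by the
    insensitivity of [ito] to null sets. *)
Lemma ito_process_comp n a b (xi : Omega -> 'cV[R]_n)
    (beta sigma X : process R Omega n) i : 0 <= a ->
  adapted_at a (fun w => xi w i 0) -> L2 P (fun w => xi w i 0) ->
  admissible a b (comp beta i) ->
  ito_process P W a b xi beta sigma X ->
  ms_process P W a b (fun w => xi w i 0) (comp beta i) (comp sigma i) (comp X i).
Proof.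
move=> a0 mxi L2xi abeta [L2FX _ eqX].
have [L2X aX] := L2F_admissible i L2FX; have [L2b ab] := abeta.
split=> //; first by move=> s /andP[/ltW as_ sb]; apply: ab; rewrite as_.
move=> s sab; have /andP[as_ sb] := sab.
have [I iI eI] := eqX s sab.
apply: (ito_ae (is_ito_integral_comp i a0 iI)).
  apply: measurable_funB; last first.
    by apply: measurable_path_int; exact: L2_measurable (L2_cutS (lexx a) sb L2b).
  apply: measurable_funB; last exact: adapted_measurable mxi.
  exact: (adapted_measurable P_complete W_brownian (aX _ sab)).
apply: aeS eI => w e.
rewrite !fctE /comp e !mxE /drift_int /path_int.
by rewrite (cst_int_window (admissible_slice w abeta sb)) /cut/=; ring.
Qed.

Lemma admissibleD a b f g : admissible a b f -> admissible a b g ->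
  admissible a b (fun s w => f s w + g s w).
Proof.
move=> [L2f mf] [L2g mg]; split; last first.
  by move=> s sab; apply: measurable_funD; [exact: mf|exact: mg].
rewrite (_ : cut _ _ _ = cut f a b + cut g a b); first exact: L2D.
by apply/funext => z; rewrite !fctE /cut mulrDr.
Qed.

Lemma admissibleZ a b c f : admissible a b f ->
  admissible a b (fun s w => c * f s w).
Proof.
move=> [L2f mf]; split; last by move=> s sab; apply: measurable_funM => //; exact: mf.
rewrite (_ : cut _ _ _ = cst c * cut f a b); first exact: L2Z.
by apply/funext => z; rewrite !fctE /cut mulrCA.
Qed.

Lemma admissible_sum (I : Type) (r : seq I) a b (F : I -> R -> Omega -> R) :
  (forall i, admissible a b (F i)) ->
  admissible a b (fun s w => \sum_(i <- r) F i s w).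
Proof.
move=> aF; elim: r => [|i r IH].
  rewrite (_ : (fun _ => _) = (fun _ => cst 0)); last first.
    by apply/funext => s; apply/funext => w; rewrite big_nil.
  split; last by move=> s _; exact: measurable_cst.
  rewrite (_ : cut _ _ _ = 0); first exact: L2_0.
  by apply/funext => z; rewrite /cut/= mulr0.
rewrite (_ : (fun _ => _) = (fun s w => F i s w + \sum_(i <- r) F i s w)).
  exact: admissibleD.
by apply/funext => s; apply/funext => w; rewrite big_cons.
Qed.

Lemma admissible_mulmx n m a b (A : 'M[R]_(n, m)) (X : process R Omega m) :
  (forall i, admissible a b (comp X i)) ->
  forall i, admissible a b (comp (fun s w => A *m X s w) i).
Proof.
move=> aX i; rewrite (_ : comp _ _ = (fun s w => \sum_j A i j * comp X j s w)).
  by apply: admissible_sum => j; exact: admissibleZ.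
by apply/funext => s; apply/funext => w; rewrite /comp mxE.
Qed.

Lemma admissible_addmx n a b (X Y : process R Omega n) :
  (forall i, admissible a b (comp X i)) ->
  (forall i, admissible a b (comp Y i)) ->
  forall i, admissible a b (comp (fun s w => X s w + Y s w) i).
Proof.
move=> aX aY i; rewrite (_ : comp _ _ = (fun s w => comp X i s w + comp Y i s w)).
  exact: admissibleD.
by apply/funext => s; apply/funext => w; rewrite /comp mxE.
Qed.

Lemma admissibleS a b a' b' f : a <= a' -> b' <= b -> admissible a b f ->
  admissible a' b' f.
Proof.
move=> aa bb [L2f mf]; split; first exact: L2_cutS L2f.
by move=> s /andP[as_ sb]; apply: mf; rewrite (le_trans aa)// (le_trans sb).
Qed.

(** The spike variation glues the trial control and the feedback at a
    deterministic time. *)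
Lemma admissible_if a b c f g : admissible a b f -> admissible a b g ->
  admissible a b (fun s w => if s < c then f s w else g s w).
Proof.
move=> [L2f mf] [L2g mg]; split; last first.
  by move=> s sab; case: (s < c); [exact: mf|exact: mg].
pose k (z : R * Omega) : R := (c <= z.1)%R%:R.
have mk : measurable_fun [set: R * Omega] k.
  rewrite (_ : k = \1_(`[c, +oo[%classic) \o fst); last first.
    by apply/funext => z /=; rewrite indicE mem_setE in_itv/= andbT.
  by apply: (measurableT_comp (measurable_indic _)) => //; exact: measurable_fst.
have kb z : `|k z| <= 1 by rewrite /k; case: (c <= z.1); rewrite ?normr1 ?normr0.
rewrite (_ : cut _ _ _ = (cut f a b - k * cut f a b) + k * cut g a b).
  by apply: L2D; [apply: L2B => //|]; apply: (L2_bounded (M := 1)).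
apply/funext => z; rewrite !fctE /cut /k ltNge.
by case: (c <= z.1); rewrite /= ?mul1r ?mul0r ?subrr ?add0r ?subr0 ?addr0.
Qed.

(** The increment of the equation between [t] and [s] is the difference of the
    equations on $[a, s]$ and $[a, t]$; the drift is additive along almost every
    path. *)
Lemma ms_restart a t b xi beta sigma X : a <= t -> t <= b ->
  adapted_at t (X t) ->
  (forall s, t <= s <= b -> measurable_fun [set: Omega] (X s)) ->
  ms_process P W a b xi beta sigma X ->
  ms_process P W t b (X t) beta sigma X.
Proof.
move=> at_ tb mXt mX XP.
have [mxi L2xi L2b mb L2X eqX] := XP.
split=> //.
- by apply: (ms_value_L2 XP); rewrite at_.
- by apply: L2_cutS L2b.
- by move=> s /andP[ts sb]; apply: mb; rewrite (le_lt_trans at_)// sb.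
- by apply: L2_cutS L2X.
move=> s /andP[ts sb].
have as_ : a <= s by exact: le_trans ts.
have is_ : a <= s <= b by rewrite as_.
have it : a <= t <= b by rewrite at_.
have := itoB P_complete W_brownian (eqX s is_) (eqX t it).
rewrite (cutB _ at_ ts) => /ito_ae; apply.
  apply: measurable_funB.
    apply: measurable_funB; last exact: (adapted_measurable P_complete W_brownian mXt).
    by apply: mX; rewrite ts.
  by apply: measurable_path_int; exact: L2_measurable (L2_cutS at_ sb L2b).
apply: aeS (L1_slice2 (L1_cut L2b)) => w L1w.
have L1S t' : t' <= b -> L1 leb (fun r => cut beta a t' (r, w)).
  move=> t'b; have -> : (fun r => cut beta a t' (r, w)) =
      window a t' * (fun r => cut beta a b (r, w)).
    by apply/funext => r; rewrite !fctE /cut/= mulrA window_sub.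
  apply: (L1_bounded (M := 1)) => //; first exact: measurable_window.
  exact: window_bound.
have e : drift_int beta t s w = drift_int beta a s w - drift_int beta a t w.
  rewrite /drift_int /path_int -intB; [|exact: L1S|exact: L1S].
  by apply: eq_Rintegral => r _; rewrite -(cutB beta at_ ts).
by rewrite !fctE e; ring.
Qed.

End components.

(** * Bilinear forms and their integrals *)

Section bilinear_forms.
Context {R : realType}.

(** All matrix identities below are stated for such scalars, where they become
    polynomial identities. *)
Definition bilf n m (G : 'M[R]_(n, m)) (x : 'cV[R]_n) (y : 'cV[R]_m) : R :=
  (x^T *m G *m y) 0 0.

Lemma bilfE n m (G : 'M[R]_(n, m)) x y :
  bilf G x y = \sum_i \sum_j G i j * (x i 0 * y j 0).
Proof.
rewrite /bilf mxE exchange_big/=; apply: eq_bigr => j _.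
rewrite mxE mulr_suml; apply: eq_bigr => i _; rewrite mxE.
ring.
Qed.

Lemma bilfDl n m (G : 'M[R]_(n, m)) x x' y :
  bilf G (x + x') y = bilf G x y + bilf G x' y.
Proof. by rewrite /bilf linearD/= !mulmxDl mxE. Qed.

Lemma bilfDr n m (G : 'M[R]_(n, m)) x y y' :
  bilf G x (y + y') = bilf G x y + bilf G x y'.
Proof. by rewrite /bilf mulmxDr mxE. Qed.

Lemma bilfNl n m (G : 'M[R]_(n, m)) x y : bilf G (- x) y = - bilf G x y.
Proof. by rewrite /bilf linearN/= !mulNmx mxE. Qed.

Lemma bilfNr n m (G : 'M[R]_(n, m)) x y : bilf G x (- y) = - bilf G x y.
Proof. by rewrite /bilf mulmxN mxE. Qed.

Lemma bilfZl n m (G : 'M[R]_(n, m)) c x y : bilf G (c *: x) y = c * bilf G x y.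
Proof. by rewrite /bilf linearZ/= -!scalemxAl mxE. Qed.

Lemma bilfZr n m (G : 'M[R]_(n, m)) c x y : bilf G x (c *: y) = c * bilf G x y.
Proof. by rewrite /bilf -scalemxAr mxE. Qed.

Lemma bilf_D n m (G G' : 'M[R]_(n, m)) x y :
  bilf (G + G') x y = bilf G x y + bilf G' x y.
Proof. by rewrite /bilf mulmxDr mulmxDl mxE. Qed.

Lemma bilf_mulr n m p (G : 'M[R]_(n, m)) (A : 'M[R]_(m, p)) x y :
  bilf G x (A *m y) = bilf (G *m A) x y.
Proof. by rewrite /bilf !mulmxA. Qed.

Lemma bilf_mull n m p (G : 'M[R]_(n, m)) (A : 'M[R]_(n, p)) x y :
  bilf G (A *m x) y = bilf (A^T *m G) x y.
Proof. by rewrite /bilf trmx_mul !mulmxA. Qed.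

Lemma bilf_tr n m (G : 'M[R]_(n, m)) x y : bilf G x y = bilf G^T y x.
Proof.
rewrite /bilf -[in LHS](trmxK (x^T *m G *m y)) mxE !trmx_mul trmxK mulmxA.
by [].
Qed.

Lemma sqnormE n (x : 'cV[R]_n) : sqnorm x = bilf 1%:M x x.
Proof. by rewrite /sqnorm /bilf mulmx1 mxE; apply: eq_bigr => i _; rewrite mxE expr2. Qed.

Lemma sqnorm_ge0 n (x : 'cV[R]_n) : 0 <= sqnorm x.
Proof. by apply: sumr_ge0 => i _; exact: sqr_ge0. Qed.

(** A substitute for the operator norm: it controls the bilinear form through
    [bilf_le]. *)
Definition mxbound n m (G : 'M[R]_(n, m)) : R := \sum_i \sum_j `|G i j|.

Lemma mxbound_ge0 n m (G : 'M[R]_(n, m)) : 0 <= mxbound G.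
Proof. by apply: sumr_ge0 => i _; apply: sumr_ge0 => j _; exact: normr_ge0. Qed.

Lemma bilf_le n m (G : 'M[R]_(n, m)) x y :
  `|bilf G x y| <= mxbound G * (sqnorm x + sqnorm y).
Proof.
rewrite bilfE (le_trans (ler_norm_sum _ _ _))// /mxbound mulr_suml.
apply: ler_sum => i _; rewrite (le_trans (ler_norm_sum _ _ _))// mulr_suml.
apply: ler_sum => j _; rewrite normrM ler_wpM2l// normrM.
have := sqr_coord_le x i; have := sqr_coord_le y j.
rewrite -(real_normK (num_real (x i 0))) -(real_normK (num_real (y j 0))).
have := sqr_ge0 (`|x i 0| - `|y j 0|); have := normr_ge0 (x i 0).
have := normr_ge0 (y j 0); nra.
Qed.

Lemma bilf_le_diag n (G : 'M[R]_n) x : `|bilf G x x| <= 2 * mxbound G * sqnorm x.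
Proof. by apply: (le_trans (bilf_le G x x)); lra. Qed.

End bilinear_forms.

Section integral_bilf.
Context d (T : measurableType d) (R : realType).
Variable mu : {measure set T -> \bar R}.

Definition vL2 n (x : T -> 'cV[R]_n) := forall i, L2 mu (fun z => x z i 0).

Lemma vL2B n (x y : T -> 'cV[R]_n) : vL2 x -> vL2 y -> vL2 (fun z => x z - y z).
Proof.
move=> Lx Ly i; rewrite (_ : (fun _ => _) = (fun z => x z i 0) - (fun z => y z i 0)).
  exact: L2B.
by apply/funext => z; rewrite !mxE.
Qed.

Lemma L1_bilf_fun n m (G : T -> 'M[R]_(n, m)) (K : R) x y :
  (forall i j, measurable_fun [set: T] (fun z => G z i j)) ->
  (forall z i j, `|G z i j| <= K) -> vL2 x -> vL2 y ->
  L1 mu (fun z => bilf (G z) (x z) (y z)).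
Proof.
move=> mG GK Lx Ly; rewrite (_ : (fun _ => _) = \sum_i \sum_j
    ((fun z => G z i j) * ((fun z => x z i 0) * (fun z => y z j 0)))).
  apply: L1_sum => i; apply: L1_sum => j.
  by apply: (L1_bounded (M := K)) => //; exact: L1_mul.
apply/funext => z; rewrite bilfE fct_sumE; apply: eq_bigr => i _.
by rewrite fct_sumE; apply: eq_bigr.
Qed.

Lemma L1_bilf n m (G : 'M[R]_(n, m)) x y : vL2 x -> vL2 y ->
  L1 mu (fun z => bilf G (x z) (y z)).
Proof.
move=> Lx Ly; apply: (@L1_bilf_fun _ _ (cst G) (mxbound G)) => // z i j /=.
rewrite /mxbound (bigD1 i)//= (bigD1 j)//= -addrA lerDl addr_ge0//.
  by apply: sumr_ge0 => k _; exact: normr_ge0.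
by apply: sumr_ge0 => k _; apply: sumr_ge0 => l _; exact: normr_ge0.
Qed.

Lemma int_bilf n m (G : 'M[R]_(n, m)) x y : vL2 x -> vL2 y ->
  \int[mu]_z bilf G (x z) (y z) =
  \sum_i \sum_j G i j * ip mu (fun z => x z i 0) (fun z => y z j 0).
Proof.
move=> Lx Ly; rewrite (_ : (fun z => bilf _ _ _) = \sum_i \sum_j
    (cst (G i j) * ((fun z => x z i 0) * (fun z => y z j 0)))); last first.
  apply/funext => z; rewrite bilfE fct_sumE; apply: eq_bigr => i _.
  by rewrite fct_sumE; apply: eq_bigr.
rewrite int_sum; last by move=> i; apply: L1_sum => j; apply: L1Z; exact: L1_mul.
apply: eq_bigr => i _; rewrite int_sum; last by move=> j; apply: L1Z; exact: L1_mul.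
by apply: eq_bigr => j _; rewrite intZ//; exact: L1_mul.
Qed.

End integral_bilf.

(** * Second moments of vector-valued Ito processes *)

Section vector_process.
Context {R : realType} {d : measure_display} {Omega : measurableType d}.
Variable P : probability Omega R.
Hypothesis P_complete : measure_is_complete P.
Variable W : R -> Omega -> R.
Hypothesis W_brownian : brownian_motion P W.
Local Notation adapted_at := (adapted_at P W).
Local Notation leb := (@lebesgue_measure R).
Local Notation M := (leb \x P)%E.

Definition vcut n (phi : process R Omega n) (s t : R) (z : R * Omega) : 'cV[R]_n :=
  window s t z.1 *: phi z.1 z.2.

Lemma vcutE n (phi : process R Omega n) s t i :
  (fun z => vcut phi s t z i 0) = cut (comp phi i) s t.
Proof. by apply/funext => z; rewrite /vcut mxE. Qed.

Lemma vcutD n (phi psi : process R Omega n) s t z :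
  vcut (fun s w => phi s w + psi s w) s t z = vcut phi s t z + vcut psi s t z.
Proof. by rewrite /vcut scalerDr. Qed.

Lemma vcut_mulmx n m (A : 'M[R]_(n, m)) (phi : process R Omega m) s t z :
  vcut (fun s w => A *m phi s w) s t z = A *m vcut phi s t z.
Proof. by rewrite /vcut scalemxAr. Qed.

Definition vadmissible n a b (phi : process R Omega n) :=
  forall i, admissible P W a b (comp phi i).

Lemma vadmissible_vL2 n a b (phi : process R Omega n) s : s <= b ->
  vadmissible a b phi -> vL2 M (vcut phi a s).
Proof.
by move=> sb h i; rewrite vcutE; have [+ _] := h i; exact: L2_cutS.
Qed.

Definition vms_process n a b (xi : Omega -> 'cV[R]_n) (beta sigma X : process R Omega n) :=
  forall i, ms_process P W a b (fun w => xi w i 0) (comp beta i) (comp sigma i)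
    (comp X i).

Section pair.
Variables (n m : nat) (a b : R) (ab : a <= b).
Variables (xi : Omega -> 'cV[R]_n) (beta sigma X : process R Omega n).
Variables (xi' : Omega -> 'cV[R]_m) (beta' sigma' X' : process R Omega m).
Hypotheses (XP : vms_process a b xi beta sigma X)
           (XP' : vms_process a b xi' beta' sigma' X').

Lemma vms_vL2 s : a <= s <= b -> [/\ vL2 P xi, vL2 P (X s), vL2 M (vcut beta a s),
  vL2 M (vcut sigma a s) & vL2 M (vcut X a s)].
Proof.
move=> sab; have /andP[as_ sb] := sab; split=> i.
- exact: ms_init_L2 (XP i).
- exact: (ms_value_L2 (XP i) sab).
- by rewrite vcutE; exact: L2_cutS (ms_drift_L2 (XP i)).
- by rewrite vcutE; exact: (ms_diffusion_L2 (XP i) sab).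
- by rewrite vcutE; exact: L2_cutS (ms_state_L2 (XP i)).
Qed.
End pair.

Lemma second_moment_bilf n m a b xi (beta sigma X : process R Omega n)
    xi' (beta' sigma' X' : process R Omega m) (G : 'M[R]_(n, m)) s :
  vms_process a b xi beta sigma X -> vms_process a b xi' beta' sigma' X' ->
  a <= s <= b ->
  \int[P]_w bilf G (X s w) (X' s w) = \int[P]_w bilf G (xi w) (xi' w) +
  \int[M]_z (bilf G (vcut X a s z) (vcut beta' a s z) +
    bilf G (vcut beta a s z) (vcut X' a s z) +
    bilf G (vcut sigma a s z) (vcut sigma' a s z)).
Proof.
move=> XP XP' sab.
have [Lxi LX Lb Ls LcX] := vms_vL2 XP sab.
have [Lxi' LX' Lb' Ls' LcX'] := vms_vL2 XP' sab.
have L1a := L1_bilf G LcX Lb'; have L1b := L1_bilf G Lb LcX'.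
have L1c := L1_bilf G Ls Ls'.
have -> : \int[M]_z (bilf G (vcut X a s z) (vcut beta' a s z) +
    bilf G (vcut beta a s z) (vcut X' a s z) +
    bilf G (vcut sigma a s z) (vcut sigma' a s z)) =
  \int[M]_z bilf G (vcut X a s z) (vcut beta' a s z) +
    \int[M]_z bilf G (vcut beta a s z) (vcut X' a s z) +
    \int[M]_z bilf G (vcut sigma a s z) (vcut sigma' a s z).
  by rewrite -intD// -intD//; exact: L1D.
rewrite !int_bilf// -!big_split/=; apply: eq_bigr => i _.
rewrite -!big_split/=; apply: eq_bigr => j _.
have := second_moment P_complete W_brownian sab (XP i) (XP' j).
by rewrite !vcutE /comp => ->; rewrite !mulrDr.
Qed.

Lemma L1_sqnorm d' (T : measurableType d') (mu : {measure set T -> \bar R}) n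
  (x : T -> 'cV[R]_n) : vL2 mu x -> L1 mu (fun z => sqnorm (x z)).
Proof.
move=> Lx; rewrite (_ : (fun _ => _) = (fun z => bilf 1%:M (x z) (x z))).
  exact: L1_bilf.
by apply/funext => z; rewrite sqnormE.
Qed.

Lemma ip_le_sqnorm d' (T : measurableType d') (mu : {measure set T -> \bar R}) n
  (x : T -> 'cV[R]_n) i : vL2 mu x ->
  ip mu (fun z => x z i 0) (fun z => x z i 0) <= \int[mu]_z sqnorm (x z).
Proof.
move=> Lx; apply: le_int; [exact: L2_sqr|exact: L1_sqnorm|].
by move=> z; rewrite -expr2; exact: sqr_coord_le.
Qed.

Lemma int_sqnormE d' (T : measurableType d') (mu : {measure set T -> \bar R}) n
  (x : T -> 'cV[R]_n) : vL2 mu x ->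
  \int[mu]_z sqnorm (x z) = \sum_i ip mu (fun z => x z i 0) (fun z => x z i 0).
Proof.
move=> Lx; rewrite -int_sum; last by move=> i; exact: L2_sqr.
by apply: eq_Rintegral => z _; rewrite fct_sumE; apply: eq_bigr => i _; rewrite expr2.
Qed.

Lemma int_vcut_sqnorm_le n (Z : process R Omega n) s t C : s <= t ->
  vL2 M (vcut Z s t) ->
  (forall r, s < r <= t -> vL2 P (Z r) /\ \int[P]_w sqnorm (Z r w) <= C) ->
  \int[M]_z sqnorm (vcut Z s t z) <= n%:R * (t - s) * C.
Proof.
move=> st LZ ZC; rewrite int_sqnormE//.
apply: (@le_trans _ _ (\sum_(i < n) ((t - s) * C))); last first.
  by rewrite sumr_const card_ord -[leLHS]mulr_natl mulrA.
apply: ler_sum => i _; have := LZ i; rewrite vcutE => LZi.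
apply: (L2_cut_bound st (L2_measurable LZi) _).2 => r /ZC[LZr ZCr].
by split; [exact: LZr|apply: le_trans ZCr; exact: ip_le_sqnorm].
Qed.

(** The discrete form of Gronwall's argument: on steps short with respect to
    [L] the increment cannot feed on itself. *)
Lemma gronwall_zero (a b L : R) (y : R -> R) : a <= b ->
  y a = 0 -> (forall s, a <= s <= b -> 0 <= y s) ->
  (forall s t, a <= s -> s <= t -> t <= b -> y t <= y s + L * (t - s) * y t) ->
  y b = 0.
Proof.
move=> ab ya y0 yL; pose N := (Num.truncn (2 * `|L| * (b - a))).+1.
have N0 : (0 : R) < N%:R by rewrite ltr0n.
have NL : 2 * `|L| * (b - a) <= N%:R by apply/ltW; rewrite truncnS_gt.
pose u k : R := a + k%:R * ((b - a) / N%:R).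
have st0 : 0 <= (b - a) / N%:R by rewrite divr_ge0// subr_ge0.
have u_mono k : u k <= u k.+1.
  by rewrite /u lerD2l ler_wpM2r// ler_nat.
have ua k : a <= u k by rewrite lerDl mulr_ge0.
have ub k : (k <= N)%N -> u k <= b.
  move=> kN; rewrite /u -lerBrDl mulrA ler_pdivrMr// mulrC ler_wpM2l ?subr_ge0//.
  by rewrite ler_nat.
suff h k : (k <= N)%N -> y (u k) = 0.
  rewrite -[RHS](h N (leqnn _)); congr y.
  by rewrite /u mulrCA divff ?gt_eqF// mulr1 subrKC.
elim: k => [_|k IH kN]; first by rewrite /u mul0r addr0.
have yk : 0 <= y (u k.+1) by apply: y0; rewrite ua ub.
have := yL _ _ (ua k) (u_mono k) (ub _ kN); rewrite (IH (ltnW kN)) add0r.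
have -> : u k.+1 - u k = (b - a) / N%:R by rewrite /u -natr1; ring.
have : L * ((b - a) / N%:R) <= 2^-1.
  apply: (@le_trans _ _ (`|L| * ((b - a) / N%:R))).
    by rewrite ler_wpM2r// ler_norm.
  by rewrite mulrA ler_pdivrMr//; move: NL; lra.
move=> h1 h2; apply/eqP; rewrite eq_le yk andbT; nra.
Qed.

Lemma bilfB_sqr n (G : 'M[R]_n) x y :
  bilf G (x - y) (x - y) = bilf G x x - bilf G x y - bilf G y x + bilf G y y.
Proof. by rewrite bilfDl !bilfDr !bilfNl !bilfNr; ring. Qed.

(** For $Z = X - X'$ the control cancels from the second-moment identity, which
    bounds $E|Z(s)|^2$ by a multiple of $y(s) = \int_a^s E|Z|^2$. Integrating
    over a short step and applying [gronwall_zero] gives $y = 0$. The identity is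
    used for the four pairs formed with [X] and [X'], so that [Z] itself need not
    be exhibited as an Ito process. *)
Lemma linear_unique n m a b (A C : 'M[R]_n) (B D : 'M[R]_(n, m)) xi
    (U : process R Omega m) (X X' : process R Omega n) : a <= b ->
  vms_process a b xi (fun s w => A *m X s w + B *m U s w)
    (fun s w => C *m X s w + D *m U s w) X ->
  vms_process a b xi (fun s w => A *m X' s w + B *m U s w)
    (fun s w => C *m X' s w + D *m U s w) X' ->
  \int[M]_z sqnorm (vcut X a b z - vcut X' a b z) = 0.
Proof.
move=> ab XP XP'.
pose Z s w := X s w - X' s w.
pose y s := \int[M]_z sqnorm (vcut Z a s z).
have ZE s t z : vcut Z s t z = vcut X s t z - vcut X' s t z.
  by rewrite /vcut scalerBr.
rewrite (_ : \int[M]_z _ = y b); last first.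
  by apply: eq_Rintegral => z _; rewrite -ZE.
pose G := A + A^T + C^T *m C.
pose K := 2 * mxbound G.
have K0 : 0 <= K by rewrite mulr_ge0// mxbound_ge0.
have LZM s : a <= s <= b -> vL2 M (vcut Z a s).
  move=> sab; have [_ _ _ _ h] := vms_vL2 XP sab; have [_ _ _ _ h'] := vms_vL2 XP' sab.
  by rewrite (_ : vcut Z a s = (fun z => vcut X a s z - vcut X' a s z)); [exact: vL2B|apply/funext => z; rewrite ZE].
have LZP s : a <= s <= b -> vL2 P (Z s).
  move=> sab; have [_ h _ _ _] := vms_vL2 XP sab; have [_ h' _ _ _] := vms_vL2 XP' sab.
  exact: vL2B.
have energy s : a <= s <= b -> \int[P]_w sqnorm (Z s w) <= K * y s.
  move=> sab; have [Lxi LX Lb Ls LcX] := vms_vL2 XP sab.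
  have [_ LX' Lb' Ls' LcX'] := vms_vL2 XP' sab.
  have e1 := second_moment_bilf 1%:M XP XP sab.
  have e2 := second_moment_bilf 1%:M XP XP' sab.
  have e3 := second_moment_bilf 1%:M XP' XP sab.
  have e4 := second_moment_bilf 1%:M XP' XP' sab.
  have L1P x x' : vL2 P x -> vL2 P x' -> L1 P (fun w => bilf (1%:M : 'M[R]_n) (x w) (x' w)).
    exact: L1_bilf.
  have L1M x x' : vL2 M x -> vL2 M x' -> L1 M (fun w => bilf (1%:M : 'M[R]_n) (x w) (x' w)).
    exact: L1_bilf.
  have lhs : \int[P]_w sqnorm (Z s w) =
      \int[P]_w bilf 1%:M (X s w) (X s w) - \int[P]_w bilf 1%:M (X s w) (X' s w) -
      \int[P]_w bilf 1%:M (X' s w) (X s w) + \int[P]_w bilf 1%:M (X' s w) (X' s w).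
    rewrite -intB ?L1P// -intB ?L1P//; last by apply: L1B; exact: L1P.
    rewrite -intD ?L1P//; last by apply: L1B; [apply: L1B|]; exact: L1P.
    by apply: eq_Rintegral => w _; rewrite sqnormE bilfB_sqr.
  rewrite lhs e1 e2 e3 e4.
  set i1 := \int[M]_z _; set i2 := \int[M]_z _; set i3 := \int[M]_z _.
  set i4 := \int[M]_z _; set x0 := \int[P]_w _.
  have -> : x0 + i1 - (x0 + i2) - (x0 + i3) + (x0 + i4) = i1 - i2 - i3 + i4 by ring.
  rewrite /i1 /i2 /i3 /i4 -intB; last 2 first.
  - by apply: L1D; [apply: L1D|]; exact: L1M.
  - by apply: L1D; [apply: L1D|]; exact: L1M.
  rewrite -intB; last 2 first.
  - by apply: L1B; apply: L1D; try apply: L1D; exact: L1M.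
  - by apply: L1D; [apply: L1D|]; exact: L1M.
  rewrite -intD; last 2 first.
  - by apply: L1B; [apply: L1B|]; apply: L1D; try apply: L1D; exact: L1M.
  - by apply: L1D; [apply: L1D|]; exact: L1M.
  rewrite /y /K -intZ; last by apply: L1_sqnorm; exact: LZM.
  apply: le_int.
  - apply: L1D; [apply: L1B; [apply: L1B|]|]; apply: L1D; try apply: L1D; exact: L1M.
  - by apply: L1Z; apply: L1_sqnorm; exact: LZM.
  move=> z; rewrite !fctE; apply: le_trans (ler_norm _) (le_trans _ (bilf_le_diag G _)).
  rewrite le_eqVlt; apply/orP; left; apply/eqP; congr `|_|.
  rewrite /G ZE !vcutD !vcut_mulmx.
  move: (vcut X a s z) (vcut X' a s z) (vcut U a s z) => x x' v.
  rewrite !(bilf_D, bilfDl, bilfDr, bilf_mulr, bilf_mull, mul1mx, mulmx1, mulmxA).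
  have t1 p q : bilf A^T p q = bilf A q p by rewrite bilf_tr trmxK.
  by rewrite !(t1, bilfNl, bilfNr); ring.
have decomp s t : a <= s -> s <= t -> t <= b ->
    y t = y s + \int[M]_z sqnorm (vcut Z s t z).
  move=> as_ st tb; have sab : a <= s <= b by rewrite as_ (le_trans st).
  have tab : a <= t <= b by rewrite (le_trans as_).
  have LZst : vL2 M (vcut Z s t).
    by move=> i; rewrite vcutE; apply: L2_cutS as_ (lexx t) _; have := LZM t tab i; rewrite vcutE.
  rewrite /y -intD; [|exact/L1_sqnorm/LZM|exact: L1_sqnorm].
  apply: eq_Rintegral => z _; rewrite !fctE /vcut (window_split _ as_ st).
  rewrite scalerDl !sqnormE bilfDl !bilfDr.
  rewrite (_ : bilf _ (window a s z.1 *: _) (window s t z.1 *: _) = 0); last first.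
    by rewrite bilfZl bilfZr mulrA window_disjoint mul0r.
  rewrite (_ : bilf _ (window s t z.1 *: _) (window a s z.1 *: _) = 0) ?add0r ?addr0//.
  by rewrite bilfZl bilfZr mulrA [window s t _ * _]mulrC window_disjoint mul0r.
have y_mono s t : a <= s -> s <= t -> t <= b -> y s <= y t.
  move=> as_ st tb; rewrite (decomp s t)// lerDl; apply: Rintegral_ge0 => z _.
  exact: sqnorm_ge0.
apply: (@gronwall_zero a b (n%:R * K) y) => //.
- rewrite /y (@eq_Rintegral _ _ _ M _ (cst 0)) ?Rintegral_cst ?mul0r//.
  by move=> z _; rewrite /vcut window_nil scale0r sqnormE bilfE big1// => i _; rewrite big1// => j _; rewrite !mxE !mulr0.
- by move=> s _; apply: Rintegral_ge0 => z _; exact: sqnorm_ge0.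
move=> s t as_ st tb; rewrite {1}(decomp s t)// lerD2l.
have tab : a <= t <= b by rewrite (le_trans as_).
rewrite (mulrAC (n%:R)) -[leRHS]mulrA; apply: int_vcut_sqnorm_le => //.
  by move=> i; rewrite vcutE; apply: L2_cutS as_ (lexx t) _; have := LZM t tab i; rewrite vcutE.
move=> r /andP[/ltW sr rt].
have rab : a <= r <= b by rewrite (le_trans as_ sr) (le_trans rt tb).
split; first exact: LZP.
apply: (le_trans (energy r rab)); rewrite ler_wpM2l// y_mono//.
exact: le_trans sr.
Qed.

End vector_process.

Section linear_equation.
Context {R : realType} {d : measure_display} {Omega : measurableType d}.
Variable P : probability Omega R.
Hypothesis P_complete : measure_is_complete P.
Variable W : R -> Omega -> R.
Hypothesis W_brownian : brownian_motion P W.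
Local Notation leb := (@lebesgue_measure R).
Local Notation M := (leb \x P)%E.

(** A constant for which $2\langle Ax + Bu, x\rangle + |Cx + Du|^2$ is at most
    [growth] times $|x|^2 + |u|^2$. *)
Definition growth n m (A C : 'M[R]_n) (B D : 'M[R]_(n, m)) : R :=
  2 * mxbound (A + A^T + C^T *m C) + mxbound B + mxbound B^T +
  mxbound (C^T *m D) + mxbound (D^T *m C) + 2 * mxbound (D^T *m D).

Lemma growth_ge0 n m (A C : 'M[R]_n) (B D : 'M[R]_(n, m)) : 0 <= growth A C B D.
Proof. by rewrite /growth !addr_ge0// ?mulr_ge0// mxbound_ge0. Qed.

(** Up to time [s] the second moment of the state is at most
    $E|\xi|^2 + K (y + u)$, with $K$ the growth constant and $y$, $u$ the energies
    of the state and of the control; integrating in time, the contribution of $y$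
    is absorbed when the interval is short. *)
Lemma linear_bound n m a b (A C : 'M[R]_n) (B D : 'M[R]_(n, m)) xi
    (U : process R Omega m) (X : process R Omega n) s :
  vms_process P W a b xi (fun s w => A *m X s w + B *m U s w)
    (fun s w => C *m X s w + D *m U s w) X ->
  vL2 M (vcut U a s) -> a <= s <= b ->
  n%:R * (s - a) * growth A C B D <= 2^-1 ->
  \int[M]_z sqnorm (vcut X a s z) <= 2 * (n%:R * (s - a)) *
    (\int[P]_w sqnorm (xi w) + growth A C B D * \int[M]_z sqnorm (vcut U a s z)).
Proof.
move=> XP LU sab; have /andP[as_ sb] := sab.
have [Lxi LX Lb Ls LcX] := vms_vL2 XP sab.
set K := growth A C B D; have K0 : 0 <= K := growth_ge0 A C B D.
set y := \int[M]_z sqnorm (vcut X a s z); set u := \int[M]_z sqnorm (vcut U a s z).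
set x0 := \int[P]_w sqnorm (xi w).
have u0 : 0 <= u by apply: Rintegral_ge0 => z _; exact: sqnorm_ge0.
have y0 : 0 <= y by apply: Rintegral_ge0 => z _; exact: sqnorm_ge0.
have x00 : 0 <= x0 by apply: Rintegral_ge0 => z _; exact: sqnorm_ge0.
have energy r : a < r <= s -> \int[P]_w sqnorm (X r w) <= x0 + K * (y + u).
  move=> /andP[/ltW ar rs]; have rab : a <= r <= b by rewrite ar (le_trans rs).
  have [_ LXr Lbr Lsr LcXr] := vms_vL2 XP rab.
  have LUr : vL2 M (vcut U a r).
    by move=> i; have := LU i; rewrite !vcutE; exact: L2_cutS.
  have e := second_moment_bilf P_complete W_brownian 1%:M XP XP rab.
  have sqE (x : Omega -> 'cV[R]_n) : \int[P]_w sqnorm (x w) = \int[P]_w bilf 1%:M (x w) (x w).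
    by apply: eq_Rintegral => w _; rewrite sqnormE.
  rewrite sqE e -sqE -/x0 lerD2l.
  apply: (@le_trans _ _ (\int[M]_z (cst K * ((fun z => sqnorm (vcut X a s z)) + (fun z => sqnorm (vcut U a s z)))) z)); last first.
    rewrite intZ ?intD//; [exact: L1_sqnorm|exact: L1_sqnorm|].
    by apply: L1D; exact: L1_sqnorm.
  apply: le_int.
  - by apply: L1D; [apply: L1D|]; exact: L1_bilf.
  - by apply: L1Z; apply: L1D; exact: L1_sqnorm.
  move=> z; rewrite !fctE !vcutD !vcut_mulmx.
  have mono k (phi : process R Omega k) : sqnorm (vcut phi a r z) <= sqnorm (vcut phi a s z).
    rewrite /vcut /window; case: (leP z.1 r) => zr.
      by rewrite (le_trans zr rs).
    rewrite andbF/= scale0r {1}/sqnorm big1 ?sqnorm_ge0// => i _.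
    by rewrite mxE expr0n.
  apply: (@le_trans _ _ (K * (sqnorm (vcut X a r z) + sqnorm (vcut U a r z)))); last first.
    by rewrite ler_wpM2l// lerD.
  move: (vcut X a r z) (vcut U a r z) => x v {mono}.
  rewrite !(bilfDl, bilfDr, bilf_mulr, bilf_mull, mul1mx, mulmx1, mulmxA).
  have t1 p q : bilf A^T p q = bilf A q p by rewrite bilf_tr trmxK.
  have := le_trans (ler_norm _) (bilf_le_diag (A + A^T + C^T *m C) x).
  rewrite !bilf_D.
  have := le_trans (ler_norm _) (bilf_le B x v).
  have := le_trans (ler_norm _) (bilf_le B^T v x).
  have := le_trans (ler_norm _) (bilf_le (C^T *m D) x v).
  have := le_trans (ler_norm _) (bilf_le (D^T *m C) v x).
  have := le_trans (ler_norm _) (bilf_le_diag (D^T *m D) v).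
  have := sqnorm_ge0 x; have := sqnorm_ge0 v.
  have := mxbound_ge0 (A + A^T + C^T *m C); have := mxbound_ge0 (D^T *m D).
  rewrite /K /growth.
  move: (mxbound (A + A^T + C^T *m C)) (mxbound B) (mxbound B^T) (mxbound (C^T *m D))
    (mxbound (D^T *m C)) (mxbound (D^T *m D)) (sqnorm x) (sqnorm v) => k1 k2 k3 k4 k5 k6 X2 V2.
  move=> k6_0 k1_0 V0 X0 h1 h2 h3 h4 h5 h6.
  have p1 : 0 <= k1 * V2 by exact: mulr_ge0.
  have p2 : 0 <= k6 * X2 by exact: mulr_ge0.
  rewrite !t1 in h6 *; lra.
move=> small.
have yle : y <= n%:R * (s - a) * (x0 + K * (y + u)).
  apply: int_vcut_sqnorm_le => // r ras; split; last exact: energy.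
  have /andP[/ltW ar rs] := ras.
  by have [] := @vms_vL2 _ _ _ _ _ _ _ _ _ _ _ _ XP r; rewrite ?ar ?(le_trans rs).
have c0 : 0 <= n%:R * (s - a) by rewrite mulr_ge0 ?subr_ge0.
move: (n%:R * (s - a)) c0 small yle => c c0 small yle.
have h1 : c * K * y <= 2^-1 * y by rewrite ler_wpM2r.
lra.
Qed.

(** ** Differentiating a deterministic weight times a second moment *)

(** With $g(s) = E[H(s)]$ and $h$ the integrand of its derivative, this is
    $(Sg)' = S g' + S' g$ in integrated form; [triangle_split] applies to the
    densities of $S$ and $g$, both only integrable. *)
Lemma product_rule (S S' : R -> R) (K : R) (a b g0 : R) (g : R -> R)
    (h : R * Omega -> R) (H : R -> Omega -> R) : a <= b ->
  measurable_fun [set: R] (window a b * S) -> measurable_fun [set: R] (window a b * S') ->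
  (forall r, `|(window a b * S) r| <= K) -> (forall r, `|(window a b * S') r| <= K) ->
  (forall s, a <= s <= b -> S s = S a + \int[leb]_r (window a s r * S' r)) ->
  L1 M h -> (forall z, window a b z.1 * h z = h z) ->
  (forall s, a <= s <= b -> g s = g0 + \int[M]_z ((z.1 <= s)%R%:R * h z)) ->
  L1 M (cut H a b) -> (forall s, a < s <= b -> \int[P]_w H s w = g s) ->
  S b * g b - S a * g0 = \int[M]_z ((window a b * S) z.1 * h z) +
    \int[M]_z ((window a b * S') z.1 * cut H a b z).
Proof.
move=> ab mS mS' SK S'K SE L1h hw gE L1H HE.
have winwin : window a b * window a b = window a b.
  by apply/funext => x; rewrite fctE window_mul maxxx minxx.
have bb : a <= b <= b by rewrite ab lexx.
pose f := window a b * S'.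
have L1f : L1 leb f.
  rewrite /f -winwin mulrAC -/f; apply: (L1_bounded (M := K)) => //.
  exact: L1_window.
have [L1k kE] := int_fubini1 L1h.
pose k s := \int[P]_w h (s, w); rewrite -/k in L1k kE.
have [L1fG L1Fk] := triangle_split L1f L1k.
set F := (X in L1 leb (X * k)) in L1Fk *; set G := (X in L1 leb (f * X)) in L1fG *.
have wf s r : s <= b -> (r <= s)%R%:R * f r = window a s r * S' r.
  move=> sb; rewrite /f fctE mulrA; congr (_ * _); rewrite /window -natrM mulnb.
  by rewrite andbCA; case: (leP r s) => rs; rewrite ?andbF//= (le_trans rs sb).
have FE s : a <= s <= b -> F s = S s - S a.
  move=> sab; rewrite (SE _ sab) [S a + _]addrC addrK; apply: eq_Rintegral => r _.
  by apply: wf; case/andP: sab.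
have GE s : a <= s <= b -> G s = g s - g0.
  move=> sab; rewrite (gE _ sab) [g0 + _]addrC addrK.
  have L1lh : L1 M (fun z => (z.1 <= s)%R%:R * h z).
    rewrite (_ : (fun z => _) = (fun z : R * Omega => (z.1 <= s)%R%:R : R) * h)//.
    apply: (L1_bounded (M := 1)) => //.
      by apply: (measurableT_comp (measurable_leR s)).
    by move=> z; case: (z.1 <= s); rewrite ?normr1 ?normr0.
  have [_ ->] := int_fubini1 L1lh; apply: eq_Rintegral => r _ /=.
  case: (r <= s); rewrite ?mul1r.
    by apply: eq_Rintegral => w _; rewrite mul1r.
  rewrite mul0r (@eq_Rintegral _ _ _ P _ (cst 0)) ?Rintegral_cst ?mul0r//.
  by move=> w _; rewrite mul0r.
have intf : \int[leb]_r f r = S b - S a.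
  rewrite -(FE b bb); apply: eq_Rintegral => r _.
  by rewrite wf.
have intk : \int[leb]_r k r = g b - g0.
  rewrite -kE (gE b bb) [g0 + _]addrC addrK; apply: eq_Rintegral => z _.
  rewrite -(hw z) mulrA; congr (_ * _).
  rewrite /window; case: (leP z.1 b); rewrite ?andbF ?mul1r//.
  by rewrite mulr0.
rewrite intf intk => e.
have L1mul (c : R -> R) (q : R * Omega -> R) : measurable_fun [set: R] c ->
    (forall r, `|c r| <= K) -> L1 M q -> L1 M (fun z => c z.1 * q z).
  move=> mc cK L1q; rewrite (_ : (fun z => _) = (fun z : R * Omega => c z.1) * q)//.
  apply: (L1_bounded (M := K)) => //.
  by apply: (measurableT_comp mc).
have slice (c : R -> R) (q : R * Omega -> R) : measurable_fun [set: R] c ->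
    (forall r, `|c r| <= K) -> L1 M q ->
    L1 leb (fun s => c s * \int[P]_w q (s, w)) /\
    \int[M]_z (c z.1 * q z) = \int[leb]_s (c s * \int[P]_w q (s, w)).
  move=> mc cK L1q; have [L1s ->] := int_fubini1 (L1mul _ _ mc cK L1q).
  have [L1Q _] := int_fubini1 L1q.
  have L1cQ : L1 leb (c * (fun s => \int[P]_w q (s, w))) by apply: (L1_bounded (M := K)).
  split=> //; apply: ae_int_eq.
  - exact: L1_measurable L1s.
  - exact: L1_measurable L1cQ.
  by apply: aeS (L1_slice1 L1q) => s L1qs; rewrite -intZ.
have [L1Sh ShE] := slice _ _ mS SK L1h.
have [L1SH SHE] := slice _ _ mS' S'K L1H.
have i1 : \int[leb]_s (f * G) s = \int[M]_z ((window a b * S') z.1 * cut H a b z) -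
    g0 * (S b - S a).
  rewrite SHE -intf -intZ// -intB//; last exact: L1Z.
  apply: eq_Rintegral => s _; rewrite !fctE /f fctE.
  have [sab|nsab] := boolP (a < s <= b); last first.
    by rewrite /window (negbTE nsab) !mul0r mulr0 subr0.
  rewrite GE; last by case/andP: sab => /ltW -> ->.
  have -> : \int[P]_w cut H a b (s, w) = g s.
    by rewrite -HE//; apply: eq_Rintegral => w _; rewrite /cut /window/= sab mul1r.
  ring.
have i2 : \int[leb]_s (F * k) s = \int[M]_z ((window a b * S) z.1 * h z) -
    S a * (g b - g0).
  rewrite ShE -intk -intZ// -intB//; last exact: L1Z.
  apply: eq_Rintegral => s _; rewrite !fctE -/(k s).
  have [sab|nsab] := boolP (a < s <= b); last first.
    have -> : k s = 0.
      rewrite /k (@eq_Rintegral _ _ _ P _ (cst 0)) ?Rintegral_cst ?mul0r//.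
      by move=> w _; rewrite -hw /window/= (negbTE nsab) mul0r.
    by rewrite !mulr0 subr0.
  rewrite FE; last by case/andP: sab => /ltW -> ->.
  by rewrite /window sab mul1r; ring.
move: e; rewrite i1 i2; lra.
Qed.

(** Switching the weight off outside the interval makes it bounded and
    measurable on the whole line. *)
Definition wmx n (a b : R) (S : R -> 'M[R]_n) (r : R) : 'M[R]_n :=
  window a b r *: S r.

(** The density of the derivative of $E\langle S X, X\rangle$. *)
Definition energy_rate n a b (beta sigma X : process R Omega n)
    (S S' : R -> 'M[R]_n) (z : R * Omega) : R :=
  bilf (wmx a b S z.1) (vcut X a b z) (vcut beta a b z) +
  bilf (wmx a b S z.1) (vcut beta a b z) (vcut X a b z) +
  bilf (wmx a b S z.1) (vcut sigma a b z) (vcut sigma a b z) +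
  bilf (wmx a b S' z.1) (vcut X a b z) (vcut X a b z).

(** The integrated form of the derivative of $E\langle S X, X\rangle$, entry by
    entry from [product_rule] and [second_moment]. *)
Lemma product_rule_bilf n a b xi (beta sigma X : process R Omega n)
    (S S' : R -> 'M[R]_n) (K : R) : a <= b ->
  vms_process P W a b xi beta sigma X ->
  (forall i j, measurable_fun [set: R] (fun r => wmx a b S r i j)) ->
  (forall i j, measurable_fun [set: R] (fun r => wmx a b S' r i j)) ->
  (forall r i j, `|wmx a b S r i j| <= K) ->
  (forall r i j, `|wmx a b S' r i j| <= K) ->
  (forall s i j, a <= s <= b ->
    S s i j = S a i j + \int[leb]_r (window a s r * S' r i j)) ->
  L1 M (energy_rate a b beta sigma X S S') /\
  \int[P]_w bilf (S b) (X b w) (X b w) - \int[P]_w bilf (S a) (xi w) (xi w) =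
  \int[M]_z energy_rate a b beta sigma X S S' z.
Proof.
move=> ab XP mS mS' SK S'K SE.
have bb : a <= b <= b by rewrite ab lexx.
have [Lxi LXb Lb Ls LX] := vms_vL2 XP bb.
pose x i := cut (comp X i) a b; pose be i := cut (comp beta i) a b.
pose si i := cut (comp sigma i) a b.
have Lx i : L2 M (x i) by have := LX i; rewrite vcutE.
have Lbe i : L2 M (be i) by have := Lb i; rewrite vcutE.
have Lsi i : L2 M (si i) by have := Ls i; rewrite vcutE.
pose h i j := x i * be j + be i * x j + si i * si j.
pose H i j := fun (s : R) w => comp X i s w * comp X j s w.
have cutH i j : cut (H i j) a b = x i * x j.
  apply/funext => z; rewrite !fctE /x /H /cut mulrACA window_mul maxxx minxx.
  by [].
have wE (f : R -> 'M[R]_n) i j : (fun r => wmx a b f r i j) = window a b * (fun r => f r i j).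
  by apply/funext => r; rewrite /wmx mxE.
have L1h i j : L1 M (h i j).
  by apply: L1D; [apply: L1D|]; exact: L1_mul.
have hw i j z : window a b z.1 * h i j z = h i j z.
  rewrite /h /x /be /si !fctE /cut /window.
  by case: (a < z.1 <= b); rewrite ?mul1r// !mul0r !addr0.
have hs i j s : a <= s <= b -> \int[M]_z ((z.1 <= s)%R%:R * h i j z) =
    ip M (cut (comp X i) a s) (cut (comp beta j) a s) +
    ip M (cut (comp beta i) a s) (cut (comp X j) a s) +
    ip M (cut (comp sigma i) a s) (cut (comp sigma j) a s).
  move=> sab; have /andP[as_ sb] := sab.
  have L2S f : L2 M (cut f a b) -> L2 M (cut f a s) by exact: L2_cutS.
  have stop f z : (z.1 <= s)%R%:R * cut f a b z = cut f a s z.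
    rewrite /cut /window mulrA -natrM mulnb; congr (_%:R * _).
    by rewrite andbCA; case: (leP z.1 s) => zs; rewrite ?andbF//= (le_trans zs sb).
  have Lxs k : L2 M (cut (comp X k) a s) := L2S _ (Lx k).
  have Lbs k : L2 M (cut (comp beta k) a s) := L2S _ (Lbe k).
  have Lss k : L2 M (cut (comp sigma k) a s) := L2S _ (Lsi k).
  rewrite /ip -intD; [|exact: L1_mul|exact: L1_mul].
  rewrite -intD; [|by apply: L1D; exact: L1_mul|exact: L1_mul].
  apply: eq_Rintegral => z _; rewrite !fctE -!stop /h !fctE /x /be /si.
  by case: (z.1 <= s); rewrite ?mul1r// !mul0r !addr0.
have Lmul (c : R -> R) (q : R * Omega -> R) : measurable_fun [set: R] c ->
    (forall r, `|c r| <= K) -> L1 M q -> L1 M (fun z => c z.1 * q z).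
  move=> mc cK L1q; rewrite (_ : (fun z => _) = (fun z : R * Omega => c z.1) * q)//.
  apply: (L1_bounded (M := K)) => //.
  by apply: (measurableT_comp mc).
pose T1 i j (z : R * Omega) := wmx a b S z.1 i j * h i j z.
pose T2 i j (z : R * Omega) := wmx a b S' z.1 i j * (x i * x j) z.
have L1T1 i j : L1 M (T1 i j).
  by apply: (Lmul (fun r => wmx a b S r i j)) => // r; exact: SK.
have L1T2 i j : L1 M (T2 i j).
  by apply: (Lmul (fun r => wmx a b S' r i j)) => //; exact: L1_mul.
have L1T i j : L1 M (T1 i j + T2 i j) by exact: L1D.
have sumE : energy_rate a b beta sigma X S S' = \sum_i \sum_j (T1 i j + T2 i j).
  have vE f i z : vcut f a b z i 0 = cut (comp f i) a b z by rewrite -vcutE.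
  apply/funext => z; rewrite /energy_rate !bilfE -!big_split/= fct_sumE.
  apply: eq_bigr => i _; rewrite -!big_split/= fct_sumE; apply: eq_bigr => j _.
  by rewrite !fctE /T1 /T2 /h !fctE /x /be /si !vE; ring.
rewrite sumE; split.
  by apply: L1_sum => i; apply: L1_sum => j; exact: L1T.
rewrite int_sum; last by move=> i; apply: L1_sum => j; exact: L1T.
rewrite !int_bilf// -sumrB; apply: eq_bigr => i _.
rewrite int_sum; last by move=> j; exact: L1T.
rewrite -sumrB; apply: eq_bigr => j _.
rewrite intD//.
pose g s := ip P (comp X i s) (comp X j s).
have := @product_rule (fun r => S r i j) (fun r => S' r i j) K a b
  (ip P (fun w => xi w i 0) (fun w => xi w j 0)) g (h i j) (H i j) ab.
rewrite -!wE => ->//.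
- rewrite cutH; congr (_ + _).
- move=> s sab; exact: SE.
- move=> s sab; rewrite /g (second_moment P_complete W_brownian sab (XP i) (XP j)).
  by rewrite hs.
- by rewrite cutH; exact: L1_mul.
Qed.

End linear_equation.

(** * Algebra of the Riccati equation *)

Section riccati_algebra.
Context {R : realType} {n m : nat}.
Implicit Types (A C S Q : 'M[R]_n) (B D : 'M[R]_(n, m)) (N : 'M[R]_m)
  (Psi : 'M[R]_(m, n)).

(** The coefficient of the linear term when the cost is written in the variable
    $u - \Psi x$. *)
Definition gap B C D N Psi S : 'M[R]_(m, n) :=
  B^T *m S + D^T *m S *m (C + D *m Psi) + N *m Psi.

(** Adding the running cost to the derivative of $\langle S X, X\rangle$ and
    using the equation of $S$ removes every term in $x$ alone: what remains is
    quadratic in $v = u - \Psi x$, plus a cross term with coefficient [gap]. *)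
Lemma riccati_square A C S S' Q B D N Psi (x : 'cV[R]_n) (u : 'cV[R]_m) :
  S^T = S -> N^T = N ->
  S' + S *m (A + B *m Psi) + (A + B *m Psi)^T *m S
    + (C + D *m Psi)^T *m S *m (C + D *m Psi) + Q + Psi^T *m N *m Psi = 0 ->
  bilf S x (A *m x + B *m u) + bilf S (A *m x + B *m u) x +
    bilf S (C *m x + D *m u) (C *m x + D *m u) + bilf S' x x +
    bilf Q x x + bilf N u u =
  2 * bilf (gap B C D N Psi S) (u - Psi *m x) x +
  bilf (N + D^T *m S *m D) (u - Psi *m x) (u - Psi *m x).
Proof.
move=> Ssym Nsym eqS.
set v := u - Psi *m x.
have uE : u = Psi *m x + v by rewrite /v addrC subrK.
move: v uE => v ->.
have -> : A *m x + B *m (Psi *m x + v) = (A + B *m Psi) *m x + B *m v.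
  by rewrite mulmxDr mulmxDl mulmxA addrA.
have -> : C *m x + D *m (Psi *m x + v) = (C + D *m Psi) *m x + D *m v.
  by rewrite mulmxDr mulmxDl mulmxA addrA.
rewrite /gap; move: (A + B *m Psi) (C + D *m Psi) eqS => Ah Ch eqS.
have eqx : bilf S' x x + bilf (S *m Ah) x x + bilf (Ah^T *m S) x x
    + bilf (Ch^T *m S *m Ch) x x + bilf Q x x + bilf (Psi^T *m N *m Psi) x x = 0.
  by rewrite -!bilf_D eqS /bilf mulmx0 mul0mx mxE.
have t1 : bilf (S *m B) x v = bilf (B^T *m S) v x.
  by rewrite bilf_tr trmx_mul Ssym.
have t2 : bilf (Ch^T *m S *m D) x v = bilf (D^T *m S *m Ch) v x.
  by rewrite bilf_tr !trmx_mul trmxK Ssym mulmxA.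
have t3 : bilf (Psi^T *m N) x v = bilf (N *m Psi) v x.
  by rewrite bilf_tr trmx_mul trmxK Nsym.
rewrite !(bilf_D, bilfDl, bilfDr, bilf_mulr, bilf_mull, mulmxA) t1 t2 t3.
move: eqx; lra.
Qed.

(** A vector of the kernel would have zero quadratic form. *)
Lemma pdmx_unit N : pdmx N -> N \in unitmx.
Proof.
move=> [_ Npos]; rewrite -row_free_unit -kermx_eq0.
apply: contraT => k0; pose v := nz_row (kermx N).
have v0 : v^T != 0.
  by apply: contra_neq k0 => /(congr1 trmx); rewrite trmxK trmx0 => /eqP; rewrite nz_row_eq0 => /eqP.
have vN : v *m N = 0 by apply/sub_kermxP; exact: nz_row_sub.
by have := Npos _ v0; rewrite trmxK vN mul0mx mxE ltxx.
Qed.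

Lemma pdmxD_psd N N' : pdmx N -> psdmx N' -> pdmx (N + N').
Proof.
move=> [Nsym Npos] [Ssym Spos]; split; first by rewrite linearD/= Nsym Ssym.
move=> x x0; rewrite -[X in 0 < X]/(bilf (N + N') x x) bilf_D.
by apply: ltr_wpDr; [exact: Spos|exact: Npos].
Qed.

Lemma psdmx_congr S D : psdmx S -> psdmx (D^T *m S *m D).
Proof.
move=> [Ssym Spos]; split; first by rewrite !trmx_mul trmxK Ssym mulmxA.
move=> x; rewrite -[X in 0 <= X]/(bilf (D^T *m S *m D) x x).
by rewrite -bilf_mulr -bilf_mull; exact: Spos.
Qed.

(** The gain is built to annihilate the linear term at time 0: the feedback
    minimizes the expression in $v$ at the instant when the decision is taken. At
    later times the gap need not vanish, which is why the strategy is an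
    equilibrium rather than an optimum. *)
Lemma gap_gain B C D N S : pdmx N -> psdmx S ->
  gap B C D N (riccati_gain B C D N S) S = 0.
Proof.
move=> Npd Spsd; have Mu : N + D^T *m S *m D \in unitmx.
  by apply: pdmx_unit; apply: pdmxD_psd => //; exact: psdmx_congr.
rewrite /gap; set Psi := riccati_gain _ _ _ _ _.
have -> : B^T *m S + D^T *m S *m (C + D *m Psi) + N *m Psi =
    (B^T *m S + D^T *m S *m C) + (N + D^T *m S *m D) *m Psi.
  by rewrite mulmxDr mulmxDl -!addrA !mulmxA [N *m Psi + _]addrC.
rewrite /Psi /riccati_gain.
by rewrite mulmxN mulmxA mulmxV// mul1mx subrr.
Qed.

(** Completing the square in $v$ with respect to $N$ alone, the term with
    $D^T S D$ being nonnegative. *)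
Lemma square_lower_bound B C D N Psi S (x : 'cV[R]_n) (v : 'cV[R]_m) :
  pdmx N -> psdmx S ->
  - bilf ((gap B C D N Psi S)^T *m invmx N *m gap B C D N Psi S) x x <=
  2 * bilf (gap B C D N Psi S) v x + bilf (N + D^T *m S *m D) v v.
Proof.
move=> Npd Spsd; have Nu := pdmx_unit Npd; have [Nsym Npos] := Npd.
have [_ Dpos] := psdmx_congr D Spsd.
move: (gap _ _ _ _ _ _) => G; rewrite bilf_D.
have vv : 0 <= bilf (D^T *m S *m D) v v by exact: Dpos.
pose y := v + invmx N *m (G *m x).
have yy : 0 <= bilf N y y.
  have [->|y0] := eqVneq y 0; last exact/ltW/Npos.
  by rewrite /bilf mulmx0 mxE.
move: yy; rewrite /y bilfDl !bilfDr !bilf_mulr !bilf_mull.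
rewrite (mulmxV Nu) mul1mx.
have invsym : (invmx N)^T = invmx N by rewrite trmx_inv Nsym.
rewrite invsym !mulmxA -(mulmxA G^T) (mulVmx Nu) mulmx1.
have t : bilf G^T x v = bilf G v x by rewrite bilf_tr trmxK.
rewrite t; lra.
Qed.

End riccati_algebra.

Section cost_identity.
Context {R : realType} {d : measure_display} {Omega : measurableType d}.
Variable P : probability Omega R.
Hypothesis P_complete : measure_is_complete P.
Variable W : R -> Omega -> R.
Hypothesis W_brownian : brownian_motion P W.
Local Notation leb := (@lebesgue_measure R).
Local Notation M := (leb \x P)%E.

(** A solution of the Riccati equation with a prescribed gain, in the integrated
    form in which it is used. *)
Record riccati_weight n m (a b : R) (A C Q : 'M[R]_n) (B D : 'M[R]_(n, m))
    (N : 'M[R]_m) (Psi : 'M[R]_(m, n)) (S S' : R -> 'M[R]_n) : Prop := {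
  rw_meas : forall i j, measurable_fun [set: R] (fun r => wmx a b S r i j) ;
  rw_meas' : forall i j, measurable_fun [set: R] (fun r => wmx a b S' r i j) ;
  rw_bounded : exists K : R, forall r i j,
    `|wmx a b S r i j| <= K /\ `|wmx a b S' r i j| <= K ;
  rw_int : forall s i j, a <= s <= b ->
    S s i j = S a i j + \int[leb]_r (window a s r * S' r i j) ;
  rw_end : S b = 0 ;
  rw_sym : forall r, a <= r <= b -> (S r)^T = S r ;
  rw_eq : forall r, a <= r <= b ->
    S' r + S r *m (A + B *m Psi) + (A + B *m Psi)^T *m S r
    + (C + D *m Psi)^T *m S r *m (C + D *m Psi) + Q + Psi^T *m N *m Psi = 0 }.

Lemma vcut0 n (phi : process R Omega n) a b z : ~~ (a < z.1 <= b) ->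
  vcut phi a b z = 0.
Proof. by move=> h; rewrite /vcut /window (negbTE h) scale0r. Qed.

Lemma bilf0l n m (G : 'M[R]_(n, m)) y : bilf G 0 y = 0.
Proof. by rewrite -(scale0r 0) bilfZl mul0r. Qed.

(** Integrate [riccati_square] over time and outcomes: by [product_rule_bilf] the
    derivative of $\langle S X, X\rangle$ contributes its boundary values, and the
    one at [b] is 0. *)
Lemma cost_identity n m a b (A C Q : 'M[R]_n) (B D : 'M[R]_(n, m)) (N : 'M[R]_m)
    (Psi : 'M[R]_(m, n)) (S S' : R -> 'M[R]_n) xi
    (U : process R Omega m) (X : process R Omega n) : a <= b -> N^T = N ->
  riccati_weight a b A C Q B D N Psi S S' ->
  vms_process P W a b xi (fun s w => A *m X s w + B *m U s w)
    (fun s w => C *m X s w + D *m U s w) X ->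
  vL2 M (vcut U a b) ->
  let v z := vcut U a b z - Psi *m vcut X a b z in
  let F z := 2 * bilf (gap B C D N Psi (S z.1)) (v z) (vcut X a b z) +
    bilf (N + D^T *m S z.1 *m D) (v z) (v z) in
  L1 M F /\
  \int[M]_z (bilf Q (vcut X a b z) (vcut X a b z) +
    bilf N (vcut U a b z) (vcut U a b z)) =
  \int[P]_w bilf (S a) (xi w) (xi w) + \int[M]_z F z.
Proof.
move=> ab Nsym [mS mS' [K SK] SE Sb Ssym Seq] XP LU v F.
have bb : a <= b <= b by rewrite ab lexx.
have [Lxi LXb Lb Ls LX] := vms_vL2 XP bb.
have [L1E EE] := product_rule_bilf P_complete W_brownian ab XP mS mS'
  (fun r i j => (SK r i j).1) (fun r i j => (SK r i j).2) SE.
have L1q : L1 M (fun z => bilf Q (vcut X a b z) (vcut X a b z) +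
    bilf N (vcut U a b z) (vcut U a b z)).
  by apply: L1D; exact: L1_bilf.
have FE : F = energy_rate a b (fun s w => A *m X s w + B *m U s w)
      (fun s w => C *m X s w + D *m U s w) X S S' +
    (fun z => bilf Q (vcut X a b z) (vcut X a b z) +
    bilf N (vcut U a b z) (vcut U a b z)).
  apply/funext => z; rewrite !fctE /F /v /energy_rate !vcutD !vcut_mulmx.
  have [zab|nz] := boolP (a < z.1 <= b); last first.
    by rewrite !vcut0// !mulmx0 subrr addr0 !bilf0l mulr0 !addr0.
  have zab' : a <= z.1 <= b by case/andP: zab => /ltW -> ->.
  rewrite /wmx /window zab !scale1r.
  by rewrite -(riccati_square _ _ (Ssym _ zab') Nsym (Seq _ zab')) addrA.
have L1F : L1 M F by rewrite FE; exact: L1D.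
split=> //.
rewrite [in RHS]FE [X in _ = _ + X](intD L1E L1q) -EE Sb.
have -> : \int[P]_w bilf 0 (X b w) (X b w) = 0.
  rewrite (@eq_Rintegral _ _ _ P _ (cst 0)) ?Rintegral_cst ?mul0r//.
  by move=> w _; rewrite /bilf mulmx0 mul0mx mxE.
by rewrite sub0r addrA subrr add0r.
Qed.

End cost_identity.

(** * Regularity of the solution of the Riccati equation *)

Section regularity.
Context {R : realType}.
Local Notation leb := (@lebesgue_measure R).

Definition mcont n m (a b : R) (F : R -> 'M[R]_(n, m)) :=
  forall i j, {within `[a, b], continuous (fun r => F r i j)}.

Lemma mcont_cst n m a b (A : 'M[R]_(n, m)) : mcont a b (fun=> A).
Proof. by move=> i j x; exact: cvg_cst. Qed.

Lemma mcontD n m a b (F G : R -> 'M[R]_(n, m)) :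
  mcont a b F -> mcont a b G -> mcont a b (fun r => F r + G r).
Proof.
move=> cF cG i j; rewrite (_ : (fun _ => _) = (fun r => F r i j) + (fun r => G r i j)).
  by move=> x; apply: cvgD; [exact: cF|exact: cG].
by apply/funext => r; rewrite mxE.
Qed.

Lemma within_continuous_sum (I : Type) (s : seq I) (f : I -> R -> R) a b :
  (forall i, {within `[a, b], continuous (f i)}) ->
  {within `[a, b], continuous (fun r => \sum_(i <- s) f i r)}.
Proof.
move=> cf; elim: s => [|i s IH].
  rewrite (_ : (fun _ => _) = cst 0); first by move=> x; exact: cvg_cst.
  by apply/funext => r; rewrite big_nil.
rewrite (_ : (fun _ => _) = f i + (fun r => \sum_(j <- s) f j r)).
  by move=> x; apply: cvgD; [exact: cf|exact: IH].
by apply/funext => r; rewrite big_cons.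
Qed.

Lemma mcont_mull n m p a b (A : 'M[R]_(p, n)) (F : R -> 'M[R]_(n, m)) :
  mcont a b F -> mcont a b (fun r => A *m F r).
Proof.
move=> cF i j; rewrite (_ : (fun _ => _) = (fun r => \sum_k A i k * F r k j)).
  by apply: within_continuous_sum => k x; apply: cvgM; [exact: cvg_cst|exact: cF].
by apply/funext => r; rewrite mxE.
Qed.

Lemma mcont_mulr n m p a b (A : 'M[R]_(m, p)) (F : R -> 'M[R]_(n, m)) :
  mcont a b F -> mcont a b (fun r => F r *m A).
Proof.
move=> cF i j; rewrite (_ : (fun _ => _) = (fun r => \sum_k F r i k * A k j)).
  by apply: within_continuous_sum => k x; apply: cvgM; [exact: cF|exact: cvg_cst].
by apply/funext => r; rewrite mxE.
Qed.

Lemma mcontN n m a b (F : R -> 'M[R]_(n, m)) :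
  mcont a b F -> mcont a b (fun r => - F r).
Proof.
move=> cF i j; rewrite (_ : (fun _ => _) = - (fun r => F r i j)).
  by move=> x; apply: cvgN; exact: cF.
by apply/funext => r; rewrite mxE.
Qed.

Lemma within_continuous_shift (f : R -> R) (t T : R) :
  {within `[0, T], continuous f} ->
  {within `[t, t + T], continuous (fun r => f (r - t))}.
Proof.
move=> /subspace_continuousP cf; apply/subspace_continuousP => x xI.
have xI' : `[0, T]%classic (x - t).
  by move: xI; rewrite /= !in_itv/= subr_ge0 lerBlDl.
apply: cvg_trans (cf _ xI') => U /= fU.
have cont : (fun r : R => r - t) @ x --> x - t by apply: cvgB; [exact: cvg_id|exact: cvg_cst].
have {}fU : nbhs (x - t) [set y | `[0, T]%classic y -> U (f y)] by exact: fU.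
have := cont _ fU; rewrite /= => hU.
suff : nbhs x [set r | `[t, t + T]%classic r -> U (f (r - t))] by [].
apply: (@filterS R (nbhs (x : R)) _ _ _ _ hU) => r /= h rI.
by apply: h; move: rI; rewrite !in_itv/= subr_ge0 lerBlDl.
Qed.

Lemma within_continuous_window (f : R -> R) a b : a <= b ->
  {within `[a, b], continuous f} ->
  measurable_fun [set: R] (fun r => window a b r * f r) /\
  exists K, forall r, `|window a b r * f r| <= K.
Proof.
move=> ab cf; split.
  have e : (fun r => window a b r * f r) = f \_ `]a, b]%classic.
    apply/funext => r; rewrite patchE windowE indicE.
    by case: (_ \in _); rewrite ?mul1r ?mul0r.
  rewrite e; apply/(measurable_restrictT _ _).1 => //.
  have mf : measurable_fun `[a, b]%classic f by exact: subspace_continuous_measurable_fun.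
  by apply: measurable_funS mf => // x /=; rewrite !in_itv/= => /andP[/ltW -> ->].
have cn : {within `[a, b], continuous (fun r => `|f r|)}.
  by move=> x; apply: cvg_norm; exact: cf.
have [c _ hc] := EVT_max ab cn.
exists `|f c| => r; rewrite normrM /window.
have [/andP[ar rb]|_] := boolP (a < r <= b); last by rewrite normr0 mul0r.
by rewrite normr1 mul1r; apply: hc; rewrite in_itv/= (ltW ar).
Qed.

Lemma window_integral_derivative (f f' : R -> R) (a b : R) :
  {within `[a, b], continuous f} -> {within `[a, b], continuous f'} ->
  (forall x, a < x < b -> is_derive x (1 : R) f (f' x)) ->
  forall s, a <= s <= b -> f s = f a + \int[leb]_r (window a s r * f' r).
Proof.
move=> cf cf' df s /andP[]; rewrite le_eqVlt => /predU1P[<- _|as_ sb].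
  rewrite (@eq_Rintegral _ _ _ leb _ (cst 0)) ?Rintegral_cst ?mul0r ?addr0//.
  by move=> r _; rewrite window_nil mul0r.
have sub : `[a, s]%classic `<=` `[a, b]%classic.
  by move=> x /=; rewrite !in_itv/= => /andP[-> xs]; exact: le_trans xs sb.
have cf1 := continuous_subspaceW sub cf; have cf1' := continuous_subspaceW sub cf'.
have [mf' _] := within_continuous_window (ltW as_) cf1'.
rewrite -(cst_int_window mf').
have dab x : x \in `]a, s[ -> a < x < b.
  by rewrite in_itv/= => /andP[-> xs]; exact: lt_le_trans xs sb.
rewrite /Rintegral (continuous_FTC2 as_ cf1' (F := f)).
- by rewrite -EFinD/= subrKC.
- move/(continuous_within_itvP _ as_) : cf1 => [_ fa fs]; split=> //.
  by move=> x /dab/df[].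
- by move=> x /dab/df; rewrite derive1E => -[].
Qed.

End regularity.

Section riccati_regularity.
Context {R : realType}.
Variables (n m : nat) (T : R).
Hypothesis T_gt0 : 0 < T.
Variables (A C Q : 'M[R]_n) (B D : 'M[R]_(n, m)) (N : 'M[R]_m).
Variable Sigma : R -> 'M[R]_n.
Hypothesis Sigma_sol : delayed_riccati_solution T A B C D Q N Sigma.
Let Psi := riccati_gain B C D N (Sigma 0).

Definition riccati_rhs (S : 'M[R]_n) : 'M[R]_n :=
  - (S *m (A + B *m Psi) + (A + B *m Psi)^T *m S
    + (C + D *m Psi)^T *m S *m (C + D *m Psi) + Q + Psi^T *m N *m Psi).

(** At interior times the derivative relative to $[0, T]$ is the ordinary one. *)
Lemma riccati_derivative t x i j : t < x < t + T ->
  is_derive x (1 : R) (fun r => Sigma (r - t) i j) (riccati_rhs (Sigma (x - t)) i j).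
Proof.
move=> /andP[tx xtT]; have [_ _ dS _] := Sigma_sol.
have x0 : 0 < x - t by rewrite subr_gt0.
have xT : x - t < T by rewrite ltrBlDl.
have /dS[dSigma dE eqS] : 0 <= x - t <= T by rewrite !ltW.
have -> : riccati_rhs (Sigma (x - t)) i j = dSigma i j.
  congr (fun_of_matrix _ i j); apply/eqP; rewrite eq_sym /riccati_rhs.
  by rewrite -addr_eq0 !addrA; exact/eqP.
set s0 := x - t; pose q (r : R) := (r - s0)^-1 * (Sigma r i j - Sigma s0 i j).
pose p (h : R) := h^-1 *: (((fun r => Sigma (r - t) i j) \o shift x) (h *: 1) - Sigma s0 i j).
have pq h : p h = q (h + s0).
  by rewrite /p /q addrK /= /GRing.scale /= mulr1 /s0 addrA.
suff lim : p @ 0^' --> dSigma i j.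
  by split; [exact: cvgP lim|exact: cvg_lim].
move=> U dU; have {}dU : nbhs s0 [set y | (`[0, T]%classic `\ s0) y -> U (q y)].
  exact: dE dU.
have cont : (fun h : R => h + s0) @ (0 : R) --> s0.
  rewrite -[X in _ --> X]add0r; apply: cvgD; [exact: cvg_id|exact: cvg_cst].
have inside : nbhs s0 [set y | y \in `]0, T[].
  by apply: near_in_itvoo; rewrite in_itv/= x0.
have hU := cont _ dU; have hI := cont _ inside.
suff : nbhs (0 : R) [set h | h != 0 -> U (p h)] by [].
apply: (@filterS2 R (nbhs (0 : R)) _ _ _ _ _ hU hI) => h /= Uh hin h0.
rewrite pq; apply: Uh; split.
  by move: hin; rewrite !in_itv/= => /andP[/ltW -> /ltW ->].
by move=> /= /eqP; rewrite -subr_eq0 addrK; exact/negP.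
Qed.

(** Being determined by the Riccati equation, the derivative of $\Sigma$ is
    continuous, so that $\Sigma$ is the integral of its derivative. *)
Lemma riccati_weight_shift t : N^T = N ->
  riccati_weight t (t + T) A C Q B D N Psi (fun r => Sigma (r - t))
    (fun r => riccati_rhs (Sigma (r - t))).
Proof.
move=> Nsym; have [cS pS dS ST] := Sigma_sol.
have ttT : t <= t + T by rewrite lerDl ltW.
have cS1 : mcont t (t + T) (fun r => Sigma (r - t)).
  by move=> i j; apply: (within_continuous_shift (f := fun r => Sigma r i j)); exact: cS.
have cS2 : mcont t (t + T) (fun r => riccati_rhs (Sigma (r - t))).
  apply: mcontN; do 2 (apply: mcontD; last exact: mcont_cst).
  apply: mcontD; [apply: mcontD|].
  - exact: mcont_mulr.
  - exact: mcont_mull.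
  - by apply: mcont_mulr; exact: mcont_mull.
have wE (F : R -> 'M[R]_n) i j : (fun r => wmx t (t + T) F r i j) =
    (fun r => window t (t + T) r * F r i j).
  by apply/funext => r; rewrite /wmx mxE.
have bound (F : R -> 'M[R]_n) : mcont t (t + T) F ->
    exists K, forall r i j, `|wmx t (t + T) F r i j| <= K.
  move=> cF; have h (p : 'I_n * 'I_n) : exists K, forall r, `|wmx t (t + T) F r p.1 p.2| <= K.
    have [_ [K hK]] := within_continuous_window ttT (cF p.1 p.2).
    by exists K => r; have := congr1 (fun f => f r) (wE F p.1 p.2) => /= ->.
  have [K hK] := choice h; exists (\sum_p `|K p|) => r i j.
  rewrite (bigD1 (i, j))//= (le_trans (hK (i, j) r))// (le_trans (ler_norm _))//.
  by rewrite lerDl sumr_ge0.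
split.
- by move=> i j; rewrite wE; exact: (within_continuous_window ttT (cS1 i j)).1.
- by move=> i j; rewrite wE; exact: (within_continuous_window ttT (cS2 i j)).1.
- have [K1 h1] := bound _ cS1; have [K2 h2] := bound _ cS2.
  exists (Num.max K1 K2) => r i j; split; rewrite le_max.
    by rewrite h1.
  by rewrite h2 orbT.
- move=> s i j; apply: (window_integral_derivative (f := fun r => Sigma (r - t) i j)
    (f' := fun r => riccati_rhs (Sigma (r - t)) i j)).
  + exact: cS1.
  + exact: cS2.
  + by move=> x; exact: riccati_derivative.
- by rewrite addrAC subrr add0r.
- by move=> r /andP[tr rT]; have [] := pS (r - t); rewrite // subr_ge0 tr lerBlDl.
- by move=> r _; rewrite /riccati_rhs -!addrA addNr.
Qed.

(** The gap is continuous in time and vanishes at the initial time by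
    [gap_gain]. *)
Lemma gap_cvg0 t (e : R) : 0 < e -> pdmx N ->
  exists2 dlt : R, 0 < dlt & forall r, t <= r -> r < t + dlt -> r <= t + T ->
    forall i j, `|gap B C D N Psi (Sigma (r - t)) i j| <= e.
Proof.
move=> e0 Npd; have [cS pS _ _] := Sigma_sol.
have cG : mcont 0 T (fun s => gap B C D N Psi (Sigma s)).
  apply: mcontD; last exact: mcont_cst.
  apply: mcontD; first exact: mcont_mull.
  by apply: mcont_mulr; exact: mcont_mull.
have G0 : gap B C D N Psi (Sigma 0) = 0.
  by apply: gap_gain => //; apply: pS; rewrite lexx ltW.
have h (p : 'I_m * 'I_n) : exists dlt : R, 0 < dlt /\
    forall s, 0 <= s -> s < dlt -> s <= T ->
    `|gap B C D N Psi (Sigma s) p.1 p.2| <= e.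
  have := cG p.1 p.2; move/(continuous_within_itvP _ T_gt0) => [_ + _].
  rewrite G0 mxE => /cvgrPdist_le/(_ _ e0)[dlt /= dlt0 hd].
  exists dlt; split=> // s; rewrite le_eqVlt => /predU1P[<- _ _|s0 sd _].
    by rewrite G0 mxE normr0 ltW.
  have := hd s; rewrite /= !sub0r !normrN; apply=> //.
  by rewrite gtr0_norm.
have [dl hdl] := choice h.
exists (\big[Order.min/1]_p dl p).
  apply: (big_ind (fun x : R => 0 < x)) => [|u v u0 v0|p _].
  - exact: ltr01.
  - by rewrite lt_min u0.
  - exact: (hdl p).1.
move=> r tr rd rT i j; apply: (hdl (i, j)).2; rewrite ?subr_ge0// ?lerBlDl//.
rewrite ltrBlDl (lt_le_trans rd)// lerD2l.
by apply: bigmin_le_cond.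
Qed.

End riccati_regularity.

(** * The cost as an integral over the product space *)

(** Integrals of nonnegative functions are suprema over simple functions, hence
    monotone even when the functions are not measurable. *)
Lemma le_integral_nonneg d (T : measurableType d) (R : realType)
    (mu : {measure set T -> \bar R}) (f g : T -> \bar R) :
  (forall x, 0 <= f x)%E -> (forall x, f x <= g x)%E ->
  (\int[mu]_x f x <= \int[mu]_x g x)%E.
Proof.
move=> f0 fg; have g0 x : (0 <= g x)%E by apply: le_trans (fg x).
rewrite !ge0_integralTE//; apply: le_ereal_sup => _ [h hf <-].
by exists h => // x; exact: le_trans (hf x) (fg x).
Qed.

Section cost_integral.
Context {R : realType} {d : measure_display} {Omega : measurableType d}.
Variable P : probability Omega R.
Hypothesis P_complete : measure_is_complete P.
Variable W : R -> Omega -> R.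
Hypothesis W_brownian : brownian_motion P W.
Local Notation leb := (@lebesgue_measure R).
Local Notation M := (leb \x P)%E.

(** Tonelli's theorem; the closed interval of the cost and the half-open
    interval of [cut] differ by a point. *)
Lemma int_cut a b (g : R -> Omega -> R) : (forall s w, 0 <= g s w) ->
  L1 M (cut g a b) ->
  (\int[P]_w \int[leb]_(s in `[a, b]) (g s w)%:E = (\int[M]_z cut g a b z)%:E)%E.
Proof.
move=> g0 L1g; have mg := L1_measurable L1g.
have c0 z : 0 <= cut g a b z by rewrite /cut mulr_ge0// /window.
have eS w : (\int[leb]_(s in `[a, b]) (g s w)%:E = \int[leb]_s (cut g a b (s, w))%:E)%E.
  have mw : measurable_fun [set: R] (fun s => cut g a b (s, w)).
    by apply: (measurableT_comp mg); exact: pair2_measurable.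
  have e : {in `]a, b]%classic : set R, (fun s => g s w) =1 (fun s => cut g a b (s, w))}.
    by move=> s; rewrite inE/= in_itv/= => sab; rewrite /cut /window/= sab mul1r.
  rewrite -integral_itv_obnd_cbnd; last first.
    apply/measurable_EFinP.
    by apply: (eq_measurable_fun (fun s => cut g a b (s, w))) => [s /e ->//|]; exact: measurable_funTS.
  rewrite integral_mkcond; apply: eq_integral => s _; rewrite patchE.
  case: ifPn => [/e ->//|]; rewrite notin_setE/= in_itv/= => /negP/negbTE nsab.
  by rewrite /cut /window/= nsab mul0r.
rewrite -int_EFin//.
rewrite [RHS](_ : _ = (\int[P]_w \int[leb]_s (cut g a b (s, w))%:E)%E).
  by apply: eq_integral => w _; exact: eS.
apply: fubini_tonelli2 => [|z]; last by rewrite lee_fin.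
exact/measurable_EFinP.
Qed.

Lemma bilf_vcut n (G : 'M[R]_n) (phi : process R Omega n) s t z :
  bilf G (vcut phi s t z) (vcut phi s t z) =
  cut (fun r w => bilf G (phi r w) (phi r w)) s t z.
Proof.
rewrite /vcut bilfZl bilfZr mulrA /cut /window.
by case: (_ < _ <= _); rewrite ?mul1r ?mul0r.
Qed.

Lemma cost_integral n m a b (Q : 'M[R]_n) (N : 'M[R]_m) (X : process R Omega n)
    (U : process R Omega m) : psdmx Q -> psdmx N ->
  vL2 M (vcut X a b) -> vL2 M (vcut U a b) ->
  (\int[P]_w \int[leb]_(s in `[a, b])
     (((X s w)^T *m Q *m X s w) 0 0 + ((U s w)^T *m N *m U s w) 0 0)%:E =
  (\int[M]_z (bilf Q (vcut X a b z) (vcut X a b z) +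
     bilf N (vcut U a b z) (vcut U a b z)))%:E)%E.
Proof.
move=> [_ Q0] [_ N0] LX LU.
pose g s w : R := bilf Q (X s w) (X s w) + bilf N (U s w) (U s w).
have gE : cut g a b = (fun z => bilf Q (vcut X a b z) (vcut X a b z) +
    bilf N (vcut U a b z) (vcut U a b z)).
  by apply/funext => z; rewrite !bilf_vcut /cut mulrDr.
have g0 s w : 0 <= g s w by apply: addr_ge0; [exact: Q0|exact: N0].
rewrite -gE -int_cut// gE.
by apply: L1D; exact: L1_bilf.
Qed.

Lemma pdmx_psdmx n (N : 'M[R]_n) : pdmx N -> psdmx N.
Proof.
move=> [Ns N0]; split=> // x; have [->|x0] := eqVneq x 0; last exact/ltW/N0.
by rewrite mulmx0 mxE.
Qed.

(** The inner integral is not known to be measurable in the outcome before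
    admissibility on the bounded interval is established, hence the use of
    [le_integral_nonneg]. *)
Lemma L2F_restrict n (t b : R) (u : process R Omega n) : t <= b ->
  L2F P W `[t, +oo[ u -> L2F P W `[t, b] u.
Proof.
move=> tb [pu iu]; split.
  move=> s /=; rewrite in_itv/= => /andP[ts sb] i.
  have ss : `[t, +oo[%classic s by rewrite /= in_itv/= ts.
  have := pu s ss i.
  rewrite (_ : `[t, +oo[%classic `&` `]-oo, s]%classic =
     `[t, b]%classic `&` `]-oo, s]%classic)//.
  apply/seteqP; split=> r /=; rewrite !in_itv/= ?andbT.
    by move=> [-> rs]; split=> //=; exact: le_trans sb.
  by move=> [/andP[-> _] rs].
apply: le_lt_trans iu; apply: le_integral_nonneg => w.
  by apply: integral_ge0 => s _; rewrite lee_fin sqnorm_ge0.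
rewrite integral_mkcond [leRHS]integral_mkcond; apply: le_integral_nonneg => s.
  by rewrite patchE; case: ifP => _; rewrite ?lee_fin ?sqnorm_ge0.
rewrite !patchE !mem_setE !in_itv/= andbT.
case: (t <= s) => //=; case: (s <= b) => //=.
by rewrite lee_fin sqnorm_ge0.
Qed.

(** The drift of the state equation is admissible because the state and the
    control are. *)
Lemma state_vms n m (t b : R) (A C : 'M[R]_n) (B D : 'M[R]_(n, m))
    (xi : Omega -> 'cV[R]_n) (U : process R Omega m) (X : process R Omega n) :
  0 <= t -> (forall i, adapted_at P W t (fun w => xi w i 0)) -> vL2 P xi ->
  vadmissible P W t b U ->
  ito_process P W t b xi (fun s w => A *m X s w + B *m U s w)
    (fun s w => C *m X s w + D *m U s w) X ->
  vms_process P W t b xi (fun s w => A *m X s w + B *m U s w)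
    (fun s w => C *m X s w + D *m U s w) X.
Proof.
move=> t0 axi Lxi aU XP i.
apply: (ito_process_comp P_complete W_brownian t0 (axi i) (Lxi i) _ XP).
apply: admissible_addmx; apply: admissible_mulmx => // j.
by have [LX _ _] := XP; exact: (L2F_admissible P_complete W_brownian).
Qed.

Lemma null_time (c : R) : {ae M, forall z, z.1 <> c}.
Proof.
exists ([set c] `*` setT); split.
- by apply: measurableX => //; exact: measurable_set1.
- rewrite [LHS](_ : _ = (leb [set c] * P setT)%E).
    by rewrite lebesgue_measure_set1 mul0e.
  by apply: product_measure1E => //; exact: measurable_set1.
- by move=> z /= /contrapT zc.
Qed.

End cost_integral.

Section mean_square_equality.
Context {d : measure_display} {T : measurableType d} {R : realType}.
Variable mu : {measure set T -> \bar R}.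

(** By bilinearity, the difference is a sum of scalar products with [x - y]. *)
Lemma int_bilf_eq n (G : 'M[R]_n) (x y : T -> 'cV[R]_n) :
  vL2 mu x -> vL2 mu y -> \int[mu]_z sqnorm (x z - y z) = 0 ->
  \int[mu]_z bilf G (x z) (x z) = \int[mu]_z bilf G (y z) (y z).
Proof.
move=> Lx Ly xy0; have Lxy := vL2B Lx Ly.
have ip0 i g : L2 mu g -> ip mu (fun z => (x z - y z) i 0) g = 0.
  move=> Lg; apply: ip_eq0 Lg _; first exact: Lxy.
  apply/eqP; rewrite eq_le ip_ge0 andbT -xy0.
  exact: ip_le_sqnorm.
have e1 : \int[mu]_z bilf G (x z - y z) (x z) = 0.
  by rewrite int_bilf// big1// => i _; rewrite big1// => j _; rewrite ip0 ?mulr0.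
have e2 : \int[mu]_z bilf G (y z) (x z - y z) = 0.
  by rewrite int_bilf// big1// => i _; rewrite big1// => j _; rewrite ipC ip0 ?mulr0.
have L1x := L1_bilf G Lxy Lx; have L2y := L1_bilf G Ly Lxy; have L3y := L1_bilf G Ly Ly.
have -> : (fun z => bilf G (x z) (x z)) = (fun z => bilf G (y z) (y z)) +
    ((fun z => bilf G (x z - y z) (x z)) + (fun z => bilf G (y z) (x z - y z))).
  by apply/funext => z; rewrite !fctE !(bilfDl, bilfDr, bilfNl, bilfNr); ring.
rewrite intD//; last exact: L1D.
by rewrite intD// e1 e2 !addr0.
Qed.

End mean_square_equality.

(** The bound is quadratic in [e]: a gap of size [e] costs only $e^2$. *)
Lemma mxbound_sandwich (R : realType) n m (G : 'M[R]_(m, n)) (K : 'M[R]_m) (e : R) :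
  (forall i j, `|G i j| <= e) ->
  mxbound (G^T *m K *m G) <= n%:R ^+ 2 * (e ^+ 2 * mxbound K).
Proof.
move=> Ge.
have h i j : `|(G^T *m K *m G) i j| <= e ^+ 2 * mxbound K.
  rewrite mxE (le_trans (ler_norm_sum _ _ _))// /mxbound exchange_big/= mulr_sumr.
  apply: ler_sum => k _; rewrite normrM mxE.
  apply: (@le_trans _ _ ((\sum_l e * `|K l k|) * e)).
    apply: ler_pM => //; apply: le_trans (ler_norm_sum _ _ _) _.
    by apply: ler_sum => l _; rewrite normrM mxE ler_wpM2r.
  by rewrite -mulr_sumr; rewrite mulrC mulrA -expr2.
rewrite {1}/mxbound (le_trans (ler_sum _ (fun i _ => ler_sum _ (fun j _ => h i j))))//.
by rewrite !sumr_const !card_ord -mulrnA -[leLHS]mulr_natl natrM expr2.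
Qed.

(** * The spike variation of the equilibrium candidate *)

Section equilibrium.
Context {R : realType} {d : measure_display} {Omega : measurableType d}.
Variable P : probability Omega R.
Hypothesis P_complete : measure_is_complete P.
Variable W : R -> Omega -> R.
Hypothesis W_brownian : brownian_motion P W.
Local Notation leb := (@lebesgue_measure R).
Local Notation M := (leb \x P)%E.
Variables (n m : nat) (T : R).
Hypothesis T_gt0 : 0 < T.
Variables (A C Q : 'M[R]_n) (B D : 'M[R]_(n, m)) (N : 'M[R]_m).
Hypotheses (Q_psd : psdmx Q) (N_pd : pdmx N).

Local Notation state xi t U X := (vms_process P W t (t + T) xi
  (fun s w => A *m X s w + B *m U s w) (fun s w => C *m X s w + D *m U s w) X).

Definition running_cost t (U : process R Omega m) (X : process R Omega n) : R :=
  \int[M]_z (bilf Q (vcut X t (t + T) z) (vcut X t (t + T) z) +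
    bilf N (vcut U t (t + T) z) (vcut U t (t + T) z)).

Section fixed_control.
Variables (t : R) (xi : Omega -> 'cV[R]_n) (U : process R Omega m).
Hypotheses (t0 : 0 <= t) (axi : forall i, adapted_at P W t (fun w => xi w i 0))
  (Lxi : vL2 P xi) (aU : vadmissible P W t (t + T) U).

Let tT : t <= t + T. Proof. by rewrite lerDl ltW. Qed.
Let LU : vL2 M (vcut U t (t + T)).
Proof. exact: vadmissible_vL2 (lexx _) aU. Qed.

(** Whichever solution the cost is evaluated along, it agrees with [X] in mean
    square by [linear_unique]. *)
Lemma cost_state X : state xi t U X ->
  state_process P W T A B C D t xi U
    (xget (fun _ _ => 0) [set X | state_process P W T A B C D t xi U X]) ->
  cost P W T A B C D Q N t xi U = (running_cost t U X)%:E.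
Proof.
move=> XP; rewrite /cost; set Y := xget _ _ => YP.
have YP' : state xi t U Y by exact: (state_vms P_complete W_brownian t0 axi Lxi aU YP).
have bb : t <= t + T <= t + T by rewrite tT lexx.
have [_ _ _ _ LX] := vms_vL2 XP bb; have [_ _ _ _ LY] := vms_vL2 YP' bb.
rewrite cost_integral//; last exact: pdmx_psdmx.
congr EFin; rewrite /running_cost.
rewrite (intD (L1_bilf Q LY LY) (L1_bilf N LU LU)).
rewrite (intD (L1_bilf Q LX LX) (L1_bilf N LU LU)); congr (_ + _).
apply: int_bilf_eq => //.
exact: (linear_unique P_complete W_brownian tT YP' XP).
Qed.

Lemma cost_state_process X : state_process P W T A B C D t xi U X ->
  cost P W T A B C D Q N t xi U = (running_cost t U X)%:E.
Proof.
move=> XP; apply: cost_state; last by apply: xgetPex; exists X.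
exact: (state_vms P_complete W_brownian t0 axi Lxi aU XP).
Qed.

(** A mean-square solution always bounds the cost. If the state equation has a
    solution with the regularity that the cost asks for, this is [cost_state];
    otherwise the cost is evaluated along the zero state, at which the
    nonnegative state cost is minimal. This avoids proving existence. *)
Lemma cost_le X : state xi t U X ->
  (cost P W T A B C D Q N t xi U <= (running_cost t U X)%:E)%E.
Proof.
move=> XP; have [YP|nY] := pselect (exists Y, state_process P W T A B C D t xi U Y).
  by rewrite (cost_state XP)//; exact: (xgetPex _ YP).
rewrite /cost; set Y := xget _ _.
have -> : Y = (fun _ _ => 0).
  by apply: xgetPN => Y' YP; apply: nY; exists Y'.
have bb : t <= t + T <= t + T by rewrite tT lexx.
have [_ _ _ _ LX] := vms_vL2 XP bb.
have c0 : vcut (fun _ _ => 0 : 'cV[R]_n) t (t + T) = (fun _ : R * Omega => 0).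
  by apply/funext => z; rewrite /vcut scaler0.
have L0 : vL2 M (vcut (fun _ _ => 0 : 'cV[R]_n) t (t + T)).
  move=> i; rewrite c0 (_ : (fun _ => _) = 0); first exact: L2_0.
  by apply/funext => z; rewrite mxE.
rewrite cost_integral//; last exact: pdmx_psdmx.
rewrite lee_fin; apply: le_int.
- by apply: L1D; exact: L1_bilf.
- by apply: L1D; exact: L1_bilf.
move=> z; rewrite c0 bilf0l lerD2r; exact: (Q_psd.2 _).
Qed.

End fixed_control.

Section spike.
Variable Sigma : R -> 'M[R]_n.
Hypothesis Sigma_sol : delayed_riccati_solution T A B C D Q N Sigma.
Local Notation Psi := (riccati_gain B C D N (Sigma 0)).
Variables (t : R) (xi : Omega -> 'cV[R]_n).
Hypothesis t0 : 0 <= t.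
Let b := t + T.
Let tT : t <= t + T. Proof. by rewrite lerDl ltW. Qed.

(** The cost of the feedback, a quadratic function of the initial state. *)
Definition value0 : R := \int[P]_w bilf (Sigma 0) (xi w) (xi w).

Definition deviation (U : process R Omega m) (X : process R Omega n)
    (z : R * Omega) : 'cV[R]_m := vcut U t b z - Psi *m vcut X t b z.

(** The density, on time and outcomes, of the difference between the cost of a
    control and [value0]. *)
Definition excess (U : process R Omega m) (X : process R Omega n) (z : R * Omega) : R :=
  2 * bilf (gap B C D N Psi (Sigma (z.1 - t))) (deviation U X z) (vcut X t b z) +
  bilf (N + D^T *m Sigma (z.1 - t) *m D) (deviation U X z) (deviation U X z).

Lemma running_costE (U : process R Omega m) (X : process R Omega n) :
  vL2 M (vcut U t b) -> state xi t U X ->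
  L1 M (excess U X) /\
  running_cost t U X = value0 + \int[M]_z excess U X z.
Proof.
move=> LU XP.
have rw := riccati_weight_shift T_gt0 Sigma_sol t N_pd.1.
have [L1F E] := cost_identity P_complete W_brownian tT N_pd.1 rw XP LU.
by split=> //; rewrite /running_cost E /value0 subrr.
Qed.

Lemma excess_eq0 (U : process R Omega m) (X : process R Omega n) z :
  deviation U X z = 0 -> excess U X z = 0.
Proof. by rewrite /excess => ->; rewrite !bilf0l mulr0 addr0. Qed.

Lemma deviation_feedback (U : process R Omega m) (X : process R Omega n) z :
  (t < z.1 <= b -> U z.1 z.2 = feedback Psi X z.1 z.2) -> deviation U X z = 0.
Proof.
move=> UX; rewrite /deviation; have [zb|nz] := boolP (t < z.1 <= b); last first.
  by rewrite !vcut0// mulmx0 subrr.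
by rewrite /vcut UX// /feedback -scalemxAr subrr.
Qed.

(** The feedback has no deviation from itself. *)
Lemma running_cost_feedback (X : process R Omega n) :
  vL2 M (vcut (feedback Psi X) t b) -> state xi t (feedback Psi X) X ->
  running_cost t (feedback Psi X) X = value0.
Proof.
move=> LU XP; have [_ ->] := running_costE LU XP.
rewrite (_ : excess _ _ = cst 0) ?Rintegral_cst ?mul0r ?addr0//.
by apply/funext => z; apply: excess_eq0; exact: deviation_feedback.
Qed.

(** Completing the square bounds the excess from below by a quadratic function
    of the gap, and the gap is at most [e] as long as the deviation lasts;
    afterwards the control is the feedback and the excess vanishes. *)
Lemma excess_ge (u : process R Omega m) (X : process R Omega n) eps e z :
  eps < T ->
  (forall r, t <= r -> r < t + eps -> forall i j,
    `|gap B C D N Psi (Sigma (r - t)) i j| <= e) ->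
  - (2 * (n%:R ^+ 2 * (e ^+ 2 * mxbound (invmx N))) * sqnorm (vcut X t (t + eps) z))
   <= excess (spike t eps Psi u X) X z.
Proof.
move=> eT Ge.
have [zb|nz] := boolP (t < z.1 < t + eps); last first.
  rewrite excess_eq0.
    rewrite oppr_le0 mulr_ge0 ?sqnorm_ge0// mulr_ge0// mulr_ge0 ?sqr_ge0//.
    by rewrite mulr_ge0 ?sqr_ge0 ?mxbound_ge0.
  apply: deviation_feedback => /andP[tz _]; rewrite /spike.
  by move: nz; rewrite tz/= => /negbTE ->.
have /andP[tz ze] := zb.
have zb' : z.1 <= b by rewrite (le_trans (ltW ze))// lerD2l ltW.
have -> : vcut X t (t + eps) z = vcut X t b z by rewrite /vcut /window tz zb' (ltW ze).
have [_ Spsd _ _] := Sigma_sol.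
have Sz : psdmx (Sigma (z.1 - t)) by apply: Spsd; rewrite subr_ge0 (ltW tz) lerBlDl.
apply: le_trans (square_lower_bound B C D Psi _ _ N_pd Sz); rewrite lerN2.
apply: le_trans (ler_norm _) _; apply: le_trans (bilf_le_diag _ _) _.
rewrite ler_wpM2r ?sqnorm_ge0// ler_wpM2l//.
by apply: mxbound_sandwich => i j; apply: Ge => //; exact: ltW.
Qed.

(** The excess is supported on the spike, where by [excess_ge] its negative part
    is at most a multiple of $e^2 |X|^2$; over so short an interval the energy of
    the state is of the order of [eps] by [linear_bound]. *)
Lemma running_cost_spike (u : process R Omega m) (X : process R Omega n) eps e :
  0 < eps -> eps < T -> vadmissible P W t b u ->
  vadmissible P W t b (spike t eps Psi u X) ->
  state xi t (spike t eps Psi u X) X ->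
  n%:R * eps * growth A C B D <= 2^-1 ->
  (forall r, t <= r -> r < t + eps -> forall i j,
    `|gap B C D N Psi (Sigma (r - t)) i j| <= e) ->
  value0 - eps * (e ^+ 2 * (2 * (n%:R ^+ 2 * mxbound (invmx N)) * (2 * n%:R *
    (\int[P]_w sqnorm (xi w) + growth A C B D * \int[M]_z sqnorm (vcut u t b z)))))
  <= running_cost t (spike t eps Psi u X) X.
Proof.
set U := spike t eps Psi u X => e0 eT au aU XP small Ge.
have LU := vadmissible_vL2 (lexx _) aU.
have Lu := vadmissible_vL2 (lexx _) au.
have [L1F ->] := running_costE LU XP; rewrite lerD2l.
have te : t <= t + eps <= b by rewrite lerDl (ltW e0) lerD2l ltW.
have teb : t + eps <= b by case/andP: te.
have LUe : vL2 M (vcut U t (t + eps)) by exact: vadmissible_vL2 aU.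
have Lue : vL2 M (vcut u t (t + eps)) by exact: vadmissible_vL2 au.
have [_ _ _ _ LX] := vms_vL2 XP te.
set k := 2 * (n%:R ^+ 2 * (e ^+ 2 * mxbound (invmx N))).
have L1k : L1 M (cst (- k) * (fun z => sqnorm (vcut X t (t + eps) z))).
  exact/L1Z/L1_sqnorm.
have : \int[M]_z (cst (- k) * (fun z => sqnorm (vcut X t (t + eps) z))) z <=
    \int[M]_z excess U X z.
  apply: le_int => // z; rewrite !fctE mulNr.
  exact: excess_ge.
apply: le_trans; rewrite intZ; last exact: L1_sqnorm.
(* on $]t, t + eps]$ the spike and [u] differ only at the final time *)
have EU : \int[M]_z sqnorm (vcut U t (t + eps) z) = \int[M]_z sqnorm (vcut u t (t + eps) z).
  apply: ae_int_eq; [exact: L1_measurable (L1_sqnorm _)|exact: L1_measurable (L1_sqnorm _)|].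
  apply: aeS (null_time P (t + eps)) => z ze.
  congr sqnorm; have [zb|nz] := boolP (t < z.1 <= t + eps); last by rewrite !vcut0.
  rewrite /vcut /U /spike lt_neqAle; case/andP: zb => _ ->; rewrite andbT.
  by move/eqP: ze => ->.
have small' : n%:R * (t + eps - t) * growth A C B D <= 2^-1 by rewrite addrAC subrr add0r.
have := linear_bound P_complete W_brownian XP LUe te small'.
rewrite EU (_ : t + eps - t = eps); last by rewrite addrAC subrr add0r.
have uu : \int[M]_z sqnorm (vcut u t (t + eps) z) <= \int[M]_z sqnorm (vcut u t b z).
  apply: le_int; [exact: L1_sqnorm|exact: L1_sqnorm|] => z.
  have [zb|nz] := boolP (t < z.1 <= t + eps); last first.
    rewrite vcut0// [leLHS](_ : _ = 0) ?sqnorm_ge0//.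
    by rewrite /sqnorm big1// => i _; rewrite mxE expr0n.
  by case/andP: (zb) => tz ze; rewrite /vcut /window zb tz (le_trans ze).
move=> bound; rewrite mulNr lerN2.
have k0 : 0 <= k.
  rewrite /k mulr_ge0// mulr_ge0 ?sqr_ge0//.
  by rewrite mulr_ge0 ?sqr_ge0 ?mxbound_ge0.
apply: (le_trans (ler_wpM2l k0 bound)).
have g0 := growth_ge0 A C B D.
have := ler_wpM2l g0 uu; rewrite -(lerD2l (\int[P]_w sqnorm (xi w))) => uu'.
have c0 : 0 <= k * (2 * (n%:R * eps)) by rewrite mulr_ge0// mulr_ge0// mulr_ge0// ltW.
rewrite [leLHS]mulrA; apply: (le_trans (ler_wpM2l c0 uu')).
by rewrite /k le_eqVlt; apply/orP; left; apply/eqP; ring.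
Qed.

End spike.
End equilibrium.

(** * The equilibrium property *)

Lemma nonneg_limf_einf (R : realType) (f : R -> \bar R) :
  (forall eta : R, 0 < eta -> exists2 r : R, 0 < r &
    forall eps, 0 < eps -> eps < r -> (- eta%:E <= f eps)%E) ->
  (0 <= limf_einf f (0 : R)^'+)%E.
Proof.
move=> h; apply/lee_addgt0Pr => eta eta0; rewrite -leeBlDr// sub0e.
have [r r0 hr] := h _ eta0; rewrite limf_einfE.
apply: (@le_trans _ _ (ereal_inf (f @` [set eps | 0 < eps < r]))).
  by apply: le_ereal_inf_tmp => _ [eps /andP[e0 er] <-]; exact: hr.
apply: ereal_sup_ubound; exists [set eps | 0 < eps < r] => //.
near=> eps; apply/andP; split; near: eps.
  exact: nbhs_right_gt.
exact: nbhs_right_lt.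
Unshelve. all: by end_near. Qed.

Section closed_loop.
Context {R : realType} {d : measure_display} {Omega : measurableType d}.
Variable P : probability Omega R.
Hypothesis P_complete : measure_is_complete P.
Variable W : R -> Omega -> R.
Hypothesis W_brownian : brownian_motion P W.
Variables (n m : nat) (A C : 'M[R]_n) (B D : 'M[R]_(n, m)) (Psi : 'M[R]_(m, n)).

(** On $[0, b]$ the closed loop is an Ito process; restarted at [t], it is the
    state driven by the feedback control along itself. *)
Lemma closed_loop_restart x (X : process R Omega n) t b : 0 <= t -> t <= b ->
  closed_loop P W A B C D Psi x X ->
  [/\ forall i, adapted_at P W t (fun w => X t w i 0), vL2 P (X t),
    vadmissible P W t b (feedback Psi X) &
    vms_process P W t b (X t)
      (fun s w => A *m X s w + B *m feedback Psi X s w)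
      (fun s w => C *m X s w + D *m feedback Psi X s w) X].
Proof.
move=> t0 tb cX; have b0 : 0 <= b by exact: le_trans tb.
have XP := cX b b0; have [LX _ _] := XP.
have aX i := L2F_admissible P_complete W_brownian i LX.
have XP' i : ms_process P W 0 b (fun w => x i 0)
    (comp (fun s w => A *m X s w + B *m feedback Psi X s w) i)
    (comp (fun s w => C *m X s w + D *m feedback Psi X s w) i) (comp X i).
  have h (F : 'M[R]_n) (G : 'M[R]_(n, m)) : comp (fun s w => F *m X s w + G *m feedback Psi X s w) i =
      comp (fun s w => (F + G *m Psi) *m X s w) i.
    apply/funext => s; apply/funext => w.
    by rewrite /comp /feedback mulmxDl mulmxA.
  rewrite !h; apply: (ito_process_comp P_complete W_brownian _ _ _ _ XP) => //.
  - exact: measurable_cst.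
  - exact: L2_cst.
  - by apply: admissible_mulmx.
split.
- by move=> i; apply: (aX i).2; rewrite t0.
- by move=> i; apply: (ms_value_L2 (XP' i)); rewrite t0.
- by move=> i; apply: admissible_mulmx => j; exact: admissibleS (aX j).
move=> i; apply: (ms_restart P_complete W_brownian t0 tb _ _ (XP' i)).
  by apply: (aX i).2; rewrite t0.
move=> s /andP[ts sb]; apply: (adapted_measurable P_complete W_brownian).
by apply: (aX i).2; rewrite (le_trans t0).
Qed.

Lemma spike_admissible t eps T (u : process R Omega m) (X : process R Omega n) :
  vadmissible P W t (t + T) u -> L2F P W `[t, (t + T)%R] X ->
  vadmissible P W t (t + T) (spike t eps Psi u X).
Proof.
move=> au LX i.
rewrite (_ : comp _ _ = (fun s w => if s < t + eps then comp u i s w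
   else comp (feedback Psi X) i s w)).
  apply: admissible_if => //; apply: admissible_mulmx => j.
  exact: (L2F_admissible P_complete W_brownian).
by apply/funext => s; apply/funext => w; rewrite /comp /spike; case: ifP.
Qed.

End closed_loop.

Theorem theorem3p3 (R : realType) (d : measure_display)
    (Omega : measurableType d) (P : probability Omega R)
    (P_complete : measure_is_complete P)
    (W : R -> Omega -> R) (W_brownian : brownian_motion P W)
    (n m : nat) (T : R) (T_gt0 : 0 < T)
    (A C : 'M[R]_n) (B D : 'M[R]_(n, m))
    (Q : 'M[R]_n) (Q_psd : psdmx Q) (Rw : 'M[R]_m) (Rw_pd : pdmx Rw)
    (Sigma : R -> 'M[R]_n)
    (Sigma_sol : delayed_riccati_solution T A B C D Q Rw Sigma) :
  equilibrium_strategy P W T A B C D Q Rw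
    (riccati_gain B C D Rw (Sigma 0)).
Proof.
set Psi := riccati_gain B C D Rw (Sigma 0).
move=> x Xbar cX t t0 u Lu Xeps stX.
have tT : t <= t + T by rewrite lerDl ltW.
have [axi Lxi aF FP] := closed_loop_restart P_complete W_brownian t0 tT cX.
have au : vadmissible P W t (t + T) u.
  by move=> i; apply: (L2F_admissible P_complete W_brownian); exact: L2F_restrict Lu.
have LF := vadmissible_vL2 (lexx _) aF.
have cF := cost_le P_complete W_brownian T_gt0 Q_psd Rw_pd t0 axi Lxi aF FP.
rewrite (running_cost_feedback P_complete W_brownian T_gt0 Rw_pd Sigma_sol LF FP) in cF.
set V := value0 _ _ _ in cF.
set g := growth A C B D.
set K := 2 * (n%:R ^+ 2 * mxbound (invmx Rw)) * (2 * n%:R *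
  (\int[P]_w sqnorm (Xbar t w) + g *
   \int[(@lebesgue_measure R \x P)%E]_z sqnorm (vcut u t (t + T) z))).
have g0 : 0 <= g by exact: growth_ge0.
have K0 : 0 <= K.
  rewrite mulr_ge0//.
    by rewrite mulr_ge0// mulr_ge0 ?sqr_ge0 ?mxbound_ge0.
  rewrite mulr_ge0// addr_ge0//; first by apply: Rintegral_ge0 => w _; exact: sqnorm_ge0.
  by rewrite mulr_ge0//; apply: Rintegral_ge0 => w _; exact: sqnorm_ge0.
apply: nonneg_limf_einf => eta eta0.
have K1 : 0 < 1 + K by rewrite ltr_wpDr.
(* a bound of the gap for which the loss $e^2 K$ per unit of time is at most [eta] *)
pose e := Num.min 1 (eta / (1 + K)).
have e0 : 0 < e by rewrite lt_min ltr01/= divr_gt0.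
have eK : e ^+ 2 * K <= eta.
  have e1 : e <= 1 by rewrite ge_min lexx.
  have eE : e * (1 + K) <= eta by rewrite -ler_pdivlMr// ge_min lexx orbT.
  apply: le_trans eE; apply: ler_pM => //; first exact: sqr_ge0.
    by rewrite expr2 ler_piMl// ltW.
  by rewrite lerDr.
have [dlt dlt0 hd] := gap_cvg0 T_gt0 Sigma_sol t e0 Rw_pd.
have ng0 : 0 <= n%:R * g by rewrite mulr_ge0.
have ng1 : 0 < 1 + n%:R * g by rewrite ltr_wpDr.
exists (Num.min T (Num.min dlt (2^-1 / (1 + n%:R * g)))).
  by rewrite !lt_min T_gt0 dlt0/= divr_gt0// invr_gt0.
move=> eps eps0; rewrite !lt_min => /and3P[eT ed en].
have st := stX eps; rewrite eps0 eT in st; have {}st := st isT.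
have aS : vadmissible P W t (t + T) (spike t eps Psi u (Xeps eps)).
  by apply: (spike_admissible P_complete W_brownian) => //; have [] := st.
rewrite (cost_state_process P_complete W_brownian T_gt0 Q_psd Rw_pd t0 axi Lxi aS st).
have SP := state_vms P_complete W_brownian t0 axi Lxi aS st.
have small : n%:R * eps * g <= 2^-1.
  rewrite mulrAC; apply: (@le_trans _ _ ((1 + n%:R * g) * eps)).
    by rewrite ler_wpM2r ?lerDr// ltW.
  by rewrite mulrC -ler_pdivlMr// ltW.
have Ge r : t <= r -> r < t + eps -> forall i j,
    `|gap B C D Rw Psi (Sigma (r - t)) i j| <= e.
  move=> tr re; apply: hd => //; first by rewrite (lt_trans re)// ltrD2l.
  by rewrite (le_trans (ltW re))// lerD2l ltW.
have := running_cost_spike P_complete W_brownian T_gt0 Rw_pd Sigma_sol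
  eps0 eT au aS SP small Ge.
rewrite -/V -/K => lb.
apply: (@le_trans _ _ ((running_cost P T Q Rw t (spike t eps Psi u (Xeps eps)) (Xeps eps)
   - V) * eps^-1)%:E).
  rewrite -EFinN lee_fin ler_pdivlMr// mulNr lerBrDr addrC.
  apply: le_trans lb; rewrite lerD2l lerN2 mulrC.
  by rewrite ler_wpM2r// ltW.
rewrite EFinM EFinB; apply: lee_wpmul2r; first by rewrite lee_fin invr_ge0 ltW.
exact: leeB.
Qed.
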